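(* There is an algorithm that, given a $P_7$-free chordal graph $G$ with $n$ vertices and $m$ edges, enumerates the set $\mathcal{D}(G)$ of all minimal dominating sets of $G$ (each exactly once) with $O(n+m)$ delay, using $O(n^2)$ space and $O(n^2)$ preprocessing time.
   Context: All graphs are finite, simple and undirected. For a vertex $x$, $N[x]$ is its closed neighbourhood; for $X\subseteq V(G)$, $N[X]=\bigcup_{x\in X}N[x]$. A set $D$ dominates $G$ if $N[D]=V(G)$; a minimal dominating set is an inclusion-minimal dominating set, and $\mathcal{D}(G)$ denotes the set of all of them. $P_k$ denotes an induced path on $k$ vertices; a graph is $P_k$-free if it has no induced $P_k$, and chordal if it has no induced cycle of length at least four. The delay of an enumeration algorithm is the maximum time elapsed before the first output, between two consecutive outputs, and after the last output until termination. *)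

(* Defs.v *)
From mathcomp Require Import all_boot.

Set Implicit Arguments.
Unset Strict Implicit.
Unset Printing Implicit Defensive.

(** * Graphs *)

(* The vertex set is 'I_n, so that a vertex is already a machine word. *)
Record sgraph (n : nat) := SGraph {
  adj :> rel 'I_n;
  adj_sym : symmetric adj;
  adj_irrefl : irreflexive adj
}.

Section Graphs.
Variable n : nat.
Implicit Types (G : sgraph n) (x y : 'I_n) (D X : {set 'I_n}).

(* Each edge is counted once, through its increasing orientation. *)
Definition edges G : {set 'I_n * 'I_n} :=
  [set p : 'I_n * 'I_n | (p.1 < p.2) && adj G p.1 p.2].

Definition closed_nbhd G x : {set 'I_n} := [set y | (y == x) || adj G x y].

Definition closed_nbhds G X : {set 'I_n} := \bigcup_(x in X) closed_nbhd G x.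

Definition dominating G D : bool := closed_nbhds G D == [set: 'I_n].

Definition min_dom_sets G : {set {set 'I_n}} :=
  [set D | minset (dominating G) D].

Definition induced_copy k (r : rel 'I_k) G : Prop :=
  exists f : 'I_k -> 'I_n,
    injective f /\ forall i j, adj G (f i) (f j) = r i j.

Definition path_rel k : rel 'I_k :=
  fun i j => (i.+1 == j :> nat) || (j.+1 == i :> nat).

(* ordS is the cyclic successor; this is the k-cycle only for 3 <= k. *)
Definition cycle_rel k : rel 'I_k :=
  fun i j => (ordS i == j) || (ordS j == i).

Definition path_free k G : Prop := ~ induced_copy (@path_rel k) G.

Definition chordal G : Prop :=
  forall k, 4 <= k -> ~ induced_copy (@cycle_rel k) G.

End Graphs.

(** * Random access machines

   A word RAM with unit-cost instructions: finitely many registers (those named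
   in the program), a word-addressed memory, and a write-only output tape.
   The bound on word length is imposed by [fits] below. *)

Inductive binop := Add | Sub | Mul | Div | Mod.

(* Natural number operations: Sub is truncated, x / 0 = 0 and x mod 0 = x. *)
Definition eval_binop (o : binop) : nat -> nat -> nat :=
  match o with
  | Add => addn | Sub => subn | Mul => muln | Div => divn | Mod => modn
  end.

(* x, y, z are register names and l is a position in the program. *)
Inductive instr :=
| Const  (x v : nat)                (* x := v *)
| Op     (o : binop) (x y z : nat)  (* x := y o z *)
| Fetch  (x y : nat)                (* x := ram[y] *)
| Store  (x y : nat)                (* ram[x] := y *)
| Jump   (l : nat)
| JumpEq (x y l : nat)              (* if x = y goto l *)
| JumpLt (x y l : nat)              (* if x < y goto l *)
| Write  (x : nat)                  (* append the word x to the current output *)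
| Emit.                             (* complete the current output *)

Definition program := seq instr.

Record config := Config {
  pc    : nat;
  reg   : nat -> nat;
  ram   : nat -> nat;
  clock : nat;                    (* number of instructions executed so far *)
  buf   : seq nat;                (* words written since the last Emit *)
  out   : seq (nat * seq nat)     (* completed outputs, in chronological order,
                                     each with its completion time *)
}.

Definition exec (i : instr) (c : config) : config :=
  let: Config p r m t b s := c in
  match i with
  | Const x v    => Config p.+1 [eta r with x |-> v] m t.+1 b s
  | Op o x y z   =>
      Config p.+1 [eta r with x |-> eval_binop o (r y) (r z)] m t.+1 b s
  | Fetch x y    => Config p.+1 [eta r with x |-> m (r y)] m t.+1 b s
  | Store x y    => Config p.+1 r [eta m with r x |-> r y] t.+1 b s
  | Jump l       => Config l r m t.+1 b s
  | JumpEq x y l => Config (if r x == r y then l else p.+1) r m t.+1 b s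
  | JumpLt x y l => Config (if r x < r y then l else p.+1) r m t.+1 b s
  | Write x      => Config p.+1 r m t.+1 (rcons b (r x)) s
  | Emit         => Config p.+1 r m t.+1 [::] (rcons s (t.+1, b))
  end.

(* The machine halts when the program counter leaves the program. *)
Definition step (P : program) (c : config) : option config :=
  omap (exec^~ c) (onth P (pc c)).

Definition run (P : program) (t : nat) (c : config) : option config :=
  iter t (obind (step P)) (Some c).

(* The order n is in register 0 and the adjacency matrix is stored row by row
   from address 0; all other words are 0. *)
Definition input n (G : sgraph n) : config := {|
  pc := 0;
  reg := [eta (fun=> 0) with 0 |-> n];
  ram := fun a =>
    [exists i : 'I_n, exists j : 'I_n, (a == i * n + j) && adj G i j];
  clock := 0;
  buf := [::];
  out := [::]
|}.

(* Memory holds no information from address [space] on, and no word exceeds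
   [word].  The output tape cannot be read back and is not counted as space. *)
Definition fits (space word : nat) (c : config) : Prop :=
  [/\ forall a, space <= a -> ram c a = 0,
      forall a, ram c a <= word
    & forall x, reg c x <= word].

(* The word sequence w lists the elements of D, each once, in any order. *)
Definition lists n (w : seq nat) (D : {set 'I_n}) : bool :=
  perm_eq w [seq nat_of_ord x | x in D].

(* Started on c0, the program P halts having output exactly the members of F,
   each once.  Preprocessing ends at some time p <= prep; from then on, the
   time to the first output, between consecutive outputs, and from the last
   output to termination is at most delay. *)
Definition enumerates (P : program) (c0 : config) n (F : {set {set 'I_n}})
    (prep delay space word : nat) : Prop :=
  (forall t c, run P t c0 = Some c -> fits space word c) /\
  exists (T : nat) (c : config) (s : seq {set 'I_n}) (p : nat),
    [/\ run P T c0 = Some c /\ step P c = None,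
        perm_eq s (enum F),
        buf c = [::] /\ all2 (@lists n) (unzip2 (out c)) s,
        p <= prep
      & path (fun t t' => t <= t' <= t + delay) p (rcons (unzip1 (out c)) T)].

(* Main.v *)
Require Import Defs.
From mathcomp Require Import all_boot zify.

(* Call a vertex far if no simplicial vertex is in its closed neighbourhood, and
   let the base consist of the simplicial vertices of G and of those of the graph
   induced by the far vertices.  It induces a disjoint union of cliques and, as G
   is P7-free and chordal, every N[v] contains N[u] for some u in the base.  So a
   set is dominating as soon as it dominates the base, and a minimal dominating
   set is a set A of vertices outside the base together with exactly one vertex
   in each clique of the base that A does not entirely dominate.  The sets A that
   occur are those in which every element is the only one to dominate some base
   vertex u, while it dominates the whole clique of u.  This condition is
   hereditary, so every node of the binary search that decides first the outer
   vertices, then those of the base, leads to a solution; with counters kept for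
   each base vertex and each element of A, the decision on v takes O(|N[v]|)
   steps.  Between two outputs each vertex is decided a bounded number of times,
   hence the linear delay.  Simplicial vertices are found in quadratic time from
   maximum cardinality searches.  The algorithm is written in a small structured
   language, which is compiled to the random access machine. *)

Set Implicit Arguments.
Unset Strict Implicit.
Unset Printing Implicit Defensive.

(** * The base of a P7-free chordal graph *)

(** The difficulty is to spend on a decision no more than the neighbourhood of the vertex decided,
    although one addition to A may take private vertices away from many elements. Keeping the sum of
    the dominators beside their number solves this: when the number is 1 the sum names the only
    dominator, and no list has to be searched or updated. An addition is tested by performing it,
    and it is undone in the same time if a counter falls to zero. That P7 is excluded is used in two
    places: a vertex whose closed neighbourhood is minimal, outside the base, would be the middle of
    an induced P7, and so would a vertex of a clique that a minimal dominating set covers in the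
    wrong way. Both paths are verified locally, by pairs two steps apart. The delay follows from a
    potential on 2n positions, [v] and [n + v] for each vertex [v]. The word bound 16(n+1)^2 covers
    the addresses, below (3n+16)n for three matrices and a few vectors, and the sums, at most n^2.
    Time is bounded apart from correctness, by a syntactic cost of commands whose loops all run up
    to one fixed variable. *)

Section Chordal.
Variables (n : nat) (G : sgraph n).
Implicit Types (x y z u v : 'I_n) (f : nat -> 'I_n).

Definition nb : rel 'I_n := fun x y => (y == x) || adj G x y.

Lemma nb_refl x : nb x x.
Proof. by rewrite /nb eqxx. Qed.

Lemma nb_sym x y : nb x y = nb y x.
Proof. by rewrite /nb eq_sym adj_sym. Qed.

Lemma adj_nb x y : adj G x y -> nb x y.
Proof. by rewrite /nb orbC => ->. Qed.

Lemma nb_adj x y : nb x y -> x != y -> adj G x y.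
Proof. by case/orP => // /eqP ->; rewrite eqxx. Qed.

(** A vertex that sees only one of [x] and [y] proves them distinct; this turns closed adjacency
    into adjacency in the seven-vertex walks below. *)
Lemma sep_adj z x y : nb x y -> nb x z != nb y z -> adj G x y.
Proof. by move=> xy; apply: contraNT => /(contraNeq (nb_adj xy)) ->. Qed.

(** Only pairs two steps apart are constrained. In a chordal graph this local condition already
    makes the walk an induced path. *)
Definition walk f k :=
  (forall i, i < k -> adj G (f i) (f i.+1)) /\
  (forall i, i.+1 < k -> ~~ nb (f i) (f i.+2)).

Hypothesis chG : chordal G.

(* A closest pair of non-consecutive adjacent vertices would close an induced
   cycle. *)
Lemma walk_induced f k : walk f k ->
  forall i j, i.+1 < j -> j <= k -> ~~ nb (f i) (f j).
Proof.
move=> [W1 W2] i j ij; have -> : j = i + (j - i) by lia.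
have : 1 < j - i by lia.
move: (j - i) => g {j ij}; elim/ltn_ind: g i => g IH i g2 gk.
have [g2' | g3] : (g = 2) \/ 2 < g by lia.
  by rewrite g2' addn2; apply: W2; lia.
(* If the ends coincide, the vertex before the last is adjacent to [f i], against the induction
   hypothesis for the gap [g.-1]. If they are adjacent, the [g.+1] vertices form an induced
   cycle. *)
apply/negP => /orP [/eqP Ei | A].
  have : ~~ nb (f i) (f (i + g.-1)) by apply: IH; lia.
  case/negP; rewrite nb_sym adj_nb // -[X in adj G _ X]Ei.
  have -> : i + g = (i + g.-1).+1 by lia.
  by apply: W1; lia.
have N a b : a < b -> b <= g -> a.+1 != b -> (a, b) != (0, g) ->
    ~~ nb (f (i + a)) (f (i + b)).
  move=> ab bg nab; rewrite xpair_eqE negb_and => n0.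
  have -> : i + b = i + a + (b - a) by lia.
  by apply: IH; lia.
have E a : a < g -> adj G (f (i + a)) (f (i + a.+1)).
  by move=> ag; rewrite addnS; apply: W1; lia.
apply: (chG (k := g.+1)); first by lia.
exists (fun a => f (i + a)).
have sy (P : 'I_g.+1 -> 'I_g.+1 -> Prop) :
    (forall a b, P a b -> P b a) -> (forall a, P a a) ->
    (forall a b : 'I_g.+1, a < b -> P a b) -> forall a b, P a b.
  move=> s r h a b; case: (ltngtP a b) => [||/val_inj ->]; auto.
have oS (a : 'I_g.+1) : val (ordS a) = if a < g then a.+1 else 0.
  rewrite /=; case: ltnP => h; first by rewrite modn_small.
  by have -> : a = g :> nat by [have := ltn_ord a; lia]; rewrite modnn.
split; last first.
  apply: sy => [a b h | a | a b ab].
  - by rewrite adj_sym h /cycle_rel orbC.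
  - rewrite adj_irrefl /cycle_rel orbb; apply/esym/negbTE.
    by rewrite -val_eqE oS /=; case: ifP => ?; lia.
  rewrite /cycle_rel -!val_eqE !oS /=.
  have bg : b <= g by rewrite -ltnS.
  rewrite (leq_trans ab bg).
  case: (eqVneq a.+1 b) => [e | ne] /=; first by rewrite -e E //; lia.
  case: (eqVneq (val a, val b) (0, g)) => [[-> ->] | n0].
    by rewrite addn0 A ltnn.
  have := N _ _ ab bg ne n0; rewrite negb_or => /andP [_ /negbTE ->].
  by apply/esym/negbTE; move: n0; rewrite xpair_eqE /=; case: ifP => ?; lia.
apply: sy => [a b h /esym /h // | // | a b ab Eab].
have bg : b <= g by rewrite -ltnS.
case: (eqVneq a.+1 b) => [e | ne].
  have /E : a < g by lia.
  by rewrite e Eab adj_irrefl.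
case: (eqVneq (val a, val b) (0, g)) => [[Ea Eb] | n0].
  by move: A; rewrite -[i in f i]addn0 -Ea Eab Eb adj_irrefl.
by have := N _ _ ab bg ne n0; rewrite Eab nb_refl.
Qed.

Lemma walk_path f k : walk f k -> induced_copy (@path_rel k.+1) G.
Proof.
move=> W; have Ni := walk_induced W; have [W1 _] := W.
exists (fun i => f i); split=> i j.
  move=> E; apply: val_inj; move: E; case: (ltngtP i j) => // [] h E.
  - case: (ltnP i.+1 j) => [h' | h'].
      by have := Ni i j h'; rewrite E nb_refl -ltnS => /(_ (ltn_ord j)).
    have /W1 : i < k by have := ltn_ord j; lia.
    by rewrite (_ : i.+1 = j) ?E ?adj_irrefl //; lia.
  - case: (ltnP j.+1 i) => [h' | h'].
      by have := Ni j i h'; rewrite E nb_refl -ltnS => /(_ (ltn_ord i)).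
    have /W1 : j < k by have := ltn_ord i; lia.
    by rewrite (_ : j.+1 = i) ?E ?adj_irrefl //; lia.
have nadj a b : a.+1 < b -> b <= k -> adj G (f a) (f b) = false.
  by move=> h h'; apply: contraNF (Ni a b h h') => /adj_nb.
have := ltn_ord i; have := ltn_ord j; rewrite !ltnS /path_rel => jk ik.
case: (ltngtP i j) => h.
- case: (eqVneq i.+1 j) => [<- | ne] /=; first by rewrite W1 //; lia.
  by rewrite nadj; lia.
- case: (eqVneq j.+1 i) => [<- | ne] /=; first by rewrite orbT adj_sym W1 //; lia.
  by rewrite adj_sym nadj; lia.
- by rewrite h adj_irrefl; lia.
Qed.

(** The ten other non-adjacencies of an induced P7, and the distinctness of its vertices, come from
    chordality through [walk_path]. *)
Lemma no_walk7 a b c d e g h : path_free 7 G ->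
  adj G a b -> adj G b c -> adj G c d -> adj G d e -> adj G e g -> adj G g h ->
  ~~ nb a c -> ~~ nb b d -> ~~ nb c e -> ~~ nb d g -> ~~ nb e h -> False.
Proof.
move=> P7 ab bc cd de eg gh ac bd ce dg eh; apply: P7.
apply: (@walk_path (nth a [:: a; b; c; d; e; g; h]) 6); split.
  by do 6![case=> //].
by do 5![case=> //].
Qed.

(* The four-point property of the orders produced by maximum cardinality search. *)
Definition search_order (pos : 'I_n -> nat) := forall u b x,
  pos u < pos b -> pos b < pos x -> nb x u -> ~~ nb b u ->
  exists t, [/\ pos t < pos b, nb b t & ~~ nb x t].

(* No walk has all its interior after both of its ends: if the later end b of a
   shortest counterexample were reached, the search order would provide a
   neighbour t of b, chosen even earlier, to which the walk can be rerouted. *)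
Lemma search_order_walk pos : injective pos -> search_order pos ->
  forall f k, 1 < k -> walk f k ->
  (forall i, 0 < i -> i < k -> maxn (pos (f 0)) (pos (f k)) < pos (f i)) ->
  False.
Proof.
move=> pos_inj so f k.
have [m] := ubnP (maxn (pos (f 0)) (pos (f k))).
elim: m f k => // m IH f k lem k1 W late.
wlog lt0k : f lem W late / pos (f 0) < pos (f k).
  move=> H; case: (ltngtP (pos (f 0)) (pos (f k))) => h; first exact: (H f).
  - apply: (H (fun i => f (k - i))); rewrite ?subn0 ?subnn //.
    + by rewrite maxnC.
    + have [W1 W2] := W; split=> i ik.
        have -> : k - i = (k - i.+1).+1 by lia.
        by rewrite adj_sym; apply: W1; lia.
      have -> : k - i = (k - i.+2).+2 by lia.
      by rewrite nb_sym; apply: W2; lia.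
    + by move=> i i0 ik; rewrite maxnC; apply: late; lia.
  - by have := walk_induced W (i := 0) (j := k) k1 (leqnn k); rewrite (pos_inj _ _ h) nb_refl.
have [W1 W2] := W.
move: lem late; rewrite (maxn_idPr (ltnW lt0k)) => lem late.
have n0k := walk_induced W (i := 0) (j := k) k1 (leqnn k).
have [t [tb bt n1t]] : exists t, [/\ pos t < pos (f k), nb (f k) t & ~~ nb (f 1) t].
  apply: so lt0k _ _ _; first by apply: late.
    by rewrite nb_sym adj_nb // W1; lia.
  by rewrite nb_sym.
have n0t : ~~ nb (f 0) t.
  (* Otherwise [t] followed by the whole walk is a walk, hence induced, although its ends [t] and
     [f k] are adjacent. *)
  apply/negP => n0t.
  have W' : walk (fun i => if i is i'.+1 then f i' else t) k.+1.
    split=> [[|i] ik | [|i] ik]; last 3 first.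
    - by apply: W1.
    - by rewrite nb_sym.
    - by apply: W2.
    apply: nb_adj; first by rewrite nb_sym.
    by apply: contraNneq n0k => <-; rewrite nb_sym.
  by have := walk_induced W' (i := 0) (j := k.+1) (ltnW k1) (leqnn _); rewrite nb_sym bt.
(* The new walk is [f 0], ..., [f j], [t], leaving at the first vertex that sees [t]. Its interior
   is not before [f k], hence after both of its ends, and the later of these ends comes before
   [f k]. *)
have [j jt jmin] : exists2 j, nb (f j) t & forall i, i < j -> ~~ nb (f i) t.
  have ex : exists j, nb (f j) t by exists k.
  by case: (ex_minnP ex) => j jt jm; exists j => // i; rewrite ltnNge; apply: contra => /jm.
have jk : j <= k by rewrite leqNgt; apply: contraL bt => /jmin.
have j2 : 1 < j by case: j jt {jmin jk} => [|[]] //; rewrite ?(negbTE n0t) ?(negbTE n1t).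
have jpos i : 0 < i -> i <= j -> pos (f k) <= pos (f i).
  move=> i0 ij; case: (ltngtP i k) => ik; last by rewrite ik.
    by rewrite ltnW ?late.
  by lia.
apply: (IH (fun i => if i <= j then f i else t) j.+1); rewrite ?leq0n ?ltnn; try lia.
- split=> i ij.
    case: (ltngtP i j) => h /=; [by apply: W1; lia | by lia|].
    rewrite h; apply: nb_adj => //; apply: contraTneq tb => <-.
    by rewrite -leqNgt jpos //; lia.
  have -> : i <= j by lia.
  by case: (ltngtP i.+1 j) => h; [apply: W2; lia | lia | apply: jmin; lia].
- move=> i i0 ij; rewrite (_ : i <= j); last by lia.
  by have := jpos i i0; lia.
Qed.

(** The reversed order is a perfect elimination order: if [y] and [z] were not adjacent, [y], [x],
    [z] would be a walk with its interior after both ends. *)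
Lemma search_order_clique pos : injective pos -> search_order pos ->
  forall x y z, pos y < pos x -> pos z < pos x -> nb x y -> nb x z -> nb y z.
Proof.
move=> pos_inj so x y z yx zx xy xz; apply/negPn/negP => nyz.
apply: (@search_order_walk pos pos_inj so (nth y [:: y; x; z]) 2) => //.
  split=> [[|[]] | []] //= _; apply: nb_adj; rewrite // 1?nb_sym //.
    by apply: contraTneq yx => ->; rewrite ltnn.
  by apply: contraTneq zx => ->; rewrite ltnn.
by case=> [|[]] //= _ _; rewrite gtn_max yx.
Qed.

End Chordal.

(** * Maximum cardinality search and the orders that it produces *)

Section SearchOrders.
Variables (n : nat) (G : sgraph n).
Implicit Types (u v x : 'I_n) (pos : 'I_n -> nat).

(* pos v = 0 means that v has not been visited yet. *)
Definition search_prefix t pos :=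
  [/\ #|[set v | 0 < pos v]| = t, forall v, pos v <= t,
      forall u v, 0 < pos u -> pos u = pos v -> u = v
    & forall u b x, 0 < pos u -> pos u < pos b -> pos x = 0 \/ pos b < pos x ->
      nb G x u -> ~~ nb G b u ->
      exists s, [/\ 0 < pos s, pos s < pos b, nb G b s & ~~ nb G x s]].

Definition weight pos x := #|[set u | (0 < pos u) && nb G x u]|.

Lemma search_prefix0 pos : (forall v, pos v = 0) -> search_prefix 0 pos.
Proof.
move=> p0; split=> [|v|u v|u b x]; rewrite ?p0 //.
by apply/eqP; rewrite cards_eq0; apply/eqP/setP=> v; rewrite !inE p0.
Qed.

(** Maximality of the weight gives the four-point property at [b]: an unvisited [x] that sees a
    visited [u] missed by [b] cannot also see every visited neighbour of [b], since its weight would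
    then be larger. *)
Lemma search_prefix_step t pos pos' b : search_prefix t pos -> pos b = 0 ->
  (forall x, pos x = 0 -> weight pos x <= weight pos b) ->
  (forall v, pos' v = if v == b then t.+1 else pos v) ->
  search_prefix t.+1 pos'.
Proof.
move=> [card_t le_t inj so] b0 max_b E.
have Eb : pos' b = t.+1 by rewrite E eqxx.
have EN v : v != b -> pos' v = pos v by rewrite E => /negbTE ->.
have gtb v : 0 < pos v -> pos' v = pos v by case: (eqVneq v b) => [->|/EN //]; rewrite b0.
split.
- have -> : [set v | 0 < pos' v] = b |: [set v | 0 < pos v].
    by apply/setP=> v; rewrite !inE E; case: eqP.
  by rewrite cardsU1 inE b0 card_t.
- by move=> v; rewrite E; case: eqP => // _; apply: leqW.
- move=> u v; rewrite !E; case: eqP => [->|_]; case: eqP => [->|_] //; last exact: inj.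
    by move=> _ e; have := le_t v; rewrite -e ltnn.
  by move=> _ e; have := le_t u; rewrite e ltnn.
move=> u c x u0 uc hx xu ncu.
case: (eqVneq c b) => [Ec | cb]; last first.
  have c0 : 0 < pos c by rewrite -(EN _ cb) (leq_trans _ uc).
  have ub : u != b by apply: contraTneq uc => ->; rewrite Eb (EN _ cb) -leqNgt leqW.
  have [s [s0 sc cs xs]] : exists s, [/\ 0 < pos s, pos s < pos c, nb G c s & ~~ nb G x s].
    apply: so xu ncu; rewrite -?(EN _ ub) -?(EN _ cb) //.
    by case: (eqVneq x b) hx => [-> | /EN ->]; first by left.
  by exists s; rewrite gtb // (EN _ cb).
have ub : u != b by apply: contraTneq uc => ->; rewrite Ec ltnn.
have xb : pos x = 0.
  case: hx; first by rewrite E; case: eqP.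
  rewrite Ec Eb E; case: eqP => [_|_]; first by rewrite ltnn.
  by move=> h; have := leq_trans h (le_t x); lia.
have u0' : 0 < pos u by rewrite -(EN _ ub).
have : ~~ ([set s | (0 < pos s) && nb G b s] \subset [set s | (0 < pos s) && nb G x s]).
  apply/negP => sub; have /eqP eqs : [set s | (0 < pos s) && nb G b s] ==
     [set s | (0 < pos s) && nb G x s] by rewrite eqEcard sub; apply: max_b.
  have : u \in [set s | (0 < pos s) && nb G x s] by rewrite inE u0' xu.
  by rewrite -eqs inE -Ec (negbTE ncu) andbF.
case/subsetPn => s; rewrite !inE => /andP [s0 bs]; rewrite s0 /= => xs.
by exists s; rewrite Ec Eb gtb // ltnS le_t.
Qed.

Lemma search_prefix_full pos : search_prefix n pos ->
  [/\ forall v, 0 < pos v, injective pos & search_order G pos].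
Proof.
move=> [card_n le_n inj so].
have p0 v : 0 < pos v.
  have /eqP E : [set v | 0 < pos v] == setT by rewrite eqEcard subsetT cardsT card_ord card_n leqnn.
  by move/setP/(_ v): E; rewrite !inE.
split=> // [u v | u b x ub bx xu bu]; first exact: inj.
by have [s [_ sb bs xs]] := so u b x (p0 u) ub (or_intror bx) xu bu; exists s.
Qed.

Lemma search_prefix_unvisited t pos : search_prefix t pos -> t < n ->
  exists v, pos v == 0.
Proof.
move=> [card_t _ _ _] tn; apply/existsP; rewrite -[[exists v, _]]negbK.
apply/negP => /existsPn ne.
suff : t = n by move: tn; lia.
rewrite -card_t -[RHS]card_ord -cardsT; congr #|pred_of_set _|.
by apply/setP=> v; rewrite !inE lt0n ne.
Qed.

(** All weights are zero at the start, so the search may begin anywhere; [simplicial_beyond] relies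
    on this freedom. Positions count from 1, as 0 means unvisited. *)
Lemma search_order_from v : exists pos,
  [/\ injective pos, search_order G pos & forall u, pos v <= pos u].
Proof.
suff [pos [spos pv]] : exists pos, search_prefix n pos /\ pos v = 1.
  have [p0 inj so] := search_prefix_full spos.
  by exists pos; split=> // u; rewrite pv.
have n0 : 0 < n by apply: leq_ltn_trans (ltn_ord v).
suff H t : 0 < t -> t <= n -> exists pos, search_prefix t pos /\ pos v = 1 by apply: H.
elim: t => // t IH _ tn; case: t IH tn => [_ tn | t IH tn].
  exists (fun u => if u == v then 1 else 0); rewrite eqxx; split=> //.
  apply: (search_prefix_step (pos := fun=> 0) (b := v)) => //.
  exact: search_prefix0.
have [pos [spos pv]] := IH isT (ltnW tn).
have [c c0] := search_prefix_unvisited spos tn.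
case: (@arg_maxnP _ c (fun x => pos x == 0) (weight pos) c0) => b /eqP b0 max_b.
exists (fun u => if u == b then t.+2 else pos u); split.
  by apply: (search_prefix_step spos b0) => // x /eqP; apply: max_b.
by case: eqP => // Ev; rewrite Ev b0 in pv.
Qed.

End SearchOrders.

(** * Simplicial vertices, far vertices and the base *)

Section Cliques.
Variables (n : nat) (G : sgraph n).
Implicit Types (u v w x y z : 'I_n) (X : {set 'I_n}).
Local Notation nb := (nb G).

Definition simplicial X v :=
  (v \in X) && [forall u in X, forall w in X, nb v u ==> nb v w ==> nb u w].

Lemma simplicialP X v : reflect (v \in X /\
  forall u w, u \in X -> w \in X -> nb v u -> nb v w -> nb u w) (simplicial X v).
Proof.
apply: (iffP andP) => [[vX /forall_inP h] | [vX h]]; split=> //.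
  by move=> u w uX wX vu vw; have /forall_inP/(_ w wX) := h u uX; rewrite vu vw.
by apply/forall_inP => u uX; apply/forall_inP => w wX; apply/implyP => vu; apply/implyP => vw; apply: h.
Qed.

Definition simplicials := [set v | simplicial setT v].

Definition far_vertices := [set v | [forall u in simplicials, ~~ nb v u]].

(* A disjoint union of cliques meeting, below every vertex, a vertex with a
   smaller neighbourhood: the role played in the paper by the irredundant
   vertices, which are not known to be computable in quadratic time. *)
Definition base := locked (simplicials :|: [set v | simplicial far_vertices v]).

Lemma in_base v : (v \in base) = simplicial setT v || simplicial far_vertices v.
Proof. by rewrite /base -lock !inE. Qed.

(** The middle vertex decides. If [y] is simplicial in G, its neighbours are pairwise adjacent.
    Otherwise [y] is far, so its neighbours in the base are not simplicial in G; they are far too,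
    and [y] is simplicial among the far vertices. *)
Lemma base_clique x y z : x \in base -> y \in base -> z \in base ->
  nb x y -> nb y z -> nb x z.
Proof.
have T u v : simplicial setT u -> simplicial far_vertices v -> ~~ nb u v.
  move=> Su /simplicialP [+ _]; rewrite inE => /forall_inP/(_ u).
  by rewrite inE nb_sym; apply.
rewrite !in_base => /orP Bx /orP By /orP Bz xy yz.
case: By => /simplicialP [Fy Sy].
  by apply: Sy; rewrite ?inE // nb_sym.
have Fb u : simplicial setT u \/ simplicial far_vertices u -> nb u y -> u \in far_vertices.
  case=> [Su | /simplicialP [] //].
  move: Fy; rewrite inE => /forall_inP/(_ u); rewrite inE nb_sym => h uy.
  by rewrite uy in h; have := h Su.
by apply: Sy => //; [apply: Fb | apply: Fb; rewrite // nb_sym | rewrite nb_sym].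
Qed.

Definition subnb x y := [forall z, nb x z ==> nb y z].

Lemma subnbP x y : reflect (forall z, nb x z -> nb y z) (subnb x y).
Proof. by apply: (iffP forallP) => h z; apply/implyP/h. Qed.

Hypothesis chG : chordal G.

(* In a search order from u, the last vertex of N[x] \ N[u] is simplicial. *)
Lemma simplicial_beyond u x : nb u x ->
  (exists p, nb x p && ~~ nb u p) ->
  (forall p, nb x p -> ~~ nb u p -> subnb p x) ->
  exists2 s, s \in simplicials & nb x s.
Proof.
move=> ux [p0 Zp0] Zsub.
have [pos [pos_inj so u_first]] := search_order_from G u.
case: (@arg_maxnP _ p0 (fun p => nb x p && ~~ nb u p) pos Zp0) => s /andP [xs us] max_s.
exists s => //.
have sx := subnbP _ _ (Zsub s xs us).
(* A neighbour [a] of [s] placed after [s] lies in N[x], hence in N[u] by the choice of [s]. Then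
   [u] and [s] both precede their neighbour [a], so they would be adjacent. *)
have late a : nb s a -> pos a <= pos s.
  move=> sa; rewrite leqNgt; apply/negP => lt_sa.
  case ua: (nb u a); last by have := max_s a; rewrite sx // ua => /(_ isT); lia.
  case/negP: us; apply: (search_order_clique chG pos_inj so (x := a)) => //.
  - by apply: leq_ltn_trans lt_sa; apply: u_first.
  - by rewrite nb_sym.
  - by rewrite nb_sym.
rewrite inE; apply/simplicialP; split=> [|a b _ _ sa sb]; first by rewrite inE.
case: (eqVneq a s) => [-> // | as_]; case: (eqVneq b s) => [-> | bs]; first by rewrite nb_sym.
apply: (search_order_clique chG pos_inj so (x := s)) => //.
  by have := late a sa; rewrite leq_eqVlt => /orP [/eqP/pos_inj e|//]; rewrite e eqxx in as_.
by have := late b sb; rewrite leq_eqVlt => /orP [/eqP/pos_inj e|//]; rewrite e eqxx in bs.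
Qed.

Hypothesis p7G : path_free 7 G.

(** Take [u] with N[u] smallest inside N[v]. If [u] sees a simplicial [s], then N[s] is inside N[u].
    If [u] is far and not simplicial among the far vertices, it has two non-adjacent far neighbours
    [x] and [z]; each is continued by two vertices away from [u], which gives the induced P7 [w],
    [p], [x], [u], [z], [q], [w']. *)
Lemma base_cover v : exists2 u, u \in base & subnb u v.
Proof.
have vv : subnb v v by apply/subnbP.
case: (@arg_minnP _ v (fun u => subnb u v) (fun u => #|[set y | nb u y]|) vv) => u uv min_u.
have trans a b c : subnb a b -> subnb b c -> subnb a c.
  by move=> /subnbP ab /subnbP bc; apply/subnbP => z /ab /bc.
have irr y : subnb y u -> subnb u y.
  move=> yu; have := min_u y (trans _ _ _ yu uv) => le.
  have /eqP E : [set z | nb y z] == [set z | nb u z].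
    rewrite eqEcard le andbT; apply/subsetP => z; rewrite !inE; exact: (subnbP _ _ yu).
  by apply/subnbP => z uz; move/setP/(_ z): E; rewrite !inE uz.
case Fu: (u \in far_vertices); last first.
  move: Fu; rewrite inE => /forall_inPn [s Ss /negPn us].
  exists s; first by rewrite inE in Ss; rewrite in_base Ss.
  apply: trans uv; apply/subnbP => z sz; rewrite inE in Ss.
  by have /simplicialP [_ h] := Ss; apply: h; rewrite ?in_setT // nb_sym.
case Su: (simplicial far_vertices u); first by exists u; rewrite // in_base orbC Su.
move: Su; rewrite /simplicial Fu => /forall_inPn [x Fx /forall_inPn [z Fz]].
rewrite !negb_imply => /and3P [ux uz xz].
(* As [b] is in N[u] but not in N[a], minimality of N[u] provides a vertex of N[a] outside N[u]. One
   of these vertices has a neighbour outside N[a], for otherwise [simplicial_beyond] would give the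
   far vertex [a] a simplicial neighbour. *)
have ext a b : a \in far_vertices -> nb u a -> nb u b -> ~~ nb a b ->
    exists p w, [/\ nb a p, ~~ nb u p, nb p w & ~~ nb a w].
  move=> Fa ua ub nab.
  have /forallPn [p] : ~~ subnb a u.
    by apply: contra nab => /irr /subnbP; apply.
  rewrite negb_imply => Zp.
  case: (boolP [forall p, nb a p ==> ~~ nb u p ==> subnb p a]) => [/forallP all_p | ].
    have [q aq uq|s Ss as_] := simplicial_beyond ua (ex_intro _ p Zp).
      by have := all_p q; rewrite aq uq.
    by move: Fa; rewrite inE => /forall_inP/(_ s Ss); rewrite as_.
  case/forallPn => q; rewrite !negb_imply => /and3P [aq uq /forallPn [w]].
  by rewrite negb_imply => /andP [qw aw]; exists q, w.
have [p [w [xp up pw xw]]] := ext x z Fx ux uz xz.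
rewrite nb_sym in xz.
have [q [w' [zq uq qw zw]]] := ext z x Fz uz ux xz.
have [xu zu px qz wp] : [/\ nb x u, nb z u, nb p x, nb q z & nb w p] by split; rewrite nb_sym.
have Nxz : ~~ nb x z by rewrite nb_sym.
have [pu qu wx w'z] : [/\ ~~ nb p u, ~~ nb q u, ~~ nb w x & ~~ nb w' z].
  by split; rewrite nb_sym.
exfalso; apply: (no_walk7 chG (a := w) (b := p) (c := x) (d := u) (e := z) (g := q) (h := w')) => //.
- by apply: (sep_adj (z := x)); rewrite // px (negbTE wx).
- by apply: (sep_adj (z := u)); rewrite // xu (negbTE pu).
- by apply: (sep_adj (z := z)); rewrite // uz (negbTE Nxz).
- by apply: (sep_adj (z := x)); rewrite // ux (negbTE xz).
- by apply: (sep_adj (z := u)); rewrite // zu (negbTE qu).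
- by apply: (sep_adj (z := z)); rewrite // qz (negbTE w'z).
Qed.

End Cliques.

(** * Minimal dominating sets and the search tree *)

Section MinimalDominatingSets.
Variables (n : nat) (G : sgraph n).
Implicit Types (u v w x y z : 'I_n) (A B D : {set 'I_n}).
Local Notation nb := (nb G).
Local Notation base := (base G).

Lemma dominatingP D : reflect (forall y, exists2 x, x \in D & nb x y) (dominating G D).
Proof.
apply: (iffP eqP) => [E y | h].
  by have /bigcupP [x xD] : y \in closed_nbhds G D; rewrite ?E ?inE //; exists x.
apply/setP => y; rewrite inE; apply/bigcupP.
by have [x xD xy] := h y; exists x; rewrite // inE.
Qed.

Lemma min_dom_setsP D : D \in min_dom_sets G <->
  (forall y, exists2 x, x \in D & nb x y) /\
  (forall d, d \in D -> exists2 y, nb d y & forall e, e \in D -> nb e y -> e = d).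
Proof.
rewrite inE; split.
  case/minsetP => /dominatingP dom minD; split=> // d dD.
  have : ~~ dominating G (D :\ d).
    apply/negP => /minD/(_ (subsetDl _ _)) E.
    by move: dD; rewrite -E !inE eqxx.
  rewrite /dominating -subTset => /subsetPn [y _ /bigcupP ny].
  have only e : e \in D -> nb e y -> e = d.
    move=> eD ey; apply/eqP/negPn/negP => ed; apply: ny.
    by exists e; rewrite !inE ?ed.
  by have [x xD xy] := dom y; exists y => //; rewrite -(only x xD xy).
case=> dom priv; apply/minsetP; split; first exact/dominatingP.
move=> B /dominatingP domB BD; apply/eqP; rewrite eqEsubset BD /=.
apply/subsetP => d /priv [y dy only]; have [b bB bY] := domB y.
by rewrite -(only b) ?(subsetP BD).
Qed.

(* The condition on the set A of redundant vertices of a minimal dominating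
   set; unlike the existence of a private neighbour in a clique of the base
   dominated by A, it is clearly inherited by subsets. *)
Definition extensible A := [forall a in A, exists u, [&& u \in base, nb a u,
  [forall w in base, nb u w ==> nb a w] & [forall b in A, nb b u ==> (b == a)]]].

(** A property of the clique of [u] in the base: some vertex of it, not necessarily [u], is missed
    by [A], so that a vertex of this clique has to be chosen. *)
Definition undominated A u :=
  [exists w, [&& w \in base, nb u w & [forall a in A, ~~ nb a w]]].

Lemma extensibleP A : reflect (forall a, a \in A -> exists u,
   [/\ u \in base, nb a u, forall w, w \in base -> nb u w -> nb a w
     & forall b, b \in A -> nb b u -> b = a]) (extensible A).
Proof.
apply: (iffP forall_inP) => h a /h.
  case/existsP => u /and4P [uU au /forall_inP s /forall_inP p].
  exists u; split=> // [w /s/implyP // | b /p/implyP pb bu].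
  exact/eqP/pb.
case=> u [uU au s p]; apply/existsP; exists u; rewrite uU au /=.
apply/andP; split; apply/forall_inP => b bX; apply/implyP => /=; first exact: s.
by move=> /p ->.
Qed.

Lemma undominatedP A u : reflect (exists w,
  [/\ w \in base, nb u w & forall a, a \in A -> ~~ nb a w]) (undominated A u).
Proof.
apply: (iffP existsP) => -[w]; last by case=> wU uw /forall_inP h; exists w; rewrite wU uw.
by case/and3P => wU uw /forall_inP; exists w.
Qed.

Lemma extensible_sub A B : B \subset A -> extensible A -> extensible B.
Proof.
move=> /subsetP BA /extensibleP eA; apply/extensibleP => a /BA /eA [u [uU au s p]].
by exists u; split=> // b /BA; apply: p.
Qed.

Hypothesis chG : chordal G.
Hypothesis p7G : path_free 7 G.

(** A private neighbour [y] of [d] may be replaced by a base vertex [u] with N[u] inside N[y]: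
    whatever dominates [u] also dominates [y]. *)
Lemma private_base D d : D \in min_dom_sets G -> d \in D ->
  exists u, [/\ u \in base, nb d u & forall e, e \in D -> nb e u -> e = d].
Proof.
case/min_dom_setsP => dom priv /priv [y dy only].
have [u uU /subnbP uy] := base_cover chG p7G y.
have only_u e : e \in D -> nb e u -> e = d.
  by move=> eD eu; apply: only; rewrite // nb_sym uy // nb_sym.
by have [e eD eu] := dom u; exists u; split=> //; rewrite -(only_u e eD eu).
Qed.

(** A private base vertex [x] of [b] is a witness unless [b] misses some [y] in the clique of [x].
    In that case a base vertex [s] with N[s] inside N[b] is one. Suppose that another outer [t] in D
    saw [s]. Let [e] in D dominate [y], let [f] be a base vertex with N[f] inside N[e], and [u] a
    base vertex private to [t]: then [f], [e], [y], [x], [b], [t], [u] is an induced P7. *)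
Lemma min_dom_extensible D : D \in min_dom_sets G -> extensible (D :\: base).
Proof.
move=> DM; have [dom _] := (min_dom_setsP D).1 DM.
apply/extensibleP => b; rewrite inE => /andP [bU bD].
have [x [xU bx only_x]] := private_base DM bD.
case: (boolP [forall w in base, nb x w ==> nb b w]) => [/forall_inP s|].
  exists x; split=> // [w /s/implyP // | e].
  by rewrite inE => /andP [_]; apply: only_x.
case/forall_inPn => y yU; rewrite negb_imply => /andP [xy Nby].
have [e eD ey] := dom y.
have eb : e != b by apply: contraNneq Nby => <-.
have Nex : ~~ nb e x by apply: contraNN eb => /(only_x e eD) ->.
have eU : e \notin base.
  apply: contraNN Nex => eU; apply: base_clique ey _ => //; by rewrite nb_sym.
have [f fU /subnbP fe] := base_cover chG p7G e.
have [s sU /subnbP sb] := base_cover chG p7G b.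
exists s; split=> // [|w wU|t]; [by apply: sb; apply: nb_refl | exact: sb |].
rewrite inE => /andP [tU tD] ts; apply/eqP/negPn/negP => tb.
have bt : nb b t by apply: sb; rewrite nb_sym.
have Ntx : ~~ nb t x by apply: contraNN tb => /(only_x t tD) ->.
have [u [uU tu only_u]] := private_base DM tD.
have adjU p q : p \in base -> q \notin base -> nb p q -> adj G p q.
  by move=> pU qU pq; apply: nb_adj => //; apply: contraNneq qU => <-.
have [xb yx] : nb x b /\ nb y x by split; rewrite nb_sym.
apply: (no_walk7 chG (a := f) (b := e) (c := y) (d := x) (e := b) (g := t) (h := u)) => //.
- by apply: adjU; rewrite // nb_sym fe // nb_refl.
- by rewrite adj_sym; apply: adjU; rewrite // nb_sym.
- by apply: (sep_adj (z := b)); rewrite // xb nb_sym (negbTE Nby).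
- exact: adjU.
- by apply: (sep_adj (z := x)); rewrite // bx (negbTE Ntx).
- by rewrite adj_sym; apply: adjU; rewrite // nb_sym.
- apply: contraNN Nex => fy; apply: fe.
  by apply: base_clique fy yx.
- by rewrite nb_sym.
- by rewrite nb_sym.
- by apply: contraNN tb => bu; rewrite (only_u b bD bu).
Qed.

(** For the converse, an element of D in the base has as private neighbour a vertex of its clique
    missed by the outer part. An outer [d] keeps its witness [u]: a base element of D that sees [u]
    would lie in the clique of [u], which [d] dominates entirely. *)
Lemma min_dom_setsE D : D \in min_dom_sets G <->
  [/\ extensible (D :\: base),
      forall u, u \in D -> u \in base -> undominated (D :\: base) u,
      forall u w, u \in D -> u \in base -> w \in D -> w \in base -> nb u w -> u = w
    & forall u, u \in base -> undominated (D :\: base) u ->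
        exists w, [/\ w \in D, w \in base & nb u w]].
Proof.
split=> [DM | [/extensibleP ext und uniq ex]].
  have [dom _] := (min_dom_setsP D).1 DM; split; first exact: min_dom_extensible.
  - move=> u uD uU; have [w [wU uw only]] := private_base DM uD.
    apply/undominatedP; exists w; split=> // a; rewrite inE => /andP [aU aD].
    by apply: contraNN aU => /(only a aD) ->.
  - move=> u w uD uU wD wU uw; have [p [pU up only]] := private_base DM uD.
    apply/esym/only => //; apply: base_clique up => //; by rewrite nb_sym.
  - move=> u uU /undominatedP [w [wU uw nd]]; have [d dD dw] := dom w.
    have dU : d \in base by apply: contraTT dw => dU; apply: nd; rewrite inE dU.
    by exists d; split=> //; apply: base_clique uw _ => //; rewrite nb_sym.
apply/min_dom_setsP; split.
  move=> y; have [u uU /subnbP uy] := base_cover chG p7G y.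
  suff [d dD du] : exists2 d, d \in D & nb d u.
    by exists d; rewrite // nb_sym uy // nb_sym.
  case: (boolP [exists a in D :\: base, nb a u]) => [/exists_inP [a]|].
    by rewrite inE => /andP [_]; exists a.
  move/exists_inPn => nd; have [|w [wD _ uw]] := ex u uU.
    by apply/undominatedP; exists u; rewrite nb_refl.
  by exists w; rewrite // nb_sym.
move=> d dD; case dU: (d \in base).
  have /undominatedP [w [wU dw nd]] := und d dD dU.
  exists w => // e eD ew.
  have eU : e \in base by apply: contraTT ew => eU; apply: nd; rewrite inE eU.
  apply/esym/uniq => //; apply: base_clique dw _ => //; by rewrite nb_sym.
have [|u [uU du cov only]] := ext d; first by rewrite inE dU.
exists u => // e eD eu; case eU: (e \in base); last by apply: only; rewrite // inE eU.
have /undominatedP [w [wU ew nd]] := und e eD eU.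
have : nb d w by apply: cov => //; apply: base_clique ew => //; rewrite nb_sym.
by rewrite (negbTE (nd d _)) // inE dU.
Qed.

End MinimalDominatingSets.

(** * Partial solutions and the binary tree of decisions *)

Section SearchTree.
Variables (n : nat) (G : sgraph n).
Implicit Types (u v w : 'I_n) (D E : {set 'I_n}).
Local Notation nb := (nb G).
Local Notation base := (base G).

(** The representative of the clique of [u]. Having the largest index, it is also the last vertex of
    the clique to be decided. *)
Definition last_nb u : 'I_n := [arg max_(w > u | (w \in base) && nb u w) w].

Lemma last_nbP u : u \in base ->
  [/\ last_nb u \in base, nb u (last_nb u)
    & forall w, w \in base -> nb u w -> w <= last_nb u].
Proof.
move=> uU; rewrite /last_nb; case: arg_maxnP => [|w /andP [wU uw] max_w].
  by rewrite uU nb_refl.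
by split=> // x xU ux; apply: max_w; rewrite xU.
Qed.

Lemma last_nb_eq u w : u \in base -> w \in base ->
  (last_nb u == last_nb w) = nb u w.
Proof.
move=> uU wU; have [lU ul mu] := last_nbP uU; have [kU wk mw] := last_nbP wU.
apply/idP/idP => [/eqP E | uw].
  by apply: base_clique ul _ => //; rewrite E nb_sym.
have wu : nb w u by rewrite nb_sym.
have uk := base_clique uU wU kU uw wk; have wl := base_clique wU uU lU wu ul.
by rewrite -val_eqE eqn_leq mu ?mw.
Qed.

(* The search decides the vertices outside the base first. *)
Definition vpos v := if v \in base then n + v else v : nat.

Lemma vpos_inj : injective vpos.
Proof.
move=> u v; rewrite /vpos; have := ltn_ord u; have := ltn_ord v.
by do 2!case: ifP => _; move=> ? ? E; apply: val_inj => /=; lia.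
Qed.

Lemma vpos_lt v : vpos v < n + n.
Proof. by rewrite /vpos; case: ifP => _; have := ltn_ord v; lia. Qed.

Definition prefix_set i D := [set v in D | vpos v < i].

Definition chosen D u := [exists w, [&& w \in D, w \in base & nb u w]].

Lemma chosenP D u : reflect (exists w, [/\ w \in D, w \in base & nb u w]) (chosen D u).
Proof. by apply: (iffP existsP) => -[w /and3P]; exists w. Qed.

(* The last clause says that a clique of the base that D does not dominate still
   has a vertex that can be chosen. *)
Definition feasible i D :=
  [/\ forall v, v \in D -> vpos v < i,
      extensible G (D :\: base),
      forall u, u \in D -> u \in base -> undominated G (D :\: base) u,
      forall u w, u \in D -> u \in base -> w \in D -> w \in base -> nb u w -> u = w
    & forall u, u \in base -> undominated G (D :\: base) u ->
        chosen D u \/ i <= vpos (last_nb u)].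

Lemma feasible0 : feasible 0 set0.
Proof.
split=> [v||u|u v|u _ _]; rewrite ?inE //; last by right.
by apply/extensibleP => a; rewrite !inE andbF.
Qed.

Hypothesis chG : chordal G.
Hypothesis p7G : path_free 7 G.

Lemma feasible_full D : feasible (n + n) D -> D \in min_dom_sets G.
Proof.
case=> _ ext und uniq ex; apply/(min_dom_setsE chG p7G); split=> // u uU /(ex u uU).
by case=> [/chosenP //|]; have := vpos_lt (last_nb u); lia.
Qed.

Lemma feasible_prefix D i : D \in min_dom_sets G -> feasible i (prefix_set i D).
Proof.
case/(min_dom_setsE chG p7G) => ext und uniq ex.
have sub : prefix_set i D :\: base \subset D :\: base.
  by apply: setSD; apply/subsetP => v; rewrite inE => /andP [].
split=> [v||u|u w|u uU].
- by rewrite inE => /andP [].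
- exact: extensible_sub sub ext.
- rewrite inE => /andP [uD _] uU; have /undominatedP [w [wU uw nd]] := und u uD uU.
  by apply/undominatedP; exists w; split=> // a /(subsetP sub); apply: nd.
- by rewrite !inE => /andP [uD _] uU /andP [wD _]; exact: (uniq u w uD uU wD).
have [lU ul mu] := last_nbP uU.
case: (leqP i (vpos (last_nb u))) => [|li]; first by right.
(* A base vertex lies before position [i], so [i] exceeds [n] and every outer vertex has been
   decided. *)
have E : prefix_set i D :\: base = D :\: base.
  apply/setP=> v; rewrite !inE; case vU: (v \in base) => //=.
  rewrite (_ : vpos v < i) ?andbT //; move: li.
  by rewrite /vpos vU lU; have := ltn_ord v; lia.
rewrite E => /(ex u uU) [w [wD wU uw]]; left; apply/chosenP; exists w; split=> //.
rewrite inE wD; apply: leq_ltn_trans li.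
by rewrite /vpos wU lU leq_add2l mu.
Qed.

(** Of the positions [v] and [n + v] just one carries the vertex [v]; at the other nothing is
    decided. *)
Lemma feasible_skip i D : (forall v, vpos v != i) -> feasible i D -> feasible i.+1 D.
Proof.
move=> ni [lt ext und uniq ex]; split=> // [v /lt /ltnW // | u uU /(ex u uU)].
by case; [left | rewrite leq_eqVlt eq_sym (negbTE (ni _)); right].
Qed.

Lemma feasible_add i D v : vpos v = i -> v \notin base -> feasible i D ->
  extensible G (v |: D :\: base) -> feasible i.+1 (v |: D).
Proof.
move=> vi vU [lt ext und uniq ex] ext'.
have E : (v |: D) :\: base = v |: D :\: base.
  by apply/setP=> u; rewrite !inE; case: eqP => // ->; rewrite vU.
have i_n : i < n by rewrite -vi /vpos (negbTE vU) ltn_ord.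
have nD u : u \in D -> u \in base -> False.
  by move=> /lt + uU; rewrite /vpos uU; lia.
split; rewrite ?E //.
- by move=> u; rewrite !inE => /orP [/eqP -> | /lt/ltnW //]; rewrite vi.
- by move=> u; rewrite !inE => /orP [/eqP -> | /nD h /h //]; rewrite (negbTE vU).
- by move=> u w; rewrite !inE => /orP [/eqP -> | /nD h /h //]; rewrite (negbTE vU).
- move=> u uU _; right; have [lU _ _] := last_nbP uU.
  by rewrite /vpos lU; lia.
Qed.

Lemma feasible_drop i D v : vpos v = i -> v \notin base -> feasible i D ->
  feasible i.+1 D.
Proof.
move=> vi vU [lt ext und uniq ex]; split=> // [u /lt /ltnW // | u uU /(ex u uU)].
case; [by left | right]; rewrite ltn_neqAle; apply/andP; split=> //.
have [lU _ _] := last_nbP uU.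
by apply: contraNneq vU => E; rewrite (vpos_inj (etrans vi E)).
Qed.

Lemma feasible_choose i D v : vpos v = i -> v \in base -> feasible i D ->
  undominated G (D :\: base) v -> ~~ chosen D v -> feasible i.+1 (v |: D).
Proof.
move=> vi vU [lt ext und uniq ex] nd nch.
have E : (v |: D) :\: base = D :\: base.
  by apply/setP=> u; rewrite !inE; case: eqP => // ->; rewrite vU.
split; rewrite ?E //.
- by move=> u; rewrite !inE => /orP [/eqP -> | /lt/ltnW //]; rewrite vi.
- by move=> u; rewrite !inE => /orP [/eqP -> | /und].
- move=> u w; rewrite !inE => /orP [/eqP -> | uD] uU /orP [/eqP -> | wD] wU uw //.
  + by case/chosenP: nch; exists w.
  + by case/chosenP: nch; exists u; rewrite nb_sym.
  + exact: uniq.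
move=> u uU u_nd; case: (ex u uU u_nd) => [/chosenP [w [wD wU uw]] | iu].
  by left; apply/chosenP; exists w; rewrite inE wD orbT.
case: (eqVneq i (vpos (last_nb u))) => [Ei | ne]; last by right; rewrite ltn_neqAle ne.
left; apply/chosenP; exists v; rewrite !inE eqxx vU; split=> //.
by rewrite (vpos_inj (etrans vi Ei)); have [] := last_nbP uU.
Qed.

(** The converses of the moves serve twice: they restore the invariant when the search goes
    backward, and they show that a refused addition has an empty subtree. *)
Lemma feasible_chooseV i D v : vpos v = i -> v \in base -> v \notin D ->
  feasible i.+1 (v |: D) ->
  [/\ feasible i D, undominated G (D :\: base) v & ~~ chosen D v].
Proof.
move=> vi vU vD [lt ext und uniq ex].
have E : (v |: D) :\: base = D :\: base.
  by apply/setP=> u; rewrite !inE; case: eqP => // ->; rewrite vU.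
rewrite E in ext und ex.
have sub u : u \in D -> u \in v |: D by rewrite inE orbC => ->.
have vvD : v \in v |: D by rewrite !inE eqxx.
split; last first.
- apply/negP => /chosenP [w [wD wU vw]].
  by move: vD; rewrite (uniq v w vvD vU (sub w wD) wU vw) wD.
- exact: und.
split=> // [u uD | u /sub | u w /sub uD uU /sub wD | u uU /(ex u uU)].
- have := lt u (sub u uD); rewrite ltnS leq_eqVlt => /orP [/eqP Eu | //].
  by move: uD; rewrite (vpos_inj (etrans Eu (esym vi))) (negbTE vD).
- exact: und.
- exact: uniq.
case=> [/chosenP [w [+ wU uw]] | /ltnW]; last by right.
case/setU1P => [Ew | wD]; last by left; apply/chosenP; exists w.
right; have [lU ul mu] := last_nbP uU.
by rewrite -vi -Ew /vpos wU lU leq_add2l mu.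
Qed.

Lemma feasible_addV i D v : vpos v = i -> v \notin base -> v \notin D ->
  feasible i.+1 (v |: D) -> feasible i D /\ extensible G (v |: D :\: base).
Proof.
move=> vi vU vD [lt ext und uniq ex].
have E : (v |: D) :\: base = v |: D :\: base.
  by apply/setP=> u; rewrite !inE; case: eqP => // ->; rewrite vU.
rewrite E in ext; split=> //.
have i_n : i < n by rewrite -vi /vpos (negbTE vU) ltn_ord.
have sub u : u \in D -> u \in v |: D by rewrite inE orbC => ->.
have nD u : u \in D -> u \in base -> False.
  by move=> /sub/lt + uU; rewrite /vpos uU; lia.
split=> [u uD | | u /nD h /h // | u w /nD h /h // | u uU _].
- have := lt u (sub u uD); rewrite ltnS leq_eqVlt => /orP [/eqP Eu | //].
  by move: uD; rewrite (vpos_inj (etrans Eu (esym vi))) (negbTE vD).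
- by apply: extensible_sub ext; apply: subsetUr.
- by right; have [lU _ _] := last_nbP uU; rewrite /vpos lU; lia.
Qed.

(** Only the last vertex of a clique can be forced: for any other one, the clique still has a
    candidate at a later position. *)
Lemma feasible_pass i D v : vpos v = i -> v \in base -> feasible i D ->
  ~~ [&& undominated G (D :\: base) v, ~~ chosen D v & last_nb v == v] ->
  feasible i.+1 D.
Proof.
move=> vi vU [lt ext und uniq ex] ok; split=> // [u /lt /ltnW // | u uU u_nd].
case: (ex u uU u_nd) => [| iu]; first by left.
case: (eqVneq i (vpos (last_nb u))) => [Ei | ne]; last by right; rewrite ltn_neqAle ne.
left; have Ev := vpos_inj (etrans vi Ei).
have uv : nb u v by rewrite Ev; have [] := last_nbP uU.
have lv : last_nb v = v by rewrite {2}Ev; apply/eqP; rewrite last_nb_eq // nb_sym.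
have v_nd : undominated G (D :\: base) v.
  case/undominatedP: u_nd => w [wU uw nd]; apply/undominatedP; exists w; split=> //.
  by apply: base_clique uw => //; rewrite nb_sym.
move: ok; rewrite v_nd lv eqxx andbT negbK => /chosenP [w [wD wU vw]].
by apply/chosenP; exists w; split=> //; apply: base_clique vw.
Qed.

Lemma feasible_passV i D v : vpos v = i -> v \notin D -> feasible i.+1 D -> feasible i D.
Proof.
move=> vi vD [lt ext und uniq ex]; split=> // [u uD | u uU /(ex u uU)].
  have := lt u uD; rewrite ltnS leq_eqVlt => /orP [/eqP Eu | //].
  by move: uD; rewrite (vpos_inj (etrans Eu (esym vi))) (negbTE vD).
by case=> [|/ltnW]; [left | right].
Qed.

Lemma feasible_skipV i D : (forall v, vpos v != i) -> feasible i.+1 D -> feasible i D.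
Proof.
move=> ni [lt ext und uniq ex]; split=> // [u uD | u uU /(ex u uU)].
  by have := lt u uD; rewrite ltnS leq_eqVlt (negbTE (ni u)).
by case=> [|/ltnW]; [left | right].
Qed.

Definition at_pos i := [pick v | vpos v == i].

Lemma at_pos_some v i : vpos v = i -> at_pos i = Some v.
Proof.
rewrite /at_pos; case: pickP => [u /eqP <- /vpos_inj -> // | no /eqP].
by rewrite no.
Qed.

Lemma at_pos_none i : (forall v, vpos v != i) -> at_pos i = None.
Proof. by rewrite /at_pos; case: pickP => // u /eqP <- /(_ u); rewrite eqxx. Qed.

Lemma at_posP i : (exists2 v, at_pos i = Some v & vpos v = i) \/
  (at_pos i = None /\ forall v, vpos v != i).
Proof.
case: (pickP (fun v => vpos v == i)) => [v /eqP vi | no].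
  by left; exists v => //; apply: at_pos_some.
have no' v : vpos v != i by rewrite no.
by right; split=> //; apply: at_pos_none.
Qed.

(** The reference enumeration: the tree of all subsets, including branch first, filtered at the
    leaves. The program follows its order but enters no empty subtree. *)
Fixpoint leaves k D : seq {set 'I_n} :=
  if k is k'.+1 then
    (if at_pos (n + n - k) is Some v then leaves k' (v |: D) else [::]) ++ leaves k' D
  else if D \in min_dom_sets G then [:: D] else [::].

(* The outputs still to come inside the subtree of D, respectively after it. *)
Definition inside i D := leaves (n + n - i) D.

Fixpoint after i D : seq {set 'I_n} :=
  if i is j.+1 then
    if at_pos j is Some v then
      if v \in D then inside i (D :\ v) ++ after j (D :\ v) else after j D
    else after j D
  else [::].

Lemma inside_step i D : i < n + n -> inside i D =
  (if at_pos i is Some v then inside i.+1 (v |: D) else [::]) ++ inside i.+1 D.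
Proof.
move=> lt_i; rewrite {1}/inside; have -> : n + n - i = (n + n - i.+1).+1 by lia.
by rewrite /= (_ : n + n - (n + n - i.+1).+1 = i) //; lia.
Qed.

Lemma mem_inside i D E : i <= n + n -> (forall v, v \in D -> vpos v < i) ->
  E \in inside i D = (E \in min_dom_sets G) && (prefix_set i E == D).
Proof.
move=> le_i; have -> : i = n + n - (n + n - i) by lia.
elim: (n + n - i) (leq_subr i (n + n)) D => {i le_i} [|k IH] lk D ltD.
  rewrite subn0 /inside subnn /=.
  have -> : prefix_set (n + n) E = E by apply/setP=> v; rewrite inE vpos_lt andbT.
  by case: ifP => DM; rewrite ?mem_seq1 ?in_nil; case: eqP => [->|_]; rewrite ?DM ?andbF.
have Ek : n + n - k = (n + n - k.+1).+1 by lia.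
rewrite inside_step -?Ek; last by lia.
have ltD' v : v \in D -> vpos v < n + n - k by move=> /ltD; lia.
set i := n + n - k.+1 in Ek ltD *.
rewrite mem_cat IH ?ltD' //; last by lia.
case: (at_posP i) => [[v -> vi] | [-> no]].
  have vD : v \notin D by apply: contraTN (leqnn i) => /ltD; rewrite vi ltnn.
  rewrite IH; [ | by lia | ]; last first.
    by move=> u; rewrite !inE => /orP [/eqP -> | /ltD' //]; rewrite Ek vi.
  rewrite -andb_orr; congr (_ && _); rewrite Ek.
  have pre : prefix_set i.+1 E = if v \in E then v |: prefix_set i E else prefix_set i E.
    apply/setP=> u; case: ifP => vE; rewrite !inE ltnS leq_eqVlt -{1}vi (inj_eq vpos_inj);
      by case: eqP => // ->; rewrite vE // vi ltnn.
  have nv : v \notin prefix_set i E by rewrite inE vi ltnn andbF.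
  rewrite pre; case: ifP => vE; apply/orP/idP => [[]|]; move=> /eqP h.
  - by rewrite -(setU1K nv) h setU1K.
  - by move: vD; rewrite -h !inE eqxx.
  - by left; rewrite h.
  - by move: nv; rewrite h !inE eqxx.
  - by rewrite h.
  - by right; rewrite h.
rewrite in_nil /= Ek; congr (_ && (_ == _)).
by apply/setP=> u; rewrite !inE ltnS leq_eqVlt (negbTE (no u)).
Qed.

Lemma inside_nil i D : i <= n + n -> (forall v, v \in D -> vpos v < i) ->
  ~ feasible i D -> inside i D = [::].
Proof.
move=> le_i ltD nf; case E: (inside i D) => [//|F s]; case: nf.
have : F \in inside i D by rewrite E inE eqxx.
by rewrite mem_inside // => /andP [FM /eqP <-]; apply: feasible_prefix.
Qed.

Lemma inside_leaf D : feasible (n + n) D -> inside (n + n) D = [:: D].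
Proof. by move=> /feasible_full DM; rewrite /inside subnn /= DM. Qed.

Lemma perm_inside : perm_eq (inside 0 set0) (enum (min_dom_sets G)).
Proof.
apply: uniq_perm; rewrite ?enum_uniq //; last first.
  move=> E; rewrite mem_inside ?mem_enum // => [|v]; last by rewrite inE.
  rewrite (_ : prefix_set 0 E = set0) ?eqxx ?andbT //.
  by apply/setP=> v; rewrite !inE andbF.
suff H k D : k <= n + n -> (forall v, v \in D -> vpos v < n + n - k) ->
    uniq (inside (n + n - k) D).
  by have := H (n + n) set0 (leqnn _); rewrite subnn; apply=> v; rewrite inE.
elim: k D => [|k IH] D lk ltD.
  by rewrite subn0 /inside subnn /=; case: ifP.
have Ek : n + n - k = (n + n - k.+1).+1 by lia.
have ltD' v : v \in D -> vpos v < n + n - k by move=> /ltD; lia.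
rewrite inside_step -?Ek; last by lia.
have uD : uniq (inside (n + n - k) D) by apply: IH => //; lia.
set i := n + n - k.+1 in Ek ltD *.
case: (at_posP i) => [[v -> vi] | [-> //]].
have vD : v \notin D by apply: contraTN (leqnn i) => /ltD; rewrite vi ltnn.
have ltvD u : u \in v |: D -> vpos u < n + n - k.
  by rewrite !inE => /orP [/eqP -> | /ltD' //]; rewrite Ek vi.
rewrite cat_uniq uD andbT IH ?(ltnW lk) //=.
have Nk : n + n - k <= n + n by lia.
apply/hasPn => E; rewrite !mem_inside //.
case/andP => -> /eqP ->; apply/eqP => /setP/(_ v).
by rewrite !inE eqxx (negbTE vD).
Qed.

Lemma todo_skip i D : i < n + n -> (forall v, vpos v != i) ->
  inside i D ++ after i D = inside i.+1 D ++ after i.+1 D.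
Proof. by move=> lt_i /at_pos_none E; rewrite inside_step //= E. Qed.

Lemma after_at i D v : vpos v = i -> after i.+1 D =
  if v \in D then inside i.+1 (D :\ v) ++ after i (D :\ v) else after i D.
Proof. by move=> vi; move: (at_pos_some vi) => /= ->. Qed.

(** Entering the including branch merely moves the excluding branch from [inside] to [after]; the
    list of remaining outputs is unchanged. *)
Lemma todo_include i D v : vpos v = i -> v \notin D ->
  inside i D ++ after i D = inside i.+1 (v |: D) ++ after i.+1 (v |: D).
Proof.
move=> vi vD; rewrite (after_at _ vi) setU11 setU1K // inside_step -?vi ?vpos_lt //.
by rewrite (at_pos_some (erefl (vpos v))) catA.
Qed.

Lemma todo_exclude i D v : vpos v = i -> v \notin D -> inside i.+1 (v |: D) = [::] ->
  inside i D ++ after i D = inside i.+1 D ++ after i.+1 D.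
Proof.
move=> vi vD E; rewrite (after_at _ vi) (negbTE vD) inside_step -?vi ?vpos_lt //.
by rewrite (at_pos_some (erefl (vpos v))) vi E.
Qed.

Lemma after_skip i D : (forall v, vpos v != i) -> after i.+1 D = after i D.
Proof. by move=> /at_pos_none E; rewrite /= E. Qed.

End SearchTree.

(** * A structured language and its compilation *)

(* Array a < 3 is an n x n matrix; array a >= 3 is a vector, stored as a single
   row 0. *)
Inductive exp :=
| Var (x : nat)
| Num (k : nat)
| Bin (o : binop) (e1 e2 : exp)
| Get (a : nat) (e1 e2 : exp).

Inductive cmp := CEq (e1 e2 : exp) | CLt (e1 e2 : exp).

Inductive cmd :=
| Asg (x : nat) (e : exp)
| Put (a : nat) (e1 e2 e : exp)
| Seq (c1 c2 : cmd)
| If (b : cmp) (c1 c2 : cmd)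
| While (b : cmp) (c : cmd)
| For (x y : nat) (c : cmd)
| Out (e : exp)
| Flush
| Skip.

Record state := State {
  vars : nat -> nat;
  mem : nat -> nat -> nat -> nat;
  clk : nat;
  sbuf : seq nat;
  souts : seq (nat * seq nat)
}.

Lemma eqbP x y : reflect (x = y) (Nat.eqb x y).
Proof. exact: eqnP. Qed.

Lemma eqbb x : Nat.eqb x x.
Proof. exact: eqxx. Qed.

(* Nat.eqb, unlike ==, lets /= evaluate the comparison of two numerals. *)
Definition setv x v s := State
  (fun y => if Nat.eqb y x then v else vars s y) (mem s) (clk s) (sbuf s) (souts s).
Definition setm a i j v s := State (vars s)
  (fun a' => if Nat.eqb a' a
     then fun i' j' => if (i' == i) && (j' == j) then v else mem s a i' j'
     else mem s a')
  (clk s) (sbuf s) (souts s).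
Definition tick k s := State (vars s) (mem s) (clk s + k) (sbuf s) (souts s).
Definition addbuf v s := State (vars s) (mem s) (clk s) (rcons (sbuf s) v) (souts s).
Definition flush s := State (vars s) (mem s) (clk s) [::] (rcons (souts s) (clk s, sbuf s)).

Fixpoint ev (e : exp) (s : state) : nat :=
  match e with
  | Var x => vars s x
  | Num k => k
  | Bin o e1 e2 => eval_binop o (ev e1 s) (ev e2 s)
  | Get a e1 e2 => mem s a (ev e1 s) (ev e2 s)
  end.

Definition evc (b : cmp) (s : state) : bool :=
  match b with
  | CEq e1 e2 => ev e1 s == ev e2 s
  | CLt e1 e2 => ev e1 s < ev e2 s
  end.

(** The exact number of compiled instructions: a copy takes two, [Const] and [Add], and an array
    access takes the seven of [addr_code] and a [Fetch]. *)
Fixpoint ecost (e : exp) : nat :=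
  match e with
  | Var _ => 2
  | Num _ => 1
  | Bin _ e1 e2 => ecost e1 + ecost e2 + 1
  | Get _ e1 e2 => ecost e1 + ecost e2 + 8
  end.

Definition ccost (b : cmp) :=
  match b with CEq e1 e2 | CLt e1 e2 => ecost e1 + ecost e2 + 1 end.

Notation nregs := 24.
Notation narrays := 16.

Definition nrows n a := if a < 3 then n else 1.

Section Semantics.
Variables (n W : nat).

(** The other operations never exceed their left operand, so that these two alone create an
    obligation on the word length. *)
Definition grows o := match o with Add | Mul => true | _ => false end.

Fixpoint safe (e : exp) (s : state) : Prop :=
  match e with
  | Var x => x < nregs
  | Num k => k <= W
  | Bin o e1 e2 => [/\ safe e1 s, safe e2 s & grows o -> ev e s <= W]
  | Get a e1 e2 =>
      [/\ safe e1 s, safe e2 s, a < narrays, ev e1 s < nrows n a & ev e2 s < n]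
  end.

Definition safec (b : cmp) (s : state) : Prop :=
  match b with CEq e1 e2 | CLt e1 e2 => safe e1 s /\ safe e2 s end.

(** A derivation certifies termination, array bounds and word length together. Its ticks match the
    compiled layout, in which the else branch comes first and ends with a jump, hence the extra
    tick. Register 0 is never assigned, for it holds [n]. *)
Inductive ex : cmd -> state -> state -> Prop :=
| ex_asg x e s : 0 < x < nregs -> safe e s ->
    ex (Asg x e) s (tick (ecost e + 2) (setv x (ev e s) s))
| ex_put a e1 e2 e s : safe (Get a e1 e2) s -> safe e s ->
    ex (Put a e1 e2 e) s
      (tick (ecost e1 + ecost e2 + ecost e + 8) (setm a (ev e1 s) (ev e2 s) (ev e s) s))
| ex_seq c1 c2 s s1 s2 : ex c1 s s1 -> ex c2 s1 s2 -> ex (Seq c1 c2) s s2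
| ex_ift b c1 c2 s s1 : safec b s -> evc b s ->
    ex c1 (tick (ccost b) s) s1 -> ex (If b c1 c2) s s1
| ex_iff b c1 c2 s s1 : safec b s -> ~~ evc b s ->
    ex c2 (tick (ccost b) s) s1 -> ex (If b c1 c2) s (tick 1 s1)
| ex_whilet b c s s1 s2 : safec b s -> evc b s ->
    ex c (tick (ccost b) s) s1 -> ex (While b c) (tick 1 s1) s2 -> ex (While b c) s s2
| ex_whilef b c s : safec b s -> ~~ evc b s ->
    ex (While b c) s (tick (ccost b + 1) s)
| ex_for x y c s s1 :
    ex (Seq (Asg x (Num 0))
         (While (CLt (Var x) (Var y)) (Seq c (Asg x (Bin Add (Var x) (Num 1)))))) s s1 ->
    ex (For x y c) s s1
| ex_out e s : safe e s -> ex (Out e) s (tick (ecost e + 1) (addbuf (ev e s) s))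
| ex_flush s : ex Flush s (flush (tick 1 s))
| ex_skip s : ex Skip s s.

Definition wp c s (Q : state -> Prop) := exists2 s', ex c s s' & Q s'.

Fixpoint wr c : seq nat :=
  match c with
  | Asg x _ => [:: x]
  | Seq c1 c2 | If _ c1 c2 => wr c1 ++ wr c2
  | While _ c => wr c
  | For x _ c => x :: wr c
  | _ => [::]
  end.

Fixpoint wa c : seq nat :=
  match c with
  | Put a _ _ _ => [:: a]
  | Seq c1 c2 | If _ c1 c2 => wa c1 ++ wa c2
  | While _ c | For _ _ c => wa c
  | _ => [::]
  end.

Fixpoint quiet c :=
  match c with
  | Seq c1 c2 | If _ c1 c2 => quiet c1 && quiet c2
  | While _ c | For _ _ c => quiet c
  | Out _ | Flush => false
  | _ => true
  end.

(** The frame of a command, read off its syntax; it settles most claims that an array, a register or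
    the output has not changed. *)
Definition keeps c s s1 :=
  [/\ forall x, x \notin wr c -> vars s1 x = vars s x,
      forall a, a \notin wa c -> mem s1 a = mem s a
    & quiet c -> sbuf s1 = sbuf s /\ souts s1 = souts s].

Lemma ex_keeps c s s1 : ex c s s1 -> keeps c s s1.
Proof.
elim=> {c s s1}; rewrite /keeps /=.
- move=> x e s _ _; split=> // y; rewrite inE; case: eqbP => [->|//].
  by rewrite eqxx.
- move=> a e1 e2 e s _ _; split=> // b; rewrite inE; case: eqbP => [->|//].
  by rewrite eqxx.
- move=> c1 c2 s s1 s2 _ [v1 m1 q1] _ [v2 m2 q2]; split=> [x|a|/andP [/q1 [<- <-] /q2]] //;
    by rewrite mem_cat negb_or => /andP [h1 h2]; rewrite ?v2 ?m2 ?v1 ?m1.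
- by move=> b c1 c2 s s1 _ _ _ [v1 m1 q1]; split=> [x|a|/andP [/q1]] //;
    rewrite mem_cat negb_or => /andP [h1 h2]; rewrite ?v1 ?m1.
- by move=> b c1 c2 s s1 _ _ _ [v1 m1 q1]; split=> [x|a|/andP [_ /q1]] //;
    rewrite mem_cat negb_or => /andP [h1 h2]; rewrite ?v1 ?m1.
- move=> b c s s1 s2 _ _ _ [v1 m1 q1] _ [v2 m2 q2].
  by split=> [x h|a h|h]; rewrite ?v2 ?m2 ?v1 ?m1 //; case: (q2 h) => -> ->; apply: q1.
- by [].
- move=> x y c s s1 _ [v m q]; split=> [z|a|h].
  + rewrite inE negb_or => /andP [h1 h2]; apply: v.
    by rewrite !(inE, mem_cat) /= (negbTE h1) (negbTE h2).
  + by move=> h; apply: m; rewrite cats0.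
  + by apply: q; rewrite h.
- by [].
- by [].
- by [].
Qed.

Lemma wp_asg x e s Q : 0 < x < nregs -> safe e s ->
  Q (tick (ecost e + 2) (setv x (ev e s) s)) -> wp (Asg x e) s Q.
Proof. by move=> hx he q; eexists; [apply: ex_asg|]. Qed.

Lemma wp_put a e1 e2 e s Q : safe (Get a e1 e2) s -> safe e s ->
  Q (tick (ecost e1 + ecost e2 + ecost e + 8) (setm a (ev e1 s) (ev e2 s) (ev e s) s)) ->
  wp (Put a e1 e2 e) s Q.
Proof. by move=> h he q; eexists; [apply: ex_put|]. Qed.

Lemma wp_seq c1 c2 s Q : wp c1 s (fun s1 => wp c2 s1 Q) -> wp (Seq c1 c2) s Q.
Proof. by case=> s1 h1 [s2 h2 q]; exists s2 => //; apply: ex_seq h1 h2. Qed.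

Lemma wp_if b c1 c2 s Q : safec b s ->
  (evc b s -> wp c1 (tick (ccost b) s) Q) ->
  (~~ evc b s -> wp c2 (tick (ccost b) s) (fun s1 => Q (tick 1 s1))) ->
  wp (If b c1 c2) s Q.
Proof.
move=> hb h1 h2; case hbs: (evc b s).
  by have [s1 h q] := h1 hbs; exists s1 => //; apply: ex_ift.
by have [|s1 h q] := h2; [rewrite hbs | exists (tick 1 s1) => //; apply: ex_iff; rewrite ?hbs].
Qed.

Lemma wp_out e s Q : safe e s -> Q (tick (ecost e + 1) (addbuf (ev e s) s)) -> wp (Out e) s Q.
Proof. by move=> he q; eexists; [apply: ex_out|]. Qed.

Lemma wp_flush s Q : Q (flush (tick 1 s)) -> wp Flush s Q.
Proof. by move=> q; eexists; [apply: ex_flush|]. Qed.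

Lemma wp_skip s (Q : state -> Prop) : Q s -> wp Skip s Q.
Proof. by move=> q; exists s => //; apply: ex_skip. Qed.

Lemma wp_weak c s (Q1 Q2 : state -> Prop) : wp c s Q1 ->
  (forall s1, keeps c s s1 -> Q1 s1 -> Q2 s1) -> wp c s Q2.
Proof. by case=> s1 h q1 q12; exists s1 => //; apply: q12 => //; apply: ex_keeps. Qed.

(** The ticks are those of the compiled loop: 3 to clear the counter, 5 for the test, 7 to increment
    and jump back, 6 for the failing test and the exit jump. *)
Lemma wp_for (I : nat -> state -> Prop) x y c s Q :
  [&& 0 < x < nregs, y < nregs, x != y, x \notin wr c & y \notin wr c] ->
  vars s y < W ->
  I 0 (tick 3 (setv x 0 s)) ->
  (forall i s1, i < vars s y -> keeps (For x y c) s s1 -> vars s1 x = i -> I i s1 ->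
     wp c (tick 5 s1) (fun s2 => I i.+1 (tick 7 (setv x i.+1 s2)))) ->
  (forall s1, keeps (For x y c) s s1 -> I (vars s y) s1 -> Q (tick 6 s1)) ->
  wp (For x y c) s Q.
Proof.
case/and5P => hx hy xy xc yc hN I0 IS Qfin.
set N := vars s y in hN IS Qfin.
pose c' := Seq c (Asg x (Bin Add (Var x) (Num 1))).
have yx : Nat.eqb y x = false by apply/eqbP/eqP; rewrite eq_sym.
have hx' : x < nregs by case/andP: hx.
have loop k s1 : k <= N -> vars s1 x = N - k -> keeps (For x y c) s s1 -> I (N - k) s1 ->
    wp (While (CLt (Var x) (Var y)) c') s1 Q.
  elim: k s1 => [|k IH] s1 lk sx ks Is.
    rewrite subn0 in sx Is; exists (tick 6 s1); last exact: Qfin.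
    apply: ex_whilef => //=; have [kv _ _] := ks.
    by rewrite sx kv ?ltnn // inE negb_or eq_sym xy.
  have sy : vars s1 y = N by have [kv _ _] := ks; rewrite kv // inE negb_or eq_sym xy.
  have lt : N - k.+1 < N by lia.
  have [s2 h2 I2] := IS _ _ lt ks sx Is.
  have [kv _ _] := ex_keeps h2.
  have s2x : vars s2 x = N - k.+1 by rewrite kv //= sx.
  have h3 : ex c' (tick 5 s1) (tick 6 (setv x (N - k.+1).+1 s2)).
    apply: ex_seq h2 _; rewrite -[(N - _).+1]addn1 -s2x.
    by apply: (@ex_asg x (Bin Add (Var x) (Num 1))) => //; split=> //=; lia.
  have k3 : keeps (For x y c) s (tick 1 (tick 6 (setv x (N - k.+1).+1 s2))).
    have [v1 m1 q1] := ks; have [v2 m2 q2] := ex_keeps h2; split.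
    - move=> z /= hz; case: eqbP => [Ez | _]; first by rewrite Ez inE eqxx in hz.
      by rewrite v2 /= ?v1 //; move: hz; rewrite inE negb_or => /andP [].
    - by move=> a ha /=; rewrite m2 //= m1.
    - by move=> q /=; have [-> ->] := q2 q; exact: q1.
  have Ek : N - k = (N - k.+1).+1 by lia.
  have x3 : vars (tick 1 (tick 6 (setv x (N - k.+1).+1 s2))) x = N - k.
    by rewrite /= eqbb Ek.
  have I3 : I (N - k) (tick 1 (tick 6 (setv x (N - k.+1).+1 s2))).
    by rewrite Ek; move: I2; rewrite /tick /= -addnA.
  have [s4 h4 Q4] := IH _ (ltnW lk) x3 k3 I3.
  exists s4 => //; apply: (@ex_whilet (CLt (Var x) (Var y)) c' s1 _ s4 _ _ h3 h4) => //=.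
  by rewrite sx sy.
have [||||s2 h2 q2] := loop N (tick 3 (setv x 0 s)); rewrite ?subnn //.
- by rewrite /= eqbb.
- split=> //= z; rewrite inE; case: eqbP => [->|//]; by rewrite eqxx.
exists s2 => //; apply: ex_for; apply: ex_seq h2; exact: (@ex_asg x (Num 0)).
Qed.

(** With every loop running up to the same unassigned variable [y], the running time is bounded by a
    polynomial in its value, whatever the data. *)
Fixpoint bounded y c :=
  match c with
  | Asg x _ => x != y
  | Seq c1 c2 | If _ c1 c2 => bounded y c1 && bounded y c2
  | While _ _ => false
  | For x z c => [&& z == y, x != y, x \notin wr c & bounded y c]
  | _ => true
  end.

(* Running time of a command all of whose loops have N iterations. *)
Fixpoint tcost c N :=
  match c with
  | Asg _ e => ecost e + 2
  | Put _ e1 e2 e => ecost e1 + ecost e2 + ecost e + 8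
  | Seq c1 c2 => tcost c1 N + tcost c2 N
  | If b c1 c2 => ccost b + tcost c1 N + tcost c2 N + 1
  | While _ _ => 0
  | For _ _ c => N * (tcost c N + 12) + 9
  | Out e => ecost e + 1
  | Flush => 1
  | Skip => 0
  end.

Lemma ex_asgV x e s s1 : ex (Asg x e) s s1 -> s1 = tick (ecost e + 2) (setv x (ev e s) s).
Proof. by move=> h; inversion h. Qed.

Lemma ex_seqV c1 c2 s s2 : ex (Seq c1 c2) s s2 -> exists2 s1, ex c1 s s1 & ex c2 s1 s2.
Proof. by move=> h; inversion h as [| |? ? ? s1 ? h1 h2| | | | | | | |]; exists s1. Qed.

(** Each iteration adds 12 to its body: 5 for the test, 6 for the increment, 1 for the jump back.
    The final 6 are the failing test and the exit jump. *)
Lemma ex_while_tcost c x y T s s1 : (forall s2 s3, ex c s2 s3 ->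
    vars s3 y = vars s2 y /\ clk s3 <= clk s2 + T (vars s2 y)) ->
  (x != y) && (x \notin wr c) ->
  ex (While (CLt (Var x) (Var y)) (Seq c (Asg x (Bin Add (Var x) (Num 1))))) s s1 ->
  vars s1 y = vars s y /\
  clk s1 <= clk s + (vars s y - vars s x) * (T (vars s y) + 12) + 6.
Proof.
move=> IHc /andP [xy xc]; move E: (While _ _) => w h; elim: h E => //; last first.
  by move=> b c0 s3 _ _ [<- _] /=; split=> //; rewrite -[leqRHS]addnA leq_add2l leq_addl.
have yx : Nat.eqb y x = false by apply/eqbP/eqP; rewrite eq_sym.
move=> b c0 s3 s4 s5 _ + h4 _ h5 IH5 E; move: (E) h4 IH5 => [<- <-] h4 /(_ erefl) /= IH5 lt3.
have [s6 h6 /ex_asgV E4] := ex_seqV h4.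
have [/= Ey t6] := IHc _ _ h6; have [/= kv _ _] := ex_keeps h6.
move: IH5; rewrite E4 /= yx eqbb Ey (kv _ xc) => -[-> t5]; split=> //.
have -> : vars s3 y - vars s3 x = (vars s3 y - (vars s3 x + 1)).+1 by lia.
by rewrite mulSn; lia.
Qed.

Lemma ex_tcost c y s s1 : bounded y c -> ex c s s1 ->
  vars s1 y = vars s y /\ clk s1 <= clk s + tcost c (vars s y).
Proof.
elim: c s s1 => [x e|a e1 e2 e|c1 IH1 c2 IH2|b c1 IH1 c2 IH2|b c IH|x z c IH|e||] s s1 /=.
- move=> xy h; inversion h; subst => /=; split=> //.
  by case: eqbP xy => // ->; rewrite eqxx.
- by move=> _ h; inversion h; subst => /=; split=> //; lia.
- case/andP=> b1 b2 /ex_seqV [s2 h1 h2].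
  have [E1 t1] := IH1 _ _ b1 h1; have [E2 t2] := IH2 _ _ b2 h2.
  by rewrite E2 E1; split=> //; rewrite E1 in t2; lia.
- case/andP=> b1 b2 h; inversion h as [| | |? ? ? ? ? _ _ h1|? ? ? ? s2 _ _ h1| | | | | | ]; subst.
    by have [/= E1 t1] := IH1 _ _ b1 h1; split=> //; lia.
  by have [/= E1 t1] := IH2 _ _ b2 h1; split=> //=; lia.
- by [].
- case/and4P=> /eqP -> xy xc yb h.
  inversion h as [| | | | | | |? ? ? ? ? h'| | | ]; subst => {h}.
  have [s2 /ex_asgV E2 Hw] := ex_seqV h'.
  have yx : Nat.eqb y x = false by apply/eqbP/eqP; rewrite eq_sym.
  have xyc : (x != y) && (x \notin wr c) by rewrite xy.
  have [Ey Ht] := ex_while_tcost (fun s3 s4 => IH s3 s4 yb) xyc Hw.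
  have E : vars s2 y = vars s y by rewrite E2 /= yx.
  have E' : vars s2 x = 0 by rewrite E2 /= eqbb.
  split; rewrite ?Ey -?E //; apply: leq_trans Ht _.
  by rewrite E' subn0 E2 /=; lia.
- by move=> _ h; inversion h; subst => /=; split=> //; lia.
- by move=> _ h; inversion h; subst => /=; split=> //; lia.
- by move=> _ h; inversion h; subst => /=; split=> //; lia.
Qed.

Lemma ex_clk c s s1 : ex c s s1 -> clk s <= clk s1.
Proof. by elim=> {c s s1} /=; lia. Qed.

Lemma wp_clk c s (Q : state -> Prop) : wp c s Q -> wp c s (fun s1 => Q s1 /\ clk s <= clk s1).
Proof. by case=> s1 h q; exists s1 => //; have := ex_clk h. Qed.

Lemma wp_tcost c y s (Q : state -> Prop) : bounded y c -> wp c s Q ->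
  wp c s (fun s1 => Q s1 /\ clk s1 <= clk s + tcost c (vars s y)).
Proof. by move=> b [s1 h q]; exists s1 => //; have [] := ex_tcost b h. Qed.

End Semantics.

(** * Compilation to the machine and its correctness *)

Definition matrix_base a := minn a 3.

(* Registers from [nregs] on hold intermediate values; [d] receives the address
   of the entry whose row and column indices are in [d] and [d.+1]. *)
Definition addr_code a d : program :=
  [:: Const d.+2 (matrix_base a); Op Mul d.+2 d.+2 0; Op Add d d d.+2;
      Const d.+2 (a - 3); Op Add d d d.+2; Op Mul d d 0; Op Add d d d.+1].

Fixpoint exp_code (d : nat) (e : exp) : program :=
  match e with
  | Var x => [:: Const d 0; Op Add d x d]
  | Num k => [:: Const d k]
  | Bin o e1 e2 => exp_code d e1 ++ exp_code d.+1 e2 ++ [:: Op o d d d.+1]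
  | Get a e1 e2 =>
      exp_code d e1 ++ exp_code d.+1 e2 ++ addr_code a d ++ [:: Fetch d d]
  end.

Definition asg_code x e : program :=
  exp_code nregs e ++ [:: Const nregs.+1 0; Op Add x nregs nregs.+1].

Definition cmp_code (b : cmp) (l : nat) : program :=
  match b with
  | CEq e1 e2 => exp_code nregs e1 ++ exp_code nregs.+1 e2 ++ [:: JumpEq nregs nregs.+1 l]
  | CLt e1 e2 => exp_code nregs e1 ++ exp_code nregs.+1 e2 ++ [:: JumpLt nregs nregs.+1 l]
  end.

Definition seq_code (f g : nat -> program) p := f p ++ g (p + size (f p)).

Definition while_code b (f : nat -> program) p :=
  let q := p + ccost b + 1 in
  cmp_code b q ++ [:: Jump (q + size (f q) + 1)] ++ f q ++ [:: Jump p].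

Definition if_code b (f g : nat -> program) p :=
  let l2 := g (p + ccost b) in
  let q := p + ccost b + size l2 + 1 in
  cmp_code b q ++ l2 ++ [:: Jump (q + size (f q))] ++ f q.

(* The code depends on the position at which it is loaded, jumps being
   absolute. *)
Fixpoint code (c : cmd) : nat -> program :=
  match c with
  | Asg x e => fun=> asg_code x e
  | Put a e1 e2 e => fun=>
      exp_code nregs e1 ++ exp_code nregs.+1 e2 ++ addr_code a nregs ++
      exp_code nregs.+1 e ++ [:: Store nregs nregs.+1]
  | Seq c1 c2 => seq_code (code c1) (code c2)
  | If b c1 c2 => if_code b (code c1) (code c2)
  | While b c => while_code b (code c)
  | For x y c =>
      seq_code (fun=> asg_code x (Num 0))
        (while_code (CLt (Var x) (Var y))
          (seq_code (code c) (fun=> asg_code x (Bin Add (Var x) (Num 1)))))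
  | Out e => fun=> exp_code nregs e ++ [:: Write nregs]
  | Flush => fun=> [:: Emit]
  | Skip => fun=> [::]
  end.

Lemma size_exp_code d e : size (exp_code d e) = ecost e.
Proof.
elim: e d => //= [o e1 IH1 e2 IH2|a e1 IH1 e2 IH2] d; rewrite !size_cat IH1 IH2 /=; lia.
Qed.

Section Reach.
Variables (P : program) (I : config -> Prop).

(** The invariant is recorded at every configuration met, because the bounds on space and words
    concern the whole run. *)
Inductive reach : config -> config -> Prop :=
| reach_refl c : I c -> reach c c
| reach_step c c1 c2 : I c -> step P c = Some c1 -> reach c1 c2 -> reach c c2.

Lemma reach_trans c1 c2 c3 : reach c1 c2 -> reach c2 c3 -> reach c1 c3.
Proof. by elim=> // c c' c'' Ic st _ IH /IH; apply: reach_step. Qed.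

Lemma step_clock c c' : step P c = Some c' -> clock c' = (clock c).+1.
Proof. by rewrite /step; case: onth => //= i [<-]; case: c; case: i. Qed.

Lemma step_at c i : onth P (pc c) = Some i -> step P c = Some (exec i c).
Proof. by rewrite /step => ->. Qed.

Lemma runS t c c1 : step P c = Some c1 -> run P t.+1 c = run P t c1.
Proof. by move=> E; rewrite /run iterSr /= E. Qed.

Lemma reach_run c c' : reach c c' ->
  exists2 t, run P t c = Some c' & clock c' = clock c + t.
Proof.
elim=> {c c'} [c _|c c1 c2 _ st _ [t rt ct]]; first by exists 0; rewrite ?addn0.
by exists t.+1; rewrite ?(runS _ st) // ct (step_clock st); lia.
Qed.

Lemma reach_halt_inv c c' : reach c c' -> step P c' = None ->
  forall t c1, run P t c = Some c1 -> I c1.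
Proof.
elim=> {c c'} [c Ic|c c1 c2 Ic st _ IH] halt [|t] c3.
- by case=> <-.
- rewrite /run iterSr /= halt.
  by have -> : iter t (obind (step P)) None = None by elim: t => //= t ->.
- by case=> <-.
- by rewrite (runS _ st); apply: IH.
Qed.

End Reach.

Section Compilation.
Variables (n W space : nat).
Hypothesis wordW : narrays * (n + 1) ^ 2 <= W.
Hypothesis space_large : (3 * n + narrays) * n <= space.
Variable P : program.

Definition code_at p (l : program) := forall k, k < size l -> onth P (p + k) = onth l k.

Lemma code_at_cat p l1 l2 : code_at p (l1 ++ l2) ->
  code_at p l1 /\ code_at (p + size l1) l2.
Proof.
move=> h; split=> k hk.
  rewrite h; last by rewrite size_cat ltn_addr.
  by rewrite !onthE map_cat nth_cat size_map hk.
rewrite -addnA h; last by rewrite size_cat ltn_add2l.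
by rewrite !onthE map_cat nth_cat size_map ltnNge leq_addr /= addKn.
Qed.

Lemma code_at_cons p i l : code_at p (i :: l) -> onth P p = Some i /\ code_at p.+1 l.
Proof.
move=> h; split; first by rewrite -[p]addn0 h.
by move=> k hk; rewrite addSnnS h.
Qed.

Local Notation fit := (fits space W).
Local Notation reach := (reach P fit).

Lemma fits_reg p r m t b o p' t' b' o' x v : fit (Config p r m t b o) -> v <= W ->
  fit (Config p' [eta r with x |-> v] m t' b' o').
Proof. by case=> h1 h2 h3 hv; split=> // y /=; case: eqP. Qed.

Lemma fits_pc p r m t b o p' t' b' o' : fit (Config p r m t b o) ->
  fit (Config p' r m t' b' o').
Proof. by case. Qed.

Lemma reach_const p r m t b o x v c : onth P p = Some (Const x v) ->
  fit (Config p r m t b o) ->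
  reach (Config p.+1 [eta r with x |-> v] m t.+1 b o) c ->
  reach (Config p r m t b o) c.
Proof. by move=> E f; apply: reach_step => //; rewrite /step /= E. Qed.

Lemma reach_op p r m t b o op x y z c : onth P p = Some (Op op x y z) ->
  fit (Config p r m t b o) ->
  reach (Config p.+1 [eta r with x |-> eval_binop op (r y) (r z)] m t.+1 b o) c ->
  reach (Config p r m t b o) c.
Proof. by move=> E f; apply: reach_step => //; rewrite /step /= E. Qed.

(** Memory is a table of rows of [n] words: [n] rows for each of the three matrices, then one for
    each vector. Matrix 0 starts at address 0, where the input is. *)
Definition row_of a i := matrix_base a * n + i + (a - 3).
Definition addr a i j := row_of a i * n + j.

Lemma row_bound a i : a < narrays -> i < nrows n a -> row_of a i < 3 * n + narrays.
Proof.
rewrite /row_of /nrows /matrix_base; case: (ltnP a 3) => ha3 ha hi.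
  have : a.+1 * n <= 3 * n by rewrite leq_mul2r ha3 orbT.
  by lia.
by lia.
Qed.

Lemma addr_bound a i j : a < narrays -> i < nrows n a -> j < n ->
  addr a i j < (3 * n + narrays) * n.
Proof. by move=> ha hi hj; have := row_bound ha hi; rewrite /addr; nia. Qed.

Lemma row_inj a i a' i' : i < nrows n a -> i' < nrows n a' ->
  row_of a i = row_of a' i' -> a = a' /\ i = i'.
Proof.
rewrite /row_of /nrows /matrix_base.
case: (ltnP a 3) => ha; case: (ltnP a' 3) => ha' hi hi' E.
- have [lt|gt|//] := ltngtP a a'; last by lia.
    have : a.+1 * n <= a' * n by rewrite leq_mul2r lt orbT.
    by lia.
  have : a'.+1 * n <= a * n by rewrite leq_mul2r gt orbT.
  by lia.
- have : a.+1 * n <= 3 * n by rewrite leq_mul2r ha orbT.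
  by lia.
- have : a'.+1 * n <= 3 * n by rewrite leq_mul2r ha' orbT.
  by lia.
- by lia.
Qed.

Lemma addr_inj a i j a' i' j' : i < nrows n a -> i' < nrows n a' -> j < n -> j' < n ->
  addr a i j = addr a' i' j' -> [/\ a = a', i = i' & j = j'].
Proof.
move=> hi hi' hj hj' E; have n0 : 0 < n by lia.
have Ej : j = j'.
  by have := congr1 (modn^~ n) E; rewrite /= /addr !modnMDl !modn_small.
have Er : row_of a i = row_of a' i'.
  by have := congr1 (divn^~ n) E; rewrite /= /addr !divnMDl // !divn_small // !addn0.
by have [-> ->] := row_inj hi hi' Er.
Qed.

(** Variable 0 must keep the value [n], because [addr_code] multiplies by register 0. *)
Definition same_store s (r m : nat -> nat) :=
  [/\ forall x, x < nregs -> r x = vars s x, vars s 0 = n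
    & forall a i j, a < narrays -> i < nrows n a -> j < n -> m (addr a i j) = mem s a i j].

Definition agree s c :=
  [/\ same_store s (reg c) (ram c), clock c = clk s, buf c = sbuf s, out c = souts s
    & fit c].

Lemma addr_codeP p r m t b o a d i j : code_at p (addr_code a d) -> nregs <= d ->
  fit (Config p r m t b o) -> r 0 = n -> r d = i -> r d.+1 = j ->
  a < narrays -> i < nrows n a -> j < n ->
  exists r', [/\ reach (Config p r m t b o) (Config (p + 7) r' m (t + 7) b o),
    fit (Config (p + 7) r' m (t + 7) b o),
    r' d = addr a i j & forall x, x != d -> x != d.+2 -> r' x = r x].
Proof.
move=> h hd f r0 rd rd1 ha hi hj.
have hrow := row_bound ha hi; have haddr := addr_bound ha hi hj.
have hW : (3 * n + narrays) * (n + 1) <= W by apply: leq_trans wordW; nia.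
have n1 : 0 < n by lia.
have hW1 : 3 * n + narrays <= W by apply: leq_trans hW; nia.
have haW : addr a i j <= W by apply: leq_trans hW; nia.
have [h1 {}h] := code_at_cons h; have [h2 {}h] := code_at_cons h.
have [h3 {}h] := code_at_cons h; have [h4 {}h] := code_at_cons h.
have [h5 {}h] := code_at_cons h; have [h6 {}h] := code_at_cons h.
have [h7 _] := code_at_cons h.
have e1 : (d.+2 == d) = false by lia.
have e2 : (d == d.+2) = false by lia.
have e3 : (0 == d) = false by lia.
have e4 : (0 == d.+2) = false by lia.
have e5 : (d.+1 == d) = false by lia.
have e6 : (d.+1 == d.+2) = false by lia.
(* [fits] is required after each of the seven instructions, so every intermediate value needs its
   own bound. *)
have b1 : matrix_base a <= W by rewrite /matrix_base; lia.
have b2 : matrix_base a * n <= W by move: hrow; rewrite /row_of; lia.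
have b3 : i + matrix_base a * n <= W by move: hrow; rewrite /row_of; lia.
have b4 : a - 3 <= W by move: hrow; rewrite /row_of; lia.
have E5 : i + matrix_base a * n + (a - 3) = row_of a i by rewrite /row_of; lia.
have b5 : row_of a i <= W by lia.
have b6 : row_of a i * n <= W by move: haW; rewrite /addr; lia.
have f1 := fits_reg p.+1 t.+1 b o d.+2 f b1.
have f2 := fits_reg p.+2 t.+2 b o d.+2 f1 b2.
have f3 := fits_reg p.+3 t.+3 b o d f2 b3.
have f4 := fits_reg p.+4 t.+4 b o d.+2 f3 b4.
have f5 := fits_reg p.+4.+1 t.+4.+1 b o d f4 b5.
have f6 := fits_reg p.+4.+2 t.+4.+2 b o d f5 b6.
have f7 := fits_reg p.+4.+3 t.+4.+3 b o d f6 haW.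
rewrite !addnS !addn0; eexists; split; last 3 first.
- exact: f7.
- by rewrite /= eqxx.
- by move=> x xd xd2 /=; rewrite (negbTE xd) (negbTE xd2).
apply: reach_const h1 f _.
apply: reach_op h2 f1 _; rewrite /= ?eqxx ?e4 r0.
apply: reach_op h3 f2 _; rewrite /= ?eqxx ?e2 rd.
apply: reach_const h4 f3 _.
apply: reach_op h5 f4 _; rewrite /= ?eqxx ?e2 E5.
apply: reach_op h6 f5 _; rewrite /= ?eqxx ?e3 ?e4 r0.
apply: reach_op h7 f6 _; rewrite /= ?eqxx ?e5 ?e6 rd1.
exact: reach_refl.
Qed.

Lemma eval_bound o x y : x <= W -> (grows o -> eval_binop o x y <= W) ->
  eval_binop o x y <= W.
Proof.
move=> hx; case: o => /= [h|_|h|_|_]; [exact: h|by lia|exact: h| |].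
  by apply: leq_trans hx; apply: leq_div.
by apply: leq_trans hx; apply: leq_mod.
Qed.

Lemma same_store_temp s r r' m : same_store s r m ->
  (forall x, x < nregs -> r' x = r x) -> same_store s r' m.
Proof. by case=> h1 h2 h3 h; split=> // x hx; rewrite h ?h1. Qed.

(** Temporaries form a stack: the code at level [d] preserves all registers below [d], which
    protects the variables and a left operand already computed. *)
Lemma exp_codeP s e d p r m t b o : code_at p (exp_code d e) -> nregs <= d ->
  same_store s r m -> fit (Config p r m t b o) -> safe n W e s ->
  exists r', [/\ reach (Config p r m t b o) (Config (p + ecost e) r' m (t + ecost e) b o),
    fit (Config (p + ecost e) r' m (t + ecost e) b o),
    r' d = ev e s & forall x, x < d -> r' x = r x].
Proof.
elim: e d p r t => [x|k|op e1 IH1 e2 IH2|a e1 IH1 e2 IH2] d p r t h hd ss f /= sf.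
- have [h1 {}h] := code_at_cons h; have [h2 _] := code_at_cons h.
  have f1 := fits_reg p.+1 t.+1 b o d f (leq0n W).
  have b2 : r x + 0 <= W by rewrite addn0; case: f.
  have xd : (x == d) = false by lia.
  have f2 := fits_reg p.+2 t.+2 b o d f1 b2.
  rewrite !addn2; eexists; split; last 3 first.
  + exact: f2.
  + by have [Hr _ _] := ss; rewrite /= eqxx addn0 Hr.
  + by move=> y yd; rewrite /= (ltn_eqF yd).
  apply: reach_const h1 f _; apply: reach_op h2 f1 _.
  by rewrite /= eqxx xd; apply: reach_refl.
- have [h1 _] := code_at_cons h.
  have f1 := fits_reg p.+1 t.+1 b o d f sf.
  rewrite !addn1; eexists; split; last 3 first.
  + exact: f1.
  + by rewrite /= eqxx.
  + by move=> y yd; rewrite /= (ltn_eqF yd).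
  by apply: reach_const h1 f _; apply: reach_refl.
- have [sf1 sf2 sfo] := sf.
  have [c1 {}h] := code_at_cat h; have [c2 {}h] := code_at_cat h.
  rewrite !size_exp_code in c2 h.
  have [r1 [R1 f1 v1 k1]] := IH1 d p r t c1 hd ss f sf1.
  have ss1 : same_store s r1 m by apply: same_store_temp ss _ => x hx; apply: k1; lia.
  have [r2 [R2 f2 v2 k2]] := IH2 d.+1 _ r1 _ c2 (leqW hd) ss1 f1 sf2.
  have [h1 _] := code_at_cons h.
  have b3 : eval_binop op (r2 d) (r2 d.+1) <= W.
    apply: eval_bound; first by case: f2.
    by rewrite k2 // v1 v2.
  have f3 := fits_reg (p + ecost e1 + ecost e2).+1 (t + ecost e1 + ecost e2).+1 b o d f2 b3.
  rewrite !addn1 !addnS !addnA.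
  eexists; split; last 3 first.
  + exact: f3.
  + by rewrite /= eqxx k2 // v1 v2.
  + move=> y yd; rewrite /= (ltn_eqF yd) k2 ?k1 //; exact: ltnW.
  apply: reach_trans R1 _; apply: reach_trans R2 _.
  by apply: reach_op h1 f2 _; apply: reach_refl.
have [sf1 sf2 ha hi hj] := sf.
have [c1 {}h] := code_at_cat h; have [c2 {}h] := code_at_cat h.
have [c3 {}h] := code_at_cat h; rewrite !size_exp_code in c2 c3 h.
have [r1 [R1 f1 v1 k1]] := IH1 d p r t c1 hd ss f sf1.
have ss1 : same_store s r1 m by apply: same_store_temp ss _ => x hx; apply: k1; lia.
have [r2 [R2 f2 v2 k2]] := IH2 d.+1 _ r1 _ c2 (leqW hd) ss1 f1 sf2.
have ss2 : same_store s r2 m by apply: same_store_temp ss1 _ => x hx; apply: k2; lia.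
have r20 : r2 0 = n by have [Hr <- _] := ss2; apply: Hr.
have [r3 [R3 f3 v3 k3]] := addr_codeP c3 hd f2 r20 (etrans (k2 d (leqnn _)) v1) v2 ha hi hj.
have [h1 _] := code_at_cons h.
have b4 : m (r3 d) <= W by case: f3.
have f4 := fits_reg (p + ecost e1 + ecost e2 + 7).+1 (t + ecost e1 + ecost e2 + 7).+1 b o d f3 b4.
rewrite (_ : 8 = 7 + 1) // !addnA !addn1.
eexists; split; last 3 first.
+ exact: f4.
+ by rewrite /= eqxx v3; have [_ _ ->] := ss.
+ by move=> y yd; rewrite /= (ltn_eqF yd) k3 ?k2 ?k1 //; lia.
apply: reach_trans R1 _; apply: reach_trans R2 _; apply: reach_trans R3 _.
apply: (reach_step f3); first by rewrite /step /= h1.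
exact: reach_refl.
Qed.

Lemma size_cmp_code b l : size (cmp_code b l) = ccost b.
Proof. by case: b => e1 e2; rewrite /= !size_cat !size_exp_code /=; lia. Qed.

Lemma cmp_codeP s b l p c : code_at p (cmp_code b l) -> pc c = p -> agree s c ->
  safec n W b s -> exists c', [/\ reach c c',
    pc c' = (if evc b s then l else p + ccost b) & agree (tick (ccost b) s) c'].
Proof.
case: c => q r m t bf o h /= Eq; subst q => -[ss /= Et Eb Eo f] sb.
have [e1 [e2 [j [Eb1 Ej sf1 sf2]]]] : exists e1 e2 j,
    [/\ cmp_code b l = exp_code nregs e1 ++ exp_code nregs.+1 e2 ++ [:: j] /\
         ccost b = ecost e1 + ecost e2 + 1,
      forall r', r' nregs = ev e1 s -> r' nregs.+1 = ev e2 s ->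
        forall q' m' t' b' o', exec j (Config q' r' m' t' b' o') =
          Config (if evc b s then l else q'.+1) r' m' t'.+1 b' o',
      safe n W e1 s & safe n W e2 s].
  by case: (b) sb => e1 e2 [sf1 sf2]; exists e1, e2;
    [exists (JumpEq nregs nregs.+1 l) | exists (JumpLt nregs nregs.+1 l)];
    split=> // r' /= E1 E2 *; rewrite E1 E2.
case: Eb1 => Ec Ecost; rewrite Ec in h.
have [c1 {}h] := code_at_cat h; have [c2 {}h] := code_at_cat h.
rewrite !size_exp_code in c2 h.
have [r1 [R1 f1 v1 k1]] := exp_codeP c1 (leqnn _) ss f sf1.
have ss1 : same_store s r1 m by apply: same_store_temp ss _.
have [r2 [R2 f2 v2 k2]] := exp_codeP c2 (leqnSn _) ss1 f1 sf2.
have [h1 _] := code_at_cons h.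
have Ej' := Ej r2 (etrans (k2 nregs (leqnn _)) v1) v2.
eexists; split.
- apply: reach_trans R1 _; apply: reach_trans R2 _; apply: (reach_step f2).
    by rewrite (step_at (c := Config _ _ _ _ _ _) h1) Ej'.
  by apply: reach_refl; apply: fits_pc f2.
- by rewrite /= Ecost !addn1 !addnS addnA.
split; rewrite //=.
  by apply: same_store_temp ss1 _ => x hx; apply: k2; apply: leqW.
by rewrite Ecost -Et; lia.
Qed.

Lemma agree_pc s p r m t b o k p' : agree s (Config p r m t b o) -> 
  agree (tick k s) (Config p' r m (t + k) b o).
Proof. by case=> /= [[h1 h2 h3]] Et Eb Eo f; split; rewrite //= ?Et //; apply: fits_pc f. Qed.

Lemma jumpP s c l : onth P (pc c) = Some (Jump l) -> agree s c ->
  exists c', [/\ reach c c', pc c' = l & agree (tick 1 s) c'].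
Proof.
case: c => p r m t b o /= E A; exists (Config l r m (t + 1) b o); split=> //.
  have [_ _ _ _ f] := A; apply: (reach_step f); first by rewrite /step /= E.
  by rewrite addn1; apply: reach_refl; apply: fits_pc f.
exact: agree_pc A.
Qed.

Lemma asg_codeP s x e p c : 0 < x < nregs -> safe n W e s ->
  code_at p (asg_code x e) -> pc c = p -> agree s c ->
  exists c', [/\ reach c c', pc c' = p + size (asg_code x e)
    & agree (tick (ecost e + 2) (setv x (ev e s) s)) c'].
Proof.
case/andP=> x0 hx sf h; case: c => q r m t b o /= Eq; subst q => -[ss /= Et Eb Eo f].
have [c1 {}h] := code_at_cat h; rewrite size_exp_code in h.
have [r1 [R1 f1 v1 k1]] := exp_codeP c1 (leqnn _) ss f sf.
have [h1 {}h] := code_at_cons h; have [h2 _] := code_at_cons h.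
have f2 := fits_reg (p + ecost e).+1 (t + ecost e).+1 b o nregs.+1 f1 (leq0n W).
have vW : ev e s + 0 <= W by rewrite addn0 -v1; case: f1.
have f3 := fits_reg (p + ecost e).+2 (t + ecost e).+2 b o x f2 vW.
eexists; split.
- apply: reach_trans R1 _; apply: reach_const h1 f1 _; apply: reach_op h2 f2 _.
  by rewrite /= v1; apply: reach_refl; exact: f3.
- by rewrite size_cat size_exp_code /= addnA addn2.
split; rewrite //=; last by rewrite Et addn2 addnS addnS.
have [h1' h2' h3'] := ss; split=> //= [y hy|].
  rewrite addn0 -[Nat.eqb y x]/(y == x); case: ifP => // yx.
  by rewrite (_ : (y == 25) = false) ?k1 ?h1' //; lia.
by case: (x) x0.
Qed.

Lemma size_seq_code f g p : size (seq_code f g p) = size (f p) + size (g (p + size (f p))).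
Proof. by rewrite size_cat. Qed.

Lemma size_if_code b f g p (q := p + ccost b + size (g (p + ccost b)) + 1) :
  p + size (if_code b f g p) = q + size (f q).
Proof. by rewrite !size_cat size_cmp_code /= /q; lia. Qed.

Lemma size_while_code b f p (q := p + ccost b + 1) :
  p + size (while_code b f p) = q + size (f q) + 1.
Proof. by rewrite !size_cat size_cmp_code /= /q; lia. Qed.

(** By induction on the derivation rather than on the command: in a loop, the remaining iterations
    are a smaller derivation for the same code at the same position. *)
Lemma codeP c s s' : ex n W c s s' -> forall p cf, code_at p (code c p) -> pc cf = p ->
  agree s cf -> exists cf', [/\ reach cf cf', pc cf' = p + size (code c p) & agree s' cf'].
Proof.
elim=> {c s s'}.
- by move=> x e s hx sf p cf h Ep A; apply: asg_codeP.
- move=> a e1 e2 e s [sf1 sf2 ha hi hj] sf p [q r m t b o] h /= Eq; subst q.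
  case=> [ss /= Et Eb Eo f].
  have [c1 {}h] := code_at_cat h; have [c2 {}h] := code_at_cat h.
  have [c3 {}h] := code_at_cat h; have [c4 {}h] := code_at_cat h.
  rewrite !size_exp_code in c2 c3 c4 h.
  have [r1 [R1 f1 v1 k1]] := exp_codeP c1 (leqnn _) ss f sf1.
  have ss1 : same_store s r1 m by apply: same_store_temp ss _ => x hx; apply: k1.
  have [r2 [R2 f2 v2 k2]] := exp_codeP c2 (leqnSn _) ss1 f1 sf2.
  have ss2 : same_store s r2 m.
    by apply: same_store_temp ss1 _ => x hx; apply: k2; apply: leqW.
  have r20 : r2 0 = n by have [Hr <- _] := ss2; apply: Hr.
  have [r3 [R3 f3 v3 k3]] :=
    addr_codeP c3 (leqnn _) f2 r20 (etrans (k2 nregs (leqnn _)) v1) v2 ha hi hj.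
  have ss3 : same_store s r3 m by apply: same_store_temp ss2 _ => x hx; apply: k3; lia.
  have [r4 [R4 f4 v4 k4]] := exp_codeP c4 (leqnSn _) ss3 f3 sf.
  have [h1 _] := code_at_cons h.
  have vW : ev e s <= W by rewrite -v4; case: f4.
  have r4a : r4 nregs = addr a (ev e1 s) (ev e2 s) by rewrite k4.
  have aS : addr a (ev e1 s) (ev e2 s) < space.
    by apply: leq_trans (addr_bound ha hi hj) space_large.
  set pf := p + _ + _ + 7 + _ in h1 f4; set tf := t + _ + _ + 7 + _ in f4.
  have f5 : fit (Config pf.+1 r4 [eta m with r4 nregs |-> r4 nregs.+1] tf.+1 b o).
    case: f4 => g1 g2 g3; split=> //= y; last by case: ifP => // _; rewrite v4.
    by move=> hy; case: eqP => [Ey|_]; [by rewrite Ey r4a leqNgt aS in hy | apply: g1].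
  eexists; split.
  + apply: reach_trans R1 _; apply: reach_trans R2 _; apply: reach_trans R3 _.
    apply: reach_trans R4 _; apply: (reach_step f4); first by rewrite /step /= h1.
    by apply: reach_refl; exact: f5.
  + by rewrite /= !size_cat !size_exp_code /= size_cat size_exp_code /= /pf; lia.
  split; rewrite //=; last by rewrite -Et /tf; lia.
  have [/= g1 g2 g3] : same_store s r4 m.
    by apply: same_store_temp ss3 _ => x hx; apply: k4; apply: leqW.
  split=> //= [a' i' j' ha' hi' hj'].
  rewrite r4a v4 -[Nat.eqb a' a]/(a' == a).
  case: eqP => [/(addr_inj hi' hi hj' hj) [-> -> ->] | ne]; first by rewrite !eqxx.
  rewrite g3 //; case: eqP => // Ea; subst a'; case: eqP => // Ei; case: eqP => // Ej.
  by case: ne; rewrite Ei Ej.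
- move=> c1 c2 s s1 s2 _ IH1 _ IH2 p cf h Ep A; have [h1 h2] := code_at_cat h.
  have [cf1 [R1 E1 A1]] := IH1 p cf h1 Ep A.
  have [cf2 [R2 E2 A2]] := IH2 _ cf1 h2 E1 A1.
  by exists cf2; split=> //; [apply: reach_trans R2 | rewrite E2 size_seq_code addnA].
- move=> b c1 c2 s s1 sb evb _ IH p cf h Ep A.
  have [h1 {}h] := code_at_cat h; have [_ {}h] := code_at_cat h.
  have [h2 h3] := code_at_cons h.
  have [cf1 [R1 E1 A1]] := cmp_codeP h1 Ep A sb; rewrite evb in E1.
  rewrite size_cmp_code -addnS -addn1 !addnA in h3.
  have [cf2 [R2 E2 A2]] := IH _ cf1 h3 E1 A1.
  exists cf2; split=> //; first exact: reach_trans R2.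
  by rewrite E2; apply/esym; exact: size_if_code.
- move=> b c1 c2 s s1 sb evb _ IH p cf h Ep A.
  have [h1 {}h] := code_at_cat h; have [h2 {}h] := code_at_cat h.
  rewrite !size_cmp_code in h2 h; have [h3 _] := code_at_cons h.
  have [cf1 [R1 E1 A1]] := cmp_codeP h1 Ep A sb; rewrite (negbTE evb) in E1.
  have [cf2 [R2 E2 A2]] := IH _ cf1 h2 E1 A1.
  rewrite -E2 in h3; have [cf3 [R3 E3 A3]] := jumpP h3 A2.
  exists cf3; split=> //; first by apply: reach_trans R1 _; apply: reach_trans R2 _.
  by rewrite E3 E2; apply/esym; exact: size_if_code.
- move=> b c s s1 s2 sb evb _ IH _ IHw p cf hw Ep A; have h := hw.
  have [h1 {}h] := code_at_cat h; have [_ {}h] := code_at_cons h.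
  have [h2 {}h] := code_at_cat h; rewrite !size_cmp_code -addn1 in h2 h.
  have [h3 _] := code_at_cons h.
  have [cf1 [R1 E1 A1]] := cmp_codeP h1 Ep A sb; rewrite evb in E1.
  have [cf2 [R2 E2 A2]] := IH _ cf1 h2 E1 A1.
  rewrite -E2 in h3; have [cf3 [R3 E3 A3]] := jumpP h3 A2.
  have [cf4 [R4 E4 A4]] := IHw p cf3 hw E3 A3.
  exists cf4; split=> //.
  by apply: reach_trans R1 _; apply: reach_trans R2 _; apply: reach_trans R3 _.
- move=> b c s sb evb p cf h Ep A.
  have [h1 {}h] := code_at_cat h; rewrite size_cmp_code in h.
  have [h2 _] := code_at_cons h.
  have [cf1 [R1 E1 A1]] := cmp_codeP h1 Ep A sb; rewrite (negbTE evb) in E1.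
  rewrite -E1 in h2; have [cf2 [R2 E2 A2]] := jumpP h2 A1.
  exists cf2; split; first exact: reach_trans R2.
    by rewrite E2 E1; apply/esym; exact: size_while_code.
  by move: A2; rewrite /tick /= addnA.
- by move=> x y c s s1 _ IH p cf h Ep A; apply: IH.
- move=> e s sf p [q r m t b o] h /= Eq; subst q; case=> [ss /= Et Eb Eo f].
  have [c1 {}h] := code_at_cat h; rewrite size_exp_code in h.
  have [r1 [R1 f1 v1 k1]] := exp_codeP c1 (leqnn _) ss f sf.
  have [h1 _] := code_at_cons h.
  eexists; split.
  + apply: reach_trans R1 _; apply: (reach_step f1); first by rewrite /step /= h1.
    by apply: reach_refl; apply: fits_pc f1.
  + by rewrite size_cat size_exp_code /= addn1 addnS.
  split; rewrite //= ?v1 ?Eb //.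
    by apply: same_store_temp ss _ => x hx; apply: k1.
  by rewrite -Et addn1 addnS.
- move=> s p [q r m t b o] /= h Eq; subst q; case=> [ss /= Et Eb Eo f].
  have [h1 _] := code_at_cons h.
  eexists; split.
  + apply: (reach_step f); first by rewrite /step /= h1.
    by apply: reach_refl; apply: fits_pc f.
  + by rewrite /= addn1.
  by split; rewrite //= ?Et ?Eb ?Eo ?addn1 //; apply: fits_pc f.
- move=> s p cf _ Ep A; exists cf; split=> //; last by rewrite addn0.
  by apply: reach_refl; case: A.
Qed.

End Compilation.

Lemma run_program n W space c s0 s cf : narrays * (n + 1) ^ 2 <= W ->
  (3 * n + narrays) * n <= space -> ex n W c s0 s ->
  agree n W space s0 cf -> pc cf = 0 -> clock cf = 0 ->
  (forall t c1, run (code c 0) t cf = Some c1 -> fits space W c1) /\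
  exists c1, [/\ run (code c 0) (clk s) cf = Some c1, step (code c 0) c1 = None,
    buf c1 = sbuf s & out c1 = souts s].
Proof.
move=> hW hS hc A Ep Et.
have [|c1 [R E1 [_ T1 B1 O1 _]]] := codeP hW hS (P := code c 0) hc _ Ep A; first by [].
have halt : step (code c 0) c1 = None.
  by rewrite /step E1 onthE nth_default // size_map.
split; first exact: reach_halt_inv R halt.
exists c1; split=> //; have [t rt ct] := reach_run R.
by rewrite -T1 ct Et.
Qed.

(** * Preprocessing *)

(* For v in the base, aRep v is the last vertex of its clique; aFlag and aNeed
   are indexed by these representatives.  For a outside the base, the row a of
   aList lists the aDeg a neighbours of a in the base, and aPriv a u tells
   whether a dominates the clique of its neighbour u.  aDead marks the vertices
   that are ignored by the second search for simplicial vertices.  For the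
   current set A, aDom u and aSum u are the number and the sum of the neighbours
   of u in A, and aCount a is the number of vertices private to a. *)
Notation aAdj := 0. Notation aList := 1. Notation aPriv := 2.
Notation aWeight := 3. Notation aPos := 4. Notation aDead := 5. Notation aBase := 6.
Notation aRep := 7. Notation aFlag := 8. Notation aDeg := 9. Notation aSol := 10.
Notation aDom := 11. Notation aSum := 12. Notation aCount := 13. Notation aNeed := 14.

Declare Scope cmd_scope.
Delimit Scope cmd_scope with cmd.
Notation "c1 ;; c2" := (Seq c1 c2) (at level 60, right associativity) : cmd_scope.
Notation "x ::= e" := (Asg x e) (at level 55, no associativity) : cmd_scope.
Notation "a '@[' i ']' ::= e" := (Put a (Num 0) i e)
  (at level 55, i at level 50, no associativity) : cmd_scope.
Open Scope cmd_scope.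

Definition vec a e := Get a (Num 0) e.
(* Boolean operations on the values 0 and 1; subtraction is truncated. *)
Definition eneg e := Bin Defs.Sub (Num 1) e.
Definition eand e1 e2 := Bin Defs.Sub e1 (eneg e2).
Definition esucc e := Bin Defs.Add e (Num 1).
Notation "? x" := (Var x) (at level 0, x at level 0, format "? x").

Definition close_adjacency := For 1 0 (Put aAdj ?1 ?1 (Num 1)).

(** Register 4 holds the best weight plus one, 0 standing for no candidate, so that a vertex of
    weight 0 can be selected. *)
Definition select_heaviest :=
  For 1 0 (If (CEq (vec aPos ?1) (Num 0))
    (If (CLt ?4 (esucc (vec aWeight ?1)))
       (3 ::= ?1 ;; 4 ::= esucc (vec aWeight ?1)) Skip) Skip).

Definition search :=
  For 7 0 (3 ::= Num 0 ;; 4 ::= Num 0 ;; select_heaviest ;;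
    aPos @[ ?3 ] ::= esucc ?7 ;;
    For 1 0 (aWeight @[ ?1 ] ::= Bin Defs.Add (vec aWeight ?1) (Get aAdj ?3 ?1))).

Definition base_nb := eand (Get aAdj ?1 ?2) (vec aBase ?2).

Definition last_visited :=
  3 ::= Num 0 ;; 4 ::= Num 0 ;;
  For 2 0 (If (CEq (Bin Defs.Sub (Get aAdj ?1 ?2) (vec aDead ?2)) (Num 1))
    (If (CLt ?4 (vec aPos ?2)) (3 ::= ?2 ;; 4 ::= vec aPos ?2) Skip) Skip).

Definition mark_simplicial :=
  For 1 0 (If (CEq (vec aDead ?1) (Num 0))
   (last_visited ;; 6 ::= Num 1 ;;
    For 2 0 (If (CEq (Bin Defs.Sub (Get aAdj ?1 ?2) (vec aDead ?2)) (Num 1))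
      (If (CEq (Get aAdj ?3 ?2) (Num 0)) (6 ::= Num 0) Skip) Skip) ;;
    If (CEq ?6 (Num 1)) (aBase @[ ?1 ] ::= Num 1) Skip) Skip).

Definition mark_dead :=
  For 1 0 (For 2 0 (If (CEq base_nb (Num 1)) (aDead @[ ?1 ] ::= Num 1) Skip)).

(** Later writes overwrite earlier ones, so the base neighbour of largest index remains, which is
    [last_nb]. *)
Definition representatives :=
  For 1 0 (If (CEq (vec aBase ?1) (Num 1))
    (For 2 0 (If (CEq base_nb (Num 1)) (aRep @[ ?1 ] ::= ?2) Skip)) Skip).

(** For the vertex in register 1, a linear pass marks the cliques that it does not dominate
    entirely; a whole row of [aPriv] is then filled in linear time. *)
Definition flag_missed :=
  For 2 0 (aFlag @[ ?2 ] ::= Num 0) ;;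
  For 2 0 (If (CEq (vec aBase ?2) (Num 1))
    (If (CEq (Get aAdj ?1 ?2) (Num 0)) (aFlag @[ vec aRep ?2 ] ::= Num 1) Skip) Skip).

Definition base_lists :=
  For 1 0 (If (CEq (vec aBase ?1) (Num 0))
    (flag_missed ;; 5 ::= Num 0 ;;
     For 2 0 (If (CEq base_nb (Num 1))
       (Put aList ?1 ?5 ?2 ;; Put aPriv ?1 ?2 (eneg (vec aFlag (vec aRep ?2))) ;;
        5 ::= esucc ?5) Skip) ;;
     aDeg @[ ?1 ] ::= ?5) Skip).

Ltac solve_safe := rewrite /nrows /=; repeat split; rewrite //=; try (move=> _); lia.

Lemma ltnS_ord n (v i : 'I_n) : (v < i.+1) = (v == i) || (v < i).
Proof. by rewrite ltnS leq_eqVlt. Qed.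

Section Preprocessing.
Variables (n : nat) (G : sgraph n) (W : nat).
Hypothesis wordW : narrays * (n + 1) ^ 2 <= W.
Local Notation nb := (nb G).
Local Notation wp := (wp n W).

Lemma n_lt_W : n + n + 10 < W.
Proof. by apply: leq_trans wordW; lia. Qed.

Lemma wp_forn (I : nat -> state -> Prop) x c s (Q : state -> Prop) :
  [&& 0 < x < nregs, x \notin wr c & 0 \notin wr c] -> vars s 0 = n ->
  I 0 (tick 3 (setv x 0 s)) ->
  (forall (i : 'I_n) s1, keeps (For x 0 c) s s1 -> vars s1 0 = n -> vars s1 x = i ->
     I i s1 -> wp c (tick 5 s1) (fun s2 => I i.+1 (tick 7 (setv x i.+1 s2)))) ->
  (forall s1, keeps (For x 0 c) s s1 -> I n s1 -> Q (tick 6 s1)) ->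
  wp (For x 0 c) s Q.
Proof.
case/and3P=> hx xc c0 sn I0 IS Qf; have hW := n_lt_W.
have x0 : x != 0 by case/andP: hx; rewrite lt0n.
apply: (wp_for (I := I)); rewrite ?sn //; last 1 first.
- move=> i s1 hi ks sx Is; rewrite -[i]/(nat_of_ord (Ordinal hi)).
  apply: IS => //; have [-> //] := ks; by rewrite inE negb_or eq_sym x0.
- by rewrite hx xc c0 x0.
- by lia.
Qed.

Lemma close_adjacencyP s : vars s 0 = n ->
  (forall u v : 'I_n, mem s aAdj u v = adj G u v) ->
  wp close_adjacency s (fun s1 => forall u v : 'I_n, mem s1 aAdj u v = nb u v).
Proof.
move=> sn A0.
apply: (wp_forn (I := fun i s1 => forall u v : 'I_n,
  mem s1 aAdj u v = if (u == v) && (u < i) then 1 else adj G u v)) => //.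
- by move=> u v /=; rewrite ltn0 andbF.
- move=> i s1 _ _ s1i Is; apply: wp_put => /=; rewrite ?s1i.
    by rewrite /nrows /=; split=> //.
    by have := n_lt_W; lia.
  move=> u v; rewrite ltnS leq_eqVlt; case: (eqVneq u v) => [<- | uv] /=.
    by rewrite andbb; case: eqVneq => //= ui; rewrite Is eqxx.
  rewrite Is (negbTE uv) /=; case: ifP => // /andP [/eqP ui /eqP vi].
  by move: uv; rewrite -val_eqE /= ui vi eqxx.
move=> s1 _ Is u v /=; rewrite Is ltn_ord andbT /nb eq_sym.
by case: eqVneq.
Qed.

Definition ranked t s :=
  search_prefix G t (fun v : 'I_n => mem s aPos 0 v) /\
  forall v : 'I_n, mem s aWeight 0 v = weight G (fun v : 'I_n => mem s aPos 0 v) v.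

Lemma weight_le pos v : weight G pos v <= n.
Proof. by rewrite -[leqRHS]card_ord max_card. Qed.

Lemma select_heaviestP t s : vars s 0 = n -> vars s 4 = 0 -> t < n -> ranked t s ->
  wp select_heaviest s (fun s1 => exists2 b : 'I_n, vars s1 3 = b & mem s aPos 0 b = 0 /\
    forall x : 'I_n, mem s aPos 0 x = 0 -> mem s aWeight 0 x <= mem s aWeight 0 b).
Proof.
move=> sn s4 tn [spos wts]; have hW := n_lt_W.
apply: (wp_forn (I := fun i s1 =>
  (vars s1 4 = 0 \/ exists2 b : 'I_n, vars s1 3 = b &
     mem s aPos 0 b = 0 /\ vars s1 4 = (mem s aWeight 0 b).+1) /\
  forall x : 'I_n, x < i -> mem s aPos 0 x = 0 -> mem s aWeight 0 x < vars s1 4)) => //.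
- by split=> //; left.
- move=> i s1 [kv km _] s1n s1i [Ib Im].
  have wle : mem s aWeight 0 i + 1 <= W by rewrite wts; have := weight_le (fun v : 'I_n => mem s aPos 0 v) i; lia.
  have m3 : mem s1 aWeight = mem s aWeight by apply: km.
  have m4 : mem s1 aPos = mem s aPos by apply: km.
  apply: wp_if => [|/=|/=].
  + by rewrite /nrows /= s1i.
  + rewrite s1i m4 => /eqP pi; apply: wp_if => [|/=|/=].
    * by rewrite /= s1i m3; solve_safe.
    * rewrite s1i m3 => lt; apply: wp_seq; apply: wp_asg => //; rewrite /= s1i.
      apply: wp_asg => //; first by rewrite /= s1i m3; solve_safe.
      rewrite /= s1i.
      rewrite m3 addn1; split; first by right; exists i.
      move=> x; rewrite ltnS leq_eqVlt => /orP [/eqP/val_inj -> // | xi px].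
      by have := Im x xi px; lia.
    * rewrite s1i m3 -leqNgt => le; apply: wp_skip => /=; split=> //.
      move=> x; rewrite ltnS leq_eqVlt => /orP [/eqP/val_inj -> px | xi px].
        by lia.
      by have := Im x xi px; lia.
  + rewrite s1i m4 => ni; apply: wp_skip => /=; split=> //.
    move=> x; rewrite ltnS leq_eqVlt => /orP [/eqP/val_inj -> px | ]; last exact: Im.
    by rewrite px in ni.
move=> s1 _ [Ib Im] /=.
have [v /eqP v0] := search_prefix_unvisited spos tn.
have lt := Im v (ltn_ord v) v0.
case: Ib => [E | [b E [pb Eb]]]; first by rewrite E in lt.
by exists b => //; split=> // x px; have := Im x (ltn_ord x) px; rewrite Eb.
Qed.

Lemma searchP s : vars s 0 = n -> (forall u v : 'I_n, mem s aAdj u v = nb u v) ->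
  (forall v : 'I_n, mem s aPos 0 v = 0) -> (forall v : 'I_n, mem s aWeight 0 v = 0) ->
  wp search s (fun s1 => ranked n s1).
Proof.
move=> sn A p0 w0; have hW := n_lt_W.
apply: (wp_forn (I := ranked)) => //.
- split=> [|v]; first exact: search_prefix0.
  rewrite /= w0; apply/esym/eqP; rewrite cards_eq0; apply/eqP/setP => u.
  by rewrite !inE p0.
- move=> t s1 [kv km _] s1n s1t Rs; have tn := ltn_ord t.
  have m0 : mem s1 aAdj = mem s aAdj by apply: km.
  apply: wp_seq; apply: wp_asg => //; apply: wp_seq; apply: wp_asg => //; apply: wp_seq.
  apply: wp_weak (select_heaviestP (t := t) _ _ _ _) _ => //.
  move=> s2 [kv2 km2 _] [b s2b [/= pb maxb]].
  have s2t : vars s2 7 = t by rewrite kv2.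
  have s2n : vars s2 0 = n by rewrite kv2.
  have M a : mem s2 a = mem s1 a by rewrite km2.
  apply: wp_seq; apply: wp_put => /=.
    by rewrite /nrows /= s2b.
    by rewrite s2t; solve_safe.
  rewrite s2b s2t; have [spos wts] := Rs.
  apply: (wp_forn (I := fun i s3 => forall v : 'I_n,
    mem s3 aWeight 0 v = mem s1 aWeight 0 v + (v < i) && nb b v)) => //.
  + by move=> v; rewrite /= M addn0.
  + move=> i s3 [kv3 km3 _] s3n s3i Is.
    have s3b : vars s3 3 = b by rewrite kv3.
    have A3 : mem s3 aAdj b i = nb b i by rewrite km3 //= M m0 A.
    apply: wp_put => /=.
      by rewrite /nrows /= s3i.
      rewrite /nrows /= s3b s3i A3 Is ltnn addn0 wts; repeat split=> //.
      by have := weight_le (fun v : 'I_n => mem s1 aPos 0 v) i; case: (nb _ _); lia.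
    rewrite s3b s3i A3 => v; rewrite !Is val_eqE (ltnS_ord v i).
    by case: eqVneq => [->|_] /=; rewrite ?ltnn ?addn0.
  move=> s3 [kv3 km3 _] Is; split=> /=.
    rewrite km3 //=; apply: (search_prefix_step spos pb) => [x px|v].
      by rewrite -!wts; apply: maxb.
    by rewrite M /= val_eqE addn1.
  move=> v; rewrite Is ltn_ord /= wts km3 //= /weight.
  pose X := [set u : 'I_n | (0 < mem s1 aPos 0 u) && nb v u].
  rewrite -/X [nb b v]nb_sym; set Y := [set u | _ & _].
  have -> : Y = if nb v b then b |: X else X.
    apply/setP => u; rewrite /Y inE M val_eqE; case vb: (nb v b); rewrite ?inE;
      case: (eqVneq u b) => [-> | _] //=; last by rewrite vb andbF pb.
    by rewrite vb addn1.
  case: ifP => bv; last by rewrite addn0.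
  by rewrite cardsU1 inE pb /= addnC.
Qed.


Definition closed_adjacency s := forall u v : 'I_n, mem s aAdj u v = nb u v.

Definition indicates s a (X : {set 'I_n}) := forall v : 'I_n, mem s a 0 v = (v \in X).

Definition visit_order s (pos : 'I_n -> nat) := [/\ forall v : 'I_n, mem s aPos 0 v = pos v,
  forall v, 0 < pos v, injective pos & search_order G pos].

Lemma nat_of_bool_eq1 (b : bool) : (b == 1 :> nat) = b.
Proof. by case: b. Qed.

Lemma nat_of_bool_eq0 (b : bool) : (b == 0 :> nat) = ~~ b.
Proof. by case: b. Qed.

Lemma subn_bool (b c : bool) : b - c = b && ~~ c.
Proof. by case: b; case: c. Qed.

Lemma andb_eand (b c : bool) : b - (1 - c) = b && c.
Proof. by case: b; case: c. Qed.

Lemma last_visitedP s pos (X : {set 'I_n}) (v : 'I_n) :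
  vars s 0 = n -> vars s 1 = v -> closed_adjacency s -> visit_order s pos ->
  indicates s aDead (~: X) -> v \in X ->
  wp last_visited s (fun s1 => exists2 z : 'I_n, vars s1 3 = z &
    [/\ z \in X, nb v z & forall u, u \in X -> nb v u -> pos u <= pos z]).
Proof.
move=> sn sv A [Epos pos0 _ _] dead vX; have hW := n_lt_W.
do 2![apply: wp_seq; apply: wp_asg => //].
apply: (wp_forn (I := fun i s1 =>
  (vars s1 4 = 0 \/ exists2 z : 'I_n, vars s1 3 = z &
     [/\ z \in X, nb v z & vars s1 4 = pos z]) /\
  forall u : 'I_n, u < i -> u \in X -> nb v u -> pos u <= vars s1 4)) => //.
- by split=> //; left.
- move=> i s1 [kv km _] s1n s1i [Ib Im].
  have s1v : vars s1 1 = v by rewrite kv.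
  have M a : mem s1 a = mem s a by rewrite km.
  apply: wp_if => [|/=|/=].
  + by rewrite /= s1v s1i; solve_safe.
  + rewrite !M s1v s1i A dead inE subn_bool negbK nat_of_bool_eq1 => /andP [vi iX].
    apply: wp_if => [|/=|/=].
    * by rewrite /= s1i; solve_safe.
    * rewrite s1i M Epos => lt; apply: wp_seq; apply: wp_asg => //; rewrite /= s1i.
      apply: wp_asg => //; first by rewrite /= s1i; solve_safe.
      rewrite /= s1i M Epos; split; first by right; exists i.
      move=> u; rewrite ltnS_ord => /orP [/eqP -> // | ui uX vu].
      by have := Im u ui uX vu; lia.
    * rewrite s1i M Epos -leqNgt => le; apply: wp_skip => /=; split=> //.
      by move=> u; rewrite ltnS_ord => /orP [/eqP -> | ]; [lia | apply: Im].
  + rewrite !M s1v s1i A dead inE subn_bool negbK nat_of_bool_eq1 => ni.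
    apply: wp_skip => /=; split=> // u; rewrite ltnS_ord => /orP [/eqP -> iX vi|]; last exact: Im.
    by rewrite vi iX in ni.
move=> s1 _ [Ib Im] /=; have := Im v (ltn_ord v) vX (nb_refl G v); have := pos0 v.
case: Ib => [-> | [z E [zX vz Ez]]]; first by lia.
by exists z => //; split=> // u uX vu; rewrite -Ez; apply: Im.
Qed.

Hypothesis chG : chordal G.

(** The other members of N[v] in [X] precede [z], so they are pairwise adjacent once [z] sees them:
    one comparison of rows replaces a test of all pairs. An order of the whole graph works for every
    [X], hence one search serves both passes. *)
Lemma simplicial_last (pos : 'I_n -> nat) (X : {set 'I_n}) v z :
  injective pos -> search_order G pos -> v \in X -> z \in X -> nb v z ->
  (forall u, u \in X -> nb v u -> pos u <= pos z) ->
  simplicial G X v = [forall u in X, nb v u ==> nb z u].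
Proof.
move=> pos_inj so vX zX vz last_z; apply/idP/forall_inP => [/simplicialP [_ S] u uX | h].
  by apply/implyP => vu; apply: S.
have zu u : u \in X -> nb v u -> nb z u by move=> uX vu; have /implyP := h u uX; apply.
apply/simplicialP; split=> // u w uX wX vu vw.
case: (eqVneq u z) => [-> | uz]; first exact: zu.
case: (eqVneq w z) => [-> | wz]; first by rewrite nb_sym zu.
apply: (search_order_clique chG pos_inj so (x := z)); rewrite ?zu //.
  by rewrite ltn_neqAle (inj_eq pos_inj) uz last_z.
by rewrite ltn_neqAle (inj_eq pos_inj) wz last_z.
Qed.

Lemma mark_simplicialP s pos (X B : {set 'I_n}) :
  vars s 0 = n -> closed_adjacency s -> visit_order s pos ->
  indicates s aDead (~: X) -> indicates s aBase B ->
  wp mark_simplicial s (fun s1 => indicates s1 aBase (B :|: [set v | simplicial G X v])).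
Proof.
move=> sn A vis dead base0; have [Epos pos0 pos_inj so] := vis; have hW := n_lt_W.
apply: (wp_forn (I := fun i s1 => forall v : 'I_n,
  mem s1 aBase 0 v = (v \in B) || (v < i) && simplicial G X v)) => //.
- by move=> v; rewrite /= orbF base0.
- move=> v s1 [kv km _] s1n s1v Is.
  have M a : a != aBase -> mem s1 a = mem s a by move=> ha; rewrite km // inE.
  apply: wp_if => [|/=|/=].
  + by rewrite /= s1v; solve_safe.
  + rewrite s1v M // dead inE nat_of_bool_eq0 negbK => vX.
    apply: wp_seq; apply: wp_weak (last_visitedP (pos := pos) (X := X) (v := v) _ _ _ _ _ _) _ => //=.
    * by move=> u w /=; rewrite M.
    * by split=> // w; rewrite /= M.
    * by move=> w; rewrite /= M.
    move=> s2 [kv2 km2 _] [z s2z [zX vz last_z]].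
    have M2 a : a != aBase -> mem s2 a = mem s a by move=> ha; rewrite km2 //= M.
    have M2b : mem s2 aBase = mem s1 aBase by rewrite km2.
    have s2n : vars s2 0 = n by rewrite kv2.
    have s2v : vars s2 1 = v by rewrite kv2.
    apply: wp_seq; apply: wp_asg => //=; first by lia.
    apply: wp_seq; apply: (wp_forn (I := fun i s3 =>
      vars s3 6 = [forall u : 'I_n, (u < i) ==> (u \in X) ==> nb v u ==> nb z u])) => //=.
    * by rewrite (_ : [forall u, _]) //; apply/forallP.
    * move=> u s3 [kv3 km3 _] s3n s3u Is3.
      have M3 a : a != aBase -> mem s3 a = mem s a by move=> ha; rewrite km3 //= M2.
      have s3v : vars s3 1 = v by rewrite kv3.
      have s3z : vars s3 3 = z by rewrite kv3.
      have AE : [forall w : 'I_n, (w < u.+1) ==> (w \in X) ==> nb v w ==> nb z w] =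
         [forall w : 'I_n, (w < u) ==> (w \in X) ==> nb v w ==> nb z w] &&
         ((u \in X) ==> nb v u ==> nb z u).
        apply/forallP/andP => [h | [/forallP h1 h2] w].
          split; last by have := h u; rewrite ltnSn.
          by apply/forallP => w; apply/implyP => wu; have := h w; rewrite ltnS (ltnW wu).
        by rewrite ltnS_ord; case: (eqVneq w u) => [-> | _] //=; apply: h1.
      apply: wp_if => [|/=|/=].
      - by rewrite /= s3v s3u; solve_safe.
      - rewrite !M3 // s3v s3u A dead inE subn_bool negbK nat_of_bool_eq1 => /andP [vu uX].
        apply: wp_if => [|/=|/=].
        + by rewrite /= s3z s3u; solve_safe.
        + rewrite M3 // s3z s3u A nat_of_bool_eq0 => nzu; apply: wp_asg => //=.
          by rewrite AE uX vu (negbTE nzu) andbF.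
        + rewrite M3 // s3z s3u A nat_of_bool_eq0 negbK => zu; apply: wp_skip => /=.
          by rewrite AE uX vu zu andbT.
      - rewrite !M3 // s3v s3u A dead inE subn_bool negbK nat_of_bool_eq1 => ni.
        apply: wp_skip => /=; rewrite AE Is3 (_ : _ ==> _) ?andbT //.
        by case: (u \in X) ni; case: (nb v u).
    move=> s3 [kv3 km3 _] Is3.
    have s3v : vars s3 1 = v by rewrite kv3.
    have Es : vars s3 6 = simplicial G X v.
      rewrite Is3 (simplicial_last pos_inj so vX zX vz last_z); congr (nat_of_bool _).
      by apply: eq_forallb => u; rewrite ltn_ord.
    apply: wp_if => [|/=|/=].
    * by solve_safe.
    * rewrite Es nat_of_bool_eq1 => Sv; apply: wp_put => /=.
        by rewrite s3v; solve_safe.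
        by lia.
      move=> w; rewrite km3 //= M2b s3v val_eqE Is ltnS_ord.
      by case: (eqVneq w v) => [-> | _] //=; rewrite Sv orbT.
    * rewrite Es nat_of_bool_eq1 => Sv; apply: wp_skip => /= w.
      rewrite km3 //= M2b Is ltnS_ord.
      by case: (eqVneq w v) => [-> | _] //=; rewrite (negbTE Sv) andbF.
  + rewrite s1v M // dead inE nat_of_bool_eq0 negbK => vX; apply: wp_skip => /= w.
    rewrite Is ltnS_ord; case: (eqVneq w v) => [-> | _] //=.
    by rewrite /simplicial (negbTE vX) andbF.
by move=> s1 _ Is v; rewrite /= Is ltn_ord !inE.
Qed.

End Preprocessing.

(** * Far vertices, representatives of the cliques and lists of base neighbours *)

Section Lists.
Variables (n : nat) (G : sgraph n) (W : nat).
Hypothesis wordW : narrays * (n + 1) ^ 2 <= W.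
Local Notation nb := (nb G).
Local Notation wp := (wp n W).
Local Notation base := (base G).
Local Notation last_nb := (last_nb G).

Lemma mark_deadP s (X S : {set 'I_n}) :
  vars s 0 = n -> closed_adjacency G s ->
  indicates s aDead (~: X) -> indicates s aBase S ->
  wp mark_dead s (fun s1 =>
    indicates s1 aDead (~: (X :&: [set v | [forall u in S, ~~ nb v u]]))).
Proof.
move=> sn A dead bS; have hW := n_lt_W wordW.
apply: (wp_forn wordW (I := fun i s1 => forall v : 'I_n,
  mem s1 aDead 0 v = (v \notin X) || (v < i) && [exists u in S, nb v u])) => //.
- by move=> v; rewrite /= orbF dead inE.
- move=> v s1 [kv km _] s1n s1v Is.
  have M a : a != aDead -> mem s1 a = mem s a by move=> ha; rewrite km // inE.
  apply: (wp_forn wordW (I := fun i s2 => forall w : 'I_n, mem s2 aDead 0 w =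
    [|| w \notin X, (w < v) && [exists u in S, nb w u] |
      (w == v) && [exists u : 'I_n, [&& u < i, u \in S & nb v u]]])) => //.
  + have E0 : [exists u : 'I_n, [&& u < 0, u \in S & nb v u]] = false.
      by apply/negbTE/existsPn.
    by move=> w; rewrite E0 andbF orbF -Is.
  + move=> u s2 [kv2 km2 _] s2n s2u Is2.
    have s2v : vars s2 1 = v by rewrite kv2.
    have M2 a : a != aDead -> mem s2 a = mem s a by move=> ha; rewrite km2 ?inE //= M.
    have EE : [exists w : 'I_n, [&& w < u.+1, w \in S & nb v w]] =
        [exists w : 'I_n, [&& w < u, w \in S & nb v w]] || (u \in S) && nb v u.
      apply/existsP/orP => [[w /and3P [+ wS vw]] | [/existsP [w /and3P [wu wS vw]] | /andP [uS vu]]].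
      - rewrite ltnS_ord => /orP [/eqP <- | wu]; first by right; rewrite wS.
        by left; apply/existsP; exists w; rewrite wu wS.
      - by exists w; rewrite ltnS (ltnW wu) wS.
      - by exists u; rewrite ltnSn uS.
    apply: wp_if => [|/=|/=].
    * by rewrite /= s2v s2u; solve_safe.
    * rewrite !M2 // s2v s2u A bS andb_eand nat_of_bool_eq1 => /andP [vu uS].
      apply: wp_put => /=; [by rewrite s2v; solve_safe | by lia | move=> w].
      rewrite s2v val_eqE EE uS vu orbT Is2 andbT.
      by case: eqVneq => //=; rewrite !orbT.
    * rewrite !M2 // s2v s2u A bS andb_eand nat_of_bool_eq1 => ni.
      by apply: wp_skip => w /=; rewrite EE [(u \in S) && _]andbC (negbTE ni) orbF Is2.
  move=> s2 _ Is2 w; rewrite /= Is2 ltnS_ord; congr (nat_of_bool (_ || _)).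
  case: (eqVneq w v) => [-> | _] /=; last by rewrite orbF.
  by rewrite ltnn /=; apply: eq_existsb => u; rewrite ltn_ord.
move=> s1 _ Is v; rewrite /= Is ltn_ord !inE negb_and; congr (nat_of_bool (_ || _)).
rewrite negb_forall_in; apply: eq_existsb => u; by rewrite negbK.
Qed.

Definition represented s := forall v, v \in base -> mem s aRep 0 v = last_nb v.

Lemma representativesP s : vars s 0 = n -> closed_adjacency G s ->
  indicates s aBase base -> wp representatives s represented.
Proof.
move=> sn A bB; have hW := n_lt_W wordW.
apply: (wp_forn wordW (I := fun i s1 => forall v, v \in base -> v < i ->
  mem s1 aRep 0 v = last_nb v)) => //.
- move=> v s1 [kv km _] s1n s1v Is.
  have M a : a != aRep -> mem s1 a = mem s a by move=> ha; rewrite km // inE.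
  apply: wp_if => [|/=|/=].
  + by rewrite /= s1v; solve_safe.
  + rewrite s1v M // bB nat_of_bool_eq1 => vB; have [lB vl max_l] := last_nbP vB.
    apply: (wp_forn wordW (I := fun i s2 =>
      (last_nb v < i -> mem s2 aRep 0 v = last_nb v) /\
      forall w, w \in base -> w < v -> mem s2 aRep 0 w = last_nb w)) => //.
    * move=> u s2 [kv2 km2 _] s2n s2u [Iv Iw].
      have s2v : vars s2 1 = v by rewrite kv2.
      have M2 a : a != aRep -> mem s2 a = mem s a by move=> ha; rewrite km2 ?inE //= M.
      apply: wp_if => [|/=|/=].
      - by rewrite /= s2v s2u; solve_safe.
      - rewrite !M2 // s2v s2u A bB andb_eand nat_of_bool_eq1 => /andP [vu uB].
        apply: wp_put => /=; [by rewrite s2v; solve_safe | by [] |].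
        rewrite s2v s2u; split=> [|w wB wv].
          by rewrite eqxx => lu; apply/eqP; rewrite eqn_leq max_l // -ltnS lu.
        by rewrite (ltn_eqF wv) Iw.
      - rewrite !M2 // s2v s2u A bB andb_eand nat_of_bool_eq1 => ni.
        apply: wp_skip => /=; split=> //; rewrite ltnS_ord => /orP [/eqP Eu | //].
        by rewrite -Eu vl lB in ni.
    move=> s2 _ [Iv Iw] w wB; rewrite /= ltnS_ord => /orP [/eqP -> | ]; last exact: Iw.
    by apply: Iv.
  + rewrite s1v M // bB nat_of_bool_eq1 => nB; apply: wp_skip => w wB /=.
    by rewrite ltnS_ord => /orP [/eqP Ew | ]; [rewrite -Ew wB in nB | apply: Is].
by move=> s1 _ Is v vB; apply: Is.
Qed.

Definition covered (a u : 'I_n) := [forall w in base, nb u w ==> nb a w].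

Definition base_seq (a : 'I_n) : seq 'I_n := [seq u <- enum 'I_n | nb a u && (u \in base)].

Definition base_prefix (a : 'I_n) i := [seq u <- take i (enum 'I_n) | nb a u && (u \in base)].

Lemma base_prefixS a (i : 'I_n) : base_prefix a i.+1 =
  if nb a i && (i \in base) then rcons (base_prefix a i) i else base_prefix a i.
Proof.
by rewrite /base_prefix (take_nth i) ?size_enum_ord // nth_ord_enum filter_rcons.
Qed.

Lemma base_prefix_full a : base_prefix a n = base_seq a.
Proof. by rewrite /base_prefix take_oversize ?size_enum_ord. Qed.

Lemma size_base_prefix a i : size (base_prefix a i) <= i.
Proof.
rewrite size_filter; apply: leq_trans (count_size _ _) _.
by rewrite size_take; case: ltnP.
Qed.

Definition listed s (a : 'I_n) := [/\ mem s aDeg 0 a = size (base_seq a),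
  forall k, k < size (base_seq a) -> mem s aList a k = nth 0 (map val (base_seq a)) k
  & forall u, nb a u -> u \in base -> mem s aPriv a u = covered a u].

Lemma flag_missedP s (a : 'I_n) : vars s 0 = n -> vars s 1 = a -> closed_adjacency G s ->
  indicates s aBase base -> represented s ->
  wp flag_missed s (fun s1 => forall u, u \in base ->
    mem s1 aFlag 0 (last_nb u) = ~~ covered a u).
Proof.
move=> sn sa A bB rep; have hW := n_lt_W wordW.
apply: wp_seq; apply: (wp_forn wordW (I := fun i s1 => forall v : 'I_n, v < i ->
  mem s1 aFlag 0 v = 0)) => //.
  move=> v s1 _ s1n s1v Is; apply: wp_put => /=; [by rewrite s1v; solve_safe | by [] |].
  by move=> w; rewrite s1v ltnS_ord val_eqE; case: eqVneq => //= _; apply: Is.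
move=> s1 [kv km _] flag0.
apply: (wp_forn wordW (I := fun i s2 => forall x : 'I_n, mem s2 aFlag 0 x =
  [exists w : 'I_n, [&& w < i, w \in base, last_nb w == x & ~~ nb a w]])) => //=.
- by rewrite kv.
- move=> x; rewrite flag0 // (_ : [exists w, _] = false) //.
  by apply/negbTE/existsPn.
- move=> v s2 [kv2 km2 _] s2n s2v Is.
  have M2 b : b != aFlag -> mem s2 b = mem s b.
    by move=> hb; rewrite km2 ?inE //= km ?inE.
  have s2a : vars s2 1 = a by rewrite kv2 //= kv.
  have EE (x : 'I_n) : [exists w : 'I_n, [&& w < v.+1, w \in base, last_nb w == x & ~~ nb a w]] =
      [exists w : 'I_n, [&& w < v, w \in base, last_nb w == x & ~~ nb a w]] ||
      [&& v \in base, last_nb v == x & ~~ nb a v].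
    apply/existsP/orP => [[w /and4P [+ wS vw nw]] | [/existsP [w /andP [wv h]] | h]].
    - rewrite ltnS_ord => /orP [/eqP <- | wu]; first by right; rewrite wS vw.
      by left; apply/existsP; exists w; rewrite wu wS vw.
    - by exists w; rewrite ltnS (ltnW wv).
    - by exists v; rewrite ltnSn.
  apply: wp_if => [|/=|/=].
  + by rewrite /= s2v; solve_safe.
  + rewrite s2v M2 // bB nat_of_bool_eq1 => vB; apply: wp_if => [|/=|/=].
    * by rewrite /= s2v s2a; solve_safe.
    * rewrite s2v s2a M2 // A nat_of_bool_eq0 => nav.
      apply: wp_put => /=; [by rewrite s2v M2 // rep //; solve_safe | by lia | move=> x].
      rewrite EE s2v M2 // rep // vB nav andbT Is val_eqE [last_nb v == x]eq_sym.
      by case: eqVneq => //=; rewrite ?orbT ?orbF.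
    * rewrite s2v s2a M2 // A nat_of_bool_eq0 negbK => av; apply: wp_skip => x /=.
      by rewrite EE av !andbF orbF.
  + rewrite s2v M2 // bB nat_of_bool_eq1 => vB; apply: wp_skip => x /=.
    by rewrite EE (negbTE vB) orbF.
move=> s2 _ Is u uB; rewrite /= Is; congr (nat_of_bool _).
rewrite /covered negb_forall_in; apply: eq_existsb => w; rewrite ltn_ord /= negb_imply.
by case wB: (w \in base); rewrite // last_nb_eq // nb_sym.
Qed.

(** Base vertices keep degree 0. The search loads the degree before it tests membership in the base,
    and its time bound uses this value in both cases. *)
Lemma base_listsP s : vars s 0 = n -> closed_adjacency G s -> indicates s aBase base ->
  represented s -> (forall v : 'I_n, mem s aDeg 0 v = 0) ->
  wp base_lists s (fun s1 => (forall a, a \notin base -> listed s1 a) /\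
    forall a, a \in base -> mem s1 aDeg 0 a = 0).
Proof.
move=> sn A bB rep deg0; have hW := n_lt_W wordW.
apply: (wp_forn wordW (I := fun i s1 =>
  (forall a, a \notin base -> a < i -> listed s1 a) /\
  (forall a : 'I_n, (a \in base) || (i <= a) -> mem s1 aDeg 0 a = 0))) => //.
- by split=> // a _; apply: deg0.
- move=> a s1 [kv km _] s1n s1a [Il Id].
  have M b : b \notin [:: aList; aPriv; aFlag; aDeg] -> mem s1 b = mem s b.
    move=> hb; rewrite km //; apply: contra hb; rewrite !inE; lia.
  apply: wp_if => [|/=|/=].
  + by rewrite /= s1a; solve_safe.
  + rewrite s1a M // bB nat_of_bool_eq0 => nB.
    apply: wp_seq; apply: wp_weak (flag_missedP (a := a) _ _ _ _ _) _ => //=.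
    * by move=> u v; rewrite /= M.
    * by move=> u; rewrite /= M.
    * by move=> u uB; rewrite /= M // rep.
    move=> s2 [kv2 km2 _] flag.
    have M2 b : b \notin [:: aList; aPriv; aFlag; aDeg] -> mem s2 b = mem s b.
      move=> hb; rewrite km2 /= ?M //; apply: contra hb; rewrite !inE; lia.
    have s2n : vars s2 0 = n by rewrite kv2.
    have s2a : vars s2 1 = a by rewrite kv2.
    apply: wp_seq; apply: wp_asg => //=.
    apply: wp_seq; apply: (wp_forn wordW (I := fun i s3 =>
      [/\ vars s3 5 = size (base_prefix a i),
         forall k, k < size (base_prefix a i) ->
           mem s3 aList a k = nth 0 (map val (base_prefix a i)) k,
         forall u : 'I_n, u < i -> nb a u -> u \in base -> mem s3 aPriv a u = covered a u
       & forall b : 'I_n, b != a :> nat ->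
           mem s3 aList b =1 mem s1 aList b /\ mem s3 aPriv b =1 mem s1 aPriv b])) => //=.
    * by rewrite /base_prefix take0; split=> // b _; split=> k; rewrite km2.
    * move=> u s3 [kv3 km3 _] s3n s3u [I5 I1 I2 Io].
      have M3 b : b \notin [:: aList; aPriv; aFlag; aDeg] -> mem s3 b = mem s b.
        move=> hb; rewrite km3 /= ?M2 //; apply: contra hb; rewrite !inE; lia.
      have s3a : vars s3 1 = a by rewrite kv3.
      have szu := size_base_prefix a u; have un := ltn_ord u.
      apply: wp_if => [|/=|/=].
      - by rewrite /= s3a s3u; solve_safe.
      - rewrite !M3 // s3a s3u A bB andb_eand nat_of_bool_eq1 => /andP [au uB].
        have Ef : mem s3 aFlag 0 (last_nb u) = ~~ covered a u.
          by rewrite km3 //= flag.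
        apply: wp_seq; apply: wp_put => /=; [by rewrite s3a I5; solve_safe | by [] |].
        rewrite s3a s3u I5; apply: wp_seq; apply: wp_put => /=.
          by rewrite s3a s3u; solve_safe.
          rewrite s3u M3 // rep //; solve_safe.
        rewrite s3a s3u (M3 aRep) // rep // Ef.
        apply: wp_asg => //=; first by rewrite I5; solve_safe.
        rewrite base_prefixS au uB /= I5 size_rcons addn1; split=> //.
        + move=> k; rewrite ltnS map_rcons nth_rcons size_map eqxx /=.
          by rewrite leq_eqVlt => /orP [/eqP -> | lt]; rewrite ?eqxx ?ltnn // lt (ltn_eqF lt) I1.
        + move=> w; rewrite ltnS_ord !val_eqE eqxx; case: eqVneq => [-> | _] /=; last exact: I2.
          by case: (covered a u).
        + by move=> b ba; have [I3 I4] := Io b ba; split=> k; rewrite (negbTE ba) /= ?I3 ?I4.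
      - rewrite !M3 // s3a s3u A bB andb_eand nat_of_bool_eq1 => ni.
        apply: wp_skip => /=; rewrite base_prefixS (negbTE ni); split=> //.
        move=> w; rewrite ltnS_ord => /orP [/eqP -> aw wB | ]; last exact: I2.
        by rewrite aw wB in ni.
    move=> s3 [kv3 km3 _]; rewrite base_prefix_full => -[I5 I1 I2 Io] /=.
    have s3a : vars s3 1 = a by rewrite kv3.
    have M3 : mem s3 aDeg = mem s1 aDeg by rewrite km3 //= km2.
    apply: wp_put => /=; [by rewrite s3a; solve_safe | by [] |].
    rewrite s3a I5 M3; split=> b; last first.
      by rewrite val_eqE; case: eqVneq => [-> | _] /= h; [move: h; rewrite (negbTE nB) ltnn | apply: Id; lia].
    move=> nb_; rewrite ltnS_ord => /orP [/eqP -> | ba].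
      by split; rewrite //= ?eqxx // => u au uB; apply: I2.
    have [I3 I4] := Io b (negbT (ltn_eqF ba)); have [L1 L2 L3] := Il b nb_ ba.
    split=> [|k hk|u bu uB]; rewrite /= ?(ltn_eqF ba) /=.
    - by rewrite M3.
    - by rewrite I3; apply: L2.
    - by rewrite I4; apply: L3.
  + rewrite s1a M // bB nat_of_bool_eq0 negbK => aB; apply: wp_skip => /=; split=> b.
      by move=> nb_; rewrite ltnS_ord => /orP [/eqP Eb | ]; [rewrite Eb aB in nb_ | exact: Il].
    by move=> h; apply: Id; case/orP: h => [-> // | /ltnW ->]; rewrite orbT.
by move=> s1 _ [Il Id]; split=> a aB; [apply: Il | apply: Id; rewrite aB].
Qed.

End Lists.

(** * The search *)

(** A base vertex with no dominator becomes private to the new element; one with a single dominator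
    is lost by it, and the sum tells which element that is. Register 16 reports that a counter fell
    to zero. *)
Definition add_loop :=
  For 13 12 (14 ::= Get aList ?11 ?13 ;;
    If (CEq (vec aDom ?14) (Num 0))
      (aCount @[ ?11 ] ::= Bin Defs.Add (vec aCount ?11) (Get aPriv ?11 ?14))
      (If (CEq (vec aDom ?14) (Num 1))
         (15 ::= vec aSum ?14 ;;
          aCount @[ ?15 ] ::= Bin Defs.Sub (vec aCount ?15) (Get aPriv ?15 ?14) ;;
          If (CEq (vec aCount ?15) (Num 0)) (16 ::= Num 1) Skip) Skip) ;;
    aDom @[ ?14 ] ::= esucc (vec aDom ?14) ;;
    aSum @[ ?14 ] ::= Bin Defs.Add (vec aSum ?14) ?11).

Definition remove_loop :=
  For 13 12 (14 ::= Get aList ?11 ?13 ;;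
    aDom @[ ?14 ] ::= Bin Defs.Sub (vec aDom ?14) (Num 1) ;;
    aSum @[ ?14 ] ::= Bin Defs.Sub (vec aSum ?14) ?11 ;;
    If (CEq (vec aDom ?14) (Num 1))
      (15 ::= vec aSum ?14 ;;
       aCount @[ ?15 ] ::= Bin Defs.Add (vec aCount ?15) (Get aPriv ?15 ?14)) Skip).

Definition remove := aSol @[ ?11 ] ::= Num 0 ;; remove_loop.

(** Extensibility is tested by carrying out the addition and reading the counters. The counter of
    the new vertex is reset first, since an earlier removal may have left it stale. *)
Definition try_add :=
  aSol @[ ?11 ] ::= Num 1 ;; aCount @[ ?11 ] ::= Num 0 ;; 16 ::= Num 0 ;;
  add_loop ;;
  If (CEq (vec aCount ?11) (Num 0)) (16 ::= Num 1) Skip ;;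
  If (CEq ?16 (Num 1)) remove Skip.

Ltac easy_safe := rewrite /nrows /=; repeat split=> //.

(** * Private vertices counted through additions and removals *)

Section PrivateCounts.
Variables (n : nat) (G : sgraph n).
Variable W : nat.
Hypothesis wordW : narrays * (n + 1) ^ 2 <= W.
Implicit Types (a b u v w : 'I_n) (A D : {set 'I_n}) (e : rel 'I_n).
Local Notation nb := (nb G).
Local Notation base := (base G).
Local Notation covered := (covered G).

(* When ndom e u = 1, the only vertex that dominates u is sdom e u. *)
Definition ndom e u := #|[set a | e a u]|.
Definition sdom e u := \sum_(a | e a u) (a : nat).
Definition npriv e a := #|[set u | [&& e a u, covered a u & ndom e u == 1]]|.

(** The loops treat one incidence at a time, so the counters are studied for an arbitrary relation,
    of which domination of the base by a set is an instance. *)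
Definition add_edge e v w : rel 'I_n := fun a u => e a u || (a == v) && (u == w).

Lemma ndom_ext e e' u : (forall a, e a u = e' a u) -> ndom e u = ndom e' u.
Proof. by move=> E; apply: eq_card => a; rewrite !inE E. Qed.

Lemma sdom_ext e e' u : (forall a, e a u = e' a u) -> sdom e u = sdom e' u.
Proof. by move=> E; apply: eq_bigl => a; rewrite E. Qed.

Lemma npriv_ext e e' a : (forall b u, e b u = e' b u) -> npriv e a = npriv e' a.
Proof.
by move=> E; apply: eq_card => u; rewrite !inE E (@ndom_ext e e').
Qed.

Section AddEdge.
Variables (e : rel 'I_n) (v w : 'I_n).
Hypothesis new : ~~ e v w.

Lemma ndom_add u : ndom (add_edge e v w) u = ndom e u + (u == w).
Proof.
case: (eqVneq u w) => [-> | uw]; last first.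
  by rewrite addn0; apply: ndom_ext => a; rewrite /add_edge (negbTE uw) andbF orbF.
rewrite /ndom addn1 (_ : [set a | _] = v |: [set a | e a w]); last first.
  by apply/setP => a; rewrite !inE /add_edge eqxx andbT orbC.
by rewrite cardsU1 inE new.
Qed.

Lemma sdom_add u : sdom (add_edge e v w) u = sdom e u + (if u == w then v : nat else 0).
Proof.
case: (eqVneq u w) => [-> | uw]; last first.
  by rewrite addn0; apply: sdom_ext => a; rewrite /add_edge (negbTE uw) andbF orbF.
have ev : add_edge e v w v w by rewrite /add_edge !eqxx orbT.
rewrite [LHS](bigD1 v ev) [RHS]addnC; congr (_ + _); apply: eq_bigl => a; rewrite /add_edge eqxx andbT.
by case: (eqVneq a v) => [-> | _]; rewrite ?(negbTE new) ?andbT ?orbF ?andbF.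
Qed.

Lemma npriv_add_self :
  npriv (add_edge e v w) v = npriv e v + (covered v w && (ndom e w == 0)).
Proof.
rewrite {1}/npriv; pose S := [set u | [&& e v u, covered v u & ndom e u == 1]].
have -> : [set u | [&& add_edge e v w v u, covered v u & ndom (add_edge e v w) u == 1]] =
    if covered v w && (ndom e w == 0) then w |: S else S.
  apply/setP => u; rewrite inE ndom_add /add_edge eqxx /=.
  case: ifP => c; rewrite ?in_setU1 [u \in S]inE; case: (eqVneq u w) => [-> | _] /=;
    rewrite ?orbF ?addn0 ?orbT ?addn1 ?eqSS ?c //=.
  by rewrite (negbTE new).
case: ifP => _; last by rewrite addn0.
by rewrite cardsU1 inE (negbTE new) addnC.
Qed.

Lemma npriv_add_other a : a != v ->
  npriv (add_edge e v w) a + [&& e a w, covered a w & ndom e w == 1] = npriv e a.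
Proof.
move=> av; rewrite [npriv e a]/npriv (cardsD1 w) inE addnC; congr (_ + _).
apply: eq_card => u; rewrite !inE ndom_add /add_edge (negbTE av) orbF.
case: (eqVneq u w) => [-> | _] /=; last by rewrite addn0.
case eaw: (e a w) => //=; case: eqP => [E|]; last by rewrite andbF.
have : a \in [set b | e b w] by rewrite inE.
rewrite addn1 in E; case: E => /eqP; rewrite cards_eq0 => /eqP ->.
by rewrite inE.
Qed.

End AddEdge.

Lemma sole_dom e w : ndom e w = 1 ->
  exists a, [/\ e a w, sdom e w = a & forall b, e b w -> b = a].
Proof.
move=> /eqP /cards1P [a E]; have H b : e b w = (b == a).
  by move/setP/(_ b): E; rewrite !inE.
exists a; split; [by rewrite H | | by move=> b; rewrite H => /eqP].
by rewrite /sdom (eq_bigl (pred1 a)) ?big_pred1_eq.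
Qed.

Lemma ndom_le e u : ndom e u <= n.
Proof. by rewrite -[leqRHS]card_ord max_card. Qed.

Lemma npriv_le e u : npriv e u <= n.
Proof. by rewrite -[leqRHS]card_ord max_card. Qed.

Lemma sdom_le e u : sdom e u <= n * n.
Proof.
apply: leq_trans (_ : \sum_(a < n) n <= _); last by rewrite sum_nat_const card_ord.
rewrite /sdom big_mkcond; apply: leq_sum => a _; case: ifP => // _; exact: ltnW.
Qed.

Lemma ndom_succ_le e u : ndom e u + 1 <= W.
Proof. by have := ndom_le e u; have := n_lt_W wordW; lia. Qed.

Lemma npriv_add_le e u (b : bool) : npriv e u + b <= W.
Proof. by have := npriv_le e u; have := n_lt_W wordW; case: b; lia. Qed.

Lemma sdom_add_le e u v : sdom e u + v <= W.
Proof.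
apply: leq_trans (_ : n * n + n <= W); last by apply: leq_trans wordW; lia.
by apply: leq_add (sdom_le e u) _; apply: ltnW.
Qed.

Definition edge_to A : rel 'I_n := fun a u => [&& a \in A, nb a u & u \in base].

(** The relation in the middle of a loop, where [v] counts as a dominator of the members of [l]
    only. *)
Definition extended A v (l : seq 'I_n) : rel 'I_n :=
  fun a u => edge_to A a u || (a == v) && (u \in l).

Lemma mem_base_seq a u : (u \in base_seq G a) = nb a u && (u \in base).
Proof. by rewrite mem_filter mem_enum andbT. Qed.

Lemma size_base_seq a : size (base_seq G a) <= n.
Proof. by rewrite -base_prefix_full size_base_prefix. Qed.

Lemma extended_full A v a u : extended A v (base_seq G v) a u = edge_to (v |: A) a u.
Proof.
rewrite /extended /edge_to mem_base_seq !inE.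
by case: (eqVneq a v) => [-> | _] /=; case: (_ \in A); case: (nb _ u); case: (u \in base).
Qed.

Lemma npriv_extensible A : (forall a, a \in A -> 0 < npriv (edge_to A) a) <-> extensible G A.
Proof.
split=> [h | /extensibleP h a aA].
  apply/extensibleP => a aA; have := h a aA; rewrite card_gt0 => /set0Pn [u].
  rewrite inE => /and3P [/and3P [_ au uU] /forall_inP cov /eqP /sole_dom [b [_ _ bs]]].
  exists u; split=> // [w /cov /implyP // | c cA cu].
  have -> : c = b by apply: bs; rewrite /edge_to cA cu.
  by apply/esym/bs; rewrite /edge_to aA au.
have [u [uU au cov only]] := h a aA.
rewrite card_gt0; apply/set0Pn; exists u; rewrite inE /edge_to aA au uU /=.
apply/andP; split; first by apply/forall_inP => w wU; apply/implyP; apply: cov.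
rewrite /ndom (_ : [set b | _] = [set a]) ?cards1 //; apply/setP => b; rewrite !inE uU andbT.
apply/andP/eqP => [[bA bu] | ->]; [exact: only | by []].
Qed.

Local Notation wp := (wp n W).

(** The private counters are specified on [A] only; a removed vertex leaves its own behind. *)
Definition track e A s := [/\ forall u, mem s aDom 0 u = ndom e u,
  forall u, mem s aSum 0 u = sdom e u & forall a, a \in A -> mem s aCount 0 a = npriv e a].

Lemma track_ext e e' A s : (forall a u, e a u = e' a u) -> track e A s -> track e' A s.
Proof.
move=> E [h1 h2 h3]; split=> [u|u|a aA]; rewrite ?h1 ?h2 ?h3 //.
- exact: ndom_ext.
- exact: sdom_ext.
- exact: npriv_ext.
Qed.

Definition tables s := [/\ indicates s aBase base, represented G s,
  forall a, a \notin base -> listed G s a & forall a, a \in base -> mem s aDeg 0 a = 0].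

Lemma tables_mem s s1 : (forall k : nat, k \in [:: aList; aPriv; aBase; aRep; aDeg] -> mem s1 k = mem s k) ->
  tables s -> tables s1.
Proof.
move=> M [h1 h2 h3 h4]; split=> [v|v vB|a aB|a aB].
- by rewrite (M aBase) ?h1.
- by rewrite (M aRep) ?h2.
- have [l1 l2 l3] := h3 a aB; split=> [|k hk|u au uB].
  + by rewrite (M aDeg) ?l1.
  + by rewrite (M aList) ?l2.
  + by rewrite (M aPriv) ?l3.
- by rewrite (M aDeg) ?h4.
Qed.

Lemma listed_nth s v k : tables s -> v \notin base -> k < size (base_seq G v) ->
  exists u, [/\ mem s aList v k = u, nth u (base_seq G v) k = u, nb v u & u \in base].
Proof.
move=> [_ _ L _] vB hk; have [_ l2 _] := L v vB.
case E: (base_seq G v) hk => [//|u0 l] hk; rewrite -E in hk.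
pose u := nth u0 (base_seq G v) k; exists u.
have uin : u \in base_seq G v by apply: mem_nth.
rewrite mem_base_seq in uin; case/andP: uin => vu uB; split=> //.
  by rewrite l2 // (nth_map u0).
by rewrite -E; apply: set_nth_default.
Qed.

Lemma add_loopP s A v : vars s 0 = n -> vars s 11 = v -> vars s 12 = size (base_seq G v) ->
  v \notin base -> v \notin A -> (forall a, a \in A -> a \notin base) -> tables s ->
  track (edge_to A) A s -> mem s aCount 0 v = 0 -> vars s 16 = 0 ->
  (forall a, a \in A -> 0 < npriv (edge_to A) a) ->
  wp add_loop s (fun s1 => track (edge_to (v |: A)) (v |: A) s1 /\
    vars s1 16 = [exists a in A, npriv (edge_to (v |: A)) a == 0]).
Proof.
move=> sn sv sd vB vA AB Ts [t1 t2 t3] cv bad0 pos; have hW := n_lt_W wordW; have W0 : 0 < W by lia.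
pose E k := extended A v (take k (base_seq G v)).
apply: (wp_for (I := fun k s1 => track (E k) (v |: A) s1 /\
    vars s1 16 = [exists a in A, npriv (E k) a == 0])) => //.
- by rewrite sd; have := size_base_seq v; lia.
- have E0 a u : edge_to A a u = E 0 a u by rewrite /E /extended take0 andbF orbF.
  split.
    split=> [u|u|a] /=; rewrite ?t1 ?t2; [exact: ndom_ext|exact: sdom_ext|].
    rewrite !inE => /orP [/eqP -> | aA]; last by rewrite t3 //; apply: npriv_ext.
    rewrite cv; apply/esym/eqP; rewrite cards_eq0; apply/eqP/setP => u.
    by rewrite !inE -E0 /edge_to (negbTE vA).
  rewrite /= bad0; apply/esym/eqP; rewrite eqb0; apply/exists_inPn => a aA.
  by rewrite -(npriv_ext _ E0) -lt0n pos.
- rewrite sd => k s1 hk [kv km _] s1k [[T1 T2 T3] Bad].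
  have Ts1 : tables s1.
    by apply: tables_mem Ts => a ha; apply: km; move: ha; rewrite !inE; lia.
  have [u [Lu nthu vu uB]] := listed_nth Ts1 vB hk.
  have s1v : vars s1 11 = v by rewrite kv.
  have uN : u \notin take k (base_seq G v).
    have /(take_uniq k.+1) : uniq (base_seq G v) by rewrite filter_uniq ?enum_uniq.
    by rewrite (take_nth u) // rcons_uniq nthu => /andP [].
  have new : ~~ E k v u by rewrite /E /extended /edge_to (negbTE vA) eqxx.
  have ES a w : add_edge (E k) v u a w = E k.+1 a w.
    rewrite /E /extended /add_edge (take_nth u) // nthu mem_rcons inE -orbA -andb_orr.
    by rewrite [(w == u) || _]orbC.
  have dE w : ndom (E k.+1) w = ndom (E k) w + (w == u).
    by rewrite -(ndom_ext (e := add_edge (E k) v u)) ?ndom_add.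
  have sE w : sdom (E k.+1) w = sdom (E k) w + (if w == u then v : nat else 0).
    by rewrite -(sdom_ext (e := add_edge (E k) v u)) ?sdom_add.
  (* The three cases for the number of dominators differ in the private counters and share the
     updates of [aDom] and [aSum]. *)
  have tail s2 :
      (forall b : nat, b \in [:: aList; aPriv; aBase; aRep; aDeg; aDom; aSum] -> mem s2 b = mem s1 b) ->
      vars s2 11 = v -> vars s2 14 = u -> 
      (forall a, a \in v |: A -> mem s2 aCount 0 a = npriv (E k.+1) a) ->
      vars s2 16 = [exists a in A, npriv (E k.+1) a == 0] ->
      wp (aDom @[ ?14 ] ::= esucc (vec aDom ?14) ;;
          aSum @[ ?14 ] ::= Bin Defs.Add (vec aSum ?14) ?11) s2
        (fun s3 => track (E k.+1) (v |: A) (tick 7 (setv 13 k.+1 s3)) /\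
           vars (tick 7 (setv 13 k.+1 s3)) 16 = [exists a in A, npriv (E k.+1) a == 0]).
    move=> M s2v s2u Cnt Bad2; apply: wp_seq; apply: wp_put => /=.
    - by rewrite s2u; easy_safe.
    - by rewrite s2u M // T1; rewrite /nrows; repeat split=> //; move=> _; apply: ndom_succ_le.
    apply: wp_put => /=.
    - by rewrite s2u; easy_safe.
    - by rewrite s2u s2v M // T2; rewrite /nrows; repeat split=> //; move=> _; apply: sdom_add_le.
    rewrite s2u s2v !M // T1 T2; split=> //; split=> [w|w|a] //=.
    + by rewrite dE val_eqE M // T1; case: eqVneq => [->|_]; rewrite ?addn0.
    + by rewrite sE val_eqE M // T2; case: eqVneq => [->|_]; rewrite ?addn0.
    + exact: Cnt.
  have other a : a \in A -> npriv (E k.+1) a + [&& E k a u, covered a u & ndom (E k) u == 1] =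
      npriv (E k) a.
    move=> aA; rewrite -(npriv_ext (e := add_edge (E k) v u)) //; apply: npriv_add_other => //.
    by apply: contraNneq vA => <-.
  have self : npriv (E k.+1) v = npriv (E k) v + (covered v u && (ndom (E k) u == 0)).
    by rewrite -(npriv_ext (e := add_edge (E k) v u)) // npriv_add_self.
  have [_ _ L _] := Ts1; have [_ _ Lp] := L v vB.
  apply: wp_seq; apply: wp_asg => //=.
    by rewrite s1v s1k /nrows; repeat split=> //; apply: leq_trans hk (size_base_seq v).
  rewrite s1v s1k Lu; apply: wp_seq; apply: wp_if => [|/=|/=].
  + by easy_safe.
  + rewrite T1 => /eqP d0; apply: wp_put => /=.
    * by rewrite s1v; easy_safe.
    * by rewrite s1v T3 ?setU11 // Lp //; rewrite /nrows; repeat split=> //; move=> _; apply: npriv_add_le.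
    have same a : a \in A -> npriv (E k.+1) a = npriv (E k) a.
      by move=> aA; rewrite -(other a aA) d0 andbF andbF addn0.
    apply: tail => //=; rewrite ?s1v.
    * by move=> b; rewrite !inE; case: eqbP => // ->.
    * move=> a; rewrite val_eqE in_setU1; case: (eqVneq a v) => [-> _ | _] /= => [|aA].
        by rewrite T3 ?setU11 // Lp // self d0 eqxx andbT.
      by rewrite T3 ?in_setU1 ?aA ?orbT // same.
    * rewrite Bad; congr (nat_of_bool _); apply: eq_existsb => a.
      by case aA: (a \in A); rewrite //= same.
  rewrite T1 => d0; apply: wp_if => [|/=|/=].
  + by easy_safe.
  + rewrite T1 => /eqP d1; have [a0 [ea0 s0 only]] := sole_dom d1.
    have a0v : a0 != v by apply: contraNneq new => <-.
    have a0A : a0 \in A.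
      by move: ea0; rewrite /E /extended (negbTE a0v) orbF => /and3P [].
    have a0B := AB _ a0A; have [_ _ Lp0] := L a0 a0B.
    have a0u : nb a0 u by move: ea0; rewrite /E /extended (negbTE a0v) orbF => /and3P [].
    have c0 : npriv (E k) a0 - covered a0 u = npriv (E k.+1) a0.
      by rewrite -(other a0 a0A) ea0 d1 eqxx andbT addnK.
    have cN a : a \in A -> a != a0 -> npriv (E k.+1) a = npriv (E k) a.
      move=> aA ne; rewrite -(other a aA) (_ : E k a u = false) ?addn0 //.
      by apply: contraNF ne => /only ->.
    have cv' : npriv (E k.+1) v = npriv (E k) v by rewrite self (negbTE d0) andbF addn0.
    (* During the loop the counters of [A] only decrease, and here only that of [a0], so a zero once
       reported remains. *)
    have badE : [exists a in A, npriv (E k.+1) a == 0] =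
        [exists a in A, npriv (E k) a == 0] || (npriv (E k.+1) a0 == 0).
      apply/exists_inP/orP => [[a aA a_0] | [/exists_inP [a aA a_0] | a_0]].
      - case: (eqVneq a a0) => [<- | ne]; first by right.
        by left; apply/exists_inP; exists a; rewrite // -cN.
      - exists a => //; move: (other a aA); rewrite (eqP a_0) => /eqP.
        by rewrite addn_eq0 => /andP [].
      - by exists a0.
    apply: wp_seq; apply: wp_asg => //=.
    rewrite T2 s0; apply: wp_seq; apply: wp_put => /=.
    * by easy_safe.
    * by easy_safe.
    rewrite T3 ?in_setU1 ?a0A ?orbT // Lp0 // c0.
    have Cnt a : a \in v |: A -> (if a == a0 :> nat then npriv (E k.+1) a0 else mem s1 aCount 0 a) = npriv (E k.+1) a.
      move=> avA; rewrite val_eqE; case: (eqVneq a a0) => [-> // | ne]; rewrite T3 //.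
      by move: avA; rewrite in_setU1 => /orP [/eqP -> | aA]; rewrite ?cv' ?cN.
    apply: wp_if => [|/=|/=].
    * by easy_safe.
    * rewrite eqxx /= => a_0; apply: wp_asg => //=.
      apply: tail => //=; first by move=> b; rewrite !inE; case: eqbP => // ->.
      by rewrite badE a_0 orbT.
    * rewrite eqxx /= => a_0; apply: wp_skip; apply: tail => //=.
        by move=> b; rewrite !inE; case: eqbP => // ->.
      by rewrite Bad badE (negbTE a_0) orbF.
  rewrite T1 => d1; have cA a : a \in A -> npriv (E k.+1) a = npriv (E k) a.
    by move=> aA; rewrite -(other a aA) (negbTE d1) !andbF addn0.
  apply: wp_skip; apply: tail => //=.
    move=> a; rewrite in_setU1 => /orP [/eqP -> | aA]; rewrite T3 ?in_setU1 ?eqxx ?aA ?orbT //.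
      by rewrite self (negbTE d0) andbF addn0.
    by rewrite cA.
  rewrite Bad; congr (nat_of_bool _); apply: eq_existsb => a.
  by case aA: (a \in A); rewrite //= cA.
rewrite sd => s1 _; rewrite /E take_size => -[T Bad] /=; split.
  have T' : track (extended A v (base_seq G v)) (v |: A) (tick 6 s1) by case: T.
  by apply: track_ext T' => a u; apply: extended_full.
rewrite Bad; congr (nat_of_bool _); apply: eq_existsb => a.
by rewrite (npriv_ext (e' := edge_to (v |: A))) // => b u; apply: extended_full.
Qed.

Lemma remove_loopP s A v : vars s 0 = n -> vars s 11 = v -> vars s 12 = size (base_seq G v) ->
  v \notin base -> v \notin A -> (forall a, a \in A -> a \notin base) -> tables s ->
  track (edge_to (v |: A)) A s ->
  wp remove_loop s (track (edge_to A) A).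
Proof.
move=> sn sv sd vB vA AB Ts tr; have hW := n_lt_W wordW; have W0 : 0 < W by lia.
(* The relation now shrinks from the front of the list: [E k] is obtained from [E k.+1] by
   [add_edge], so the equations for additions are read backwards. *)
pose E k := extended A v (drop k (base_seq G v)).
apply: (wp_for (I := fun k s1 => track (E k) A s1)) => //.
- by rewrite sd; have := size_base_seq v; lia.
- have E0 a u : edge_to (v |: A) a u = E 0 a u by rewrite /E drop0 extended_full.
  by have := track_ext E0 tr.
- rewrite sd => k s1 hk [kv km _] s1k [T1 T2 T3].
  have Ts1 : tables s1.
    by apply: tables_mem Ts => a ha; apply: km; move: ha; rewrite !inE; lia.
  have [u [Lu nthu vu uB]] := listed_nth Ts1 vB hk.
  have s1v : vars s1 11 = v by rewrite kv.
  have dropk : drop k (base_seq G v) = u :: drop k.+1 (base_seq G v).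
    by rewrite (drop_nth u) // nthu.
  have uN : u \notin drop k.+1 (base_seq G v).
    have : uniq (drop k (base_seq G v)) by rewrite drop_uniq // filter_uniq ?enum_uniq.
    by rewrite dropk => /andP [].
  have new : ~~ E k.+1 v u by rewrite /E /extended /edge_to (negbTE vA) eqxx.
  have ES a w : add_edge (E k.+1) v u a w = E k a w.
    by rewrite /E /extended /add_edge dropk inE -orbA -andb_orr [(w == u) || _]orbC.
  have dE w : ndom (E k) w = ndom (E k.+1) w + (w == u).
    by rewrite -(ndom_ext (e := add_edge (E k.+1) v u)) ?ndom_add.
  have sE w : sdom (E k) w = sdom (E k.+1) w + (if w == u then v : nat else 0).
    by rewrite -(sdom_ext (e := add_edge (E k.+1) v u)) ?sdom_add.
  have other a : a \in A -> npriv (E k) a +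
      [&& E k.+1 a u, covered a u & ndom (E k.+1) u == 1] = npriv (E k.+1) a.
    move=> aA; rewrite -(npriv_ext (e := add_edge (E k.+1) v u)) //; apply: npriv_add_other => //.
    by apply: contraNneq vA => <-.
  have [_ _ L _] := Ts1.
  apply: wp_seq; apply: wp_asg => //=.
    by rewrite s1v s1k /nrows; repeat split=> //; apply: leq_trans hk (size_base_seq v).
  rewrite s1v s1k Lu; apply: wp_seq; apply: wp_put => /=; [by easy_safe | by easy_safe |].
  rewrite T1 dE eqxx addnK.
  apply: wp_seq; apply: wp_put => /=; [by easy_safe | by rewrite ?s1v; easy_safe |].
  rewrite T2 sE eqxx s1v addnK.
  have D1 w : (if nat_of_ord w == u then ndom (E k.+1) u else mem s1 aDom 0 w) = ndom (E k.+1) w.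
    by rewrite val_eqE T1 dE; case: eqVneq => [->|_]; rewrite ?addn0.
  have S1 w : (if nat_of_ord w == u then sdom (E k.+1) u else mem s1 aSum 0 w) = sdom (E k.+1) w.
    by rewrite val_eqE T2 sE; case: eqVneq => [->|_]; rewrite ?addn0.
  apply: wp_if => [|/=|/=].
  + by easy_safe.
  + rewrite eqxx => /eqP d1; have [a0 [ea0 s0 only]] := sole_dom d1.
    have a0v : a0 != v by apply: contraNneq new => <-.
    have /and3P [a0A a0u _] : edge_to A a0 u.
      by move: ea0; rewrite /E /extended (negbTE a0v) orbF.
    have [_ _ Lp0] := L a0 (AB _ a0A).
    have c0 : npriv (E k) a0 + covered a0 u = npriv (E k.+1) a0.
      by rewrite -(other a0 a0A) ea0 d1 eqxx andbT.
    apply: wp_seq; apply: wp_asg => //=.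
    rewrite eqxx s0; apply: wp_put => /=.
    * by easy_safe.
    * by rewrite T3 // Lp0 //; easy_safe; move=> _; apply: npriv_add_le.
    rewrite T3 // Lp0 // c0; split=> [w|w|a aA] /=; [exact: D1 | by rewrite -s0; exact: S1 |].
    rewrite val_eqE; case: (eqVneq a a0) => [-> // | ne] /=.
    rewrite T3 // -(other a aA) (_ : E k.+1 a u = false) ?addn0 //.
    by apply: contraNF ne => /only ->.
  + rewrite eqxx => d1; apply: wp_skip; split=> [w|w|a aA] /=; [exact: D1 | exact: S1 |].
    by rewrite T3 // -(other a aA) (negbTE d1) !andbF addn0.
rewrite sd => s1 _; rewrite /E drop_size => T.
have T' : track (extended A v [::]) A (tick 6 s1) by case: T.
by apply: track_ext T' => a u; rewrite /extended in_nil andbF orbF.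
Qed.

Lemma try_addP s D v (A := D :\: base) : vars s 0 = n -> vars s 11 = v ->
  vars s 12 = size (base_seq G v) -> v \notin base -> v \notin D -> tables s ->
  track (edge_to A) A s -> indicates s aSol D -> extensible G A ->
  wp try_add s (fun s1 => if extensible G (v |: A)
    then track (edge_to (v |: A)) (v |: A) s1 /\ indicates s1 aSol (v |: D)
    else track (edge_to A) A s1 /\ indicates s1 aSol D).
Proof.
move=> sn sv sd vB vD Ts [t1 t2 t3] Sol /npriv_extensible pos.
have hW := n_lt_W wordW; have W0 : 0 < W by lia.
have vA : v \notin A by rewrite inE (negbTE vD) andbF.
have AB a : a \in A -> a \notin base by rewrite inE => /andP [].
have A_ne a : a \in A -> (a == v :> nat) = false.
  by move=> aA; rewrite val_eqE; apply: contraNF vA => /eqP <-.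
apply: wp_seq; apply: wp_put => /=; [by rewrite sv; easy_safe | by [] |].
apply: wp_seq; apply: wp_put => /=; [by rewrite sv; easy_safe | by [] |].
apply: wp_seq; apply: wp_asg => //=.
rewrite sv; set s0 := tick _ _.
have Ts0 : tables s0 by apply: tables_mem Ts => k; rewrite !inE => /= h; case: k h => [|[|[|[|[|[|[|[|[|[]]]]]]]]]].
have tr0 : track (edge_to A) A s0.
  by split=> [u|u|a aA]; rewrite ?t1 ?t2 //= A_ne // t3.
apply: wp_seq; apply: wp_weak (add_loopP (v := v) (A := A) _ _ _ _ _ _ Ts0 tr0 _ _ pos) _ => //=.
  by rewrite eqxx.
move=> s1 [kv km _] [tr1 bad1].
have s1v : vars s1 11 = v by rewrite kv.
have s1d : vars s1 12 = size (base_seq G v) by rewrite kv.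
have s1n : vars s1 0 = n by rewrite kv.
have Ts1 : tables s1.
  by apply: tables_mem Ts0 => a ha; apply: km; move: ha; rewrite !inE; lia.
have Sol1 : indicates s1 aSol (v |: D).
  by move=> u; rewrite km //= val_eqE in_setU1 Sol; case: eqVneq.
have [T1 T2 T3] := tr1.
have tail s2 : mem s2 = mem s1 -> vars s2 0 = n -> vars s2 11 = v ->
   vars s2 12 = size (base_seq G v) -> vars s2 16 = ~~ extensible G (v |: A) ->
   wp (If (CEq ?16 (Num 1)) remove Skip) s2 (fun s3 => if extensible G (v |: A)
    then track (edge_to (v |: A)) (v |: A) s3 /\ indicates s3 aSol (v |: D)
    else track (edge_to A) A s3 /\ indicates s3 aSol D).
  move=> M s2n s2v s2d bad; apply: wp_if => [|/=|/=]; first by [].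
  - rewrite bad; case: (boolP (extensible G (v |: A))) => //= next _.
    apply: wp_seq; apply: wp_put => /=; [by rewrite s2v; easy_safe | by [] |].
    rewrite s2v; set s3 := tick _ _.
    have Ts3 : tables s3.
      apply: tables_mem Ts1 => k; rewrite /s3 /= M !inE => h.
      by case: k h => [|[|[|[|[|[|[|[|[|[]]]]]]]]]].
    have tr3 : track (edge_to (v |: A)) A s3.
      split=> [u|u|a aA]; rewrite /s3 /= M ?T1 ?T2 ?T3 //.
      by rewrite in_setU1 aA orbT.
    apply: wp_weak (remove_loopP (v := v) _ _ _ _ _ _ Ts3 tr3) _ => //=.
    move=> s4 [kv4 km4 _] tr4; split=> // u.
    rewrite km4 //= M val_eqE Sol1 in_setU1.
    by case: eqVneq => [->|_]; rewrite ?(negbTE vD).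
  - rewrite bad; case: (boolP (extensible G (v |: A))) => //= ext _.
    apply: wp_skip; split; last by move=> u; rewrite /= M.
    by split=> [u|u|a aA]; rewrite /= M ?T1 ?T2 ?T3.
have vvA : v \in v |: A by rewrite setU11.
have extE : extensible G (v |: A) = ~~ [exists a in A, npriv (edge_to (v |: A)) a == 0] &&
    (0 < npriv (edge_to (v |: A)) v).
  apply/idP/andP => [/npriv_extensible h | [/exists_inPn h1 h2]].
    split; last exact: h.
    by apply/exists_inPn => a aA; rewrite -lt0n h // in_setU1 aA orbT.
  apply/npriv_extensible => a; rewrite in_setU1 => /orP [/eqP -> // | aA].
  by rewrite lt0n h1.
apply: wp_seq; apply: wp_if => [|/=|/=].
- by rewrite /= s1v; easy_safe.
- rewrite s1v T3 // => c0; apply: wp_asg => //=; apply: tail => //=.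
  by rewrite extE (eqP c0) andbF.
- rewrite s1v T3 // => c0; apply: wp_skip; apply: tail => //=.
  by rewrite bad1 extE lt0n c0 andbT negbK.
Qed.

End PrivateCounts.

(** * The moves of the search *)

Definition compute_need :=
  For 1 0 (aNeed @[ ?1 ] ::= Num 0) ;;
  For 1 0 (If (CEq (vec aBase ?1) (Num 1))
    (If (CEq (vec aDom ?1) (Num 0)) (aNeed @[ vec aRep ?1 ] ::= Num 1) Skip) Skip).

Definition forward_outer :=
  If (CEq (vec aBase ?11) (Num 0)) try_add Skip ;; 9 ::= esucc ?9.

Definition forward_base :=
  If (CEq (vec aBase ?11) (Num 1))
    (If (CEq (vec aNeed (vec aRep ?11)) (Num 1))
      (aSol @[ ?11 ] ::= Num 1 ;; aNeed @[ vec aRep ?11 ] ::= Num 0) Skip) Skip ;;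
  9 ::= esucc ?9.

Definition backward_outer :=
  If (CEq (Bin Defs.Sub (vec aSol ?11) (vec aBase ?11)) (Num 1))
    (remove ;; 8 ::= Num 0 ;; 9 ::= esucc ?9) Skip.

(** When the vertex given up is the last of its clique, the excluding branch is empty and the search
    keeps going backward. *)
Definition backward_base :=
  If (CEq (vec aBase ?11) (Num 1))
    (If (CEq (vec aSol ?11) (Num 1))
      (aSol @[ ?11 ] ::= Num 0 ;; aNeed @[ vec aRep ?11 ] ::= Num 1 ;;
       If (CEq (vec aRep ?11) ?11) Skip (8 ::= Num 0 ;; 9 ::= esucc ?9)) Skip) Skip.

Definition write_solution := For 1 0 (If (CEq (vec aSol ?1) (Num 1)) (Out ?1) Skip).

(* Register 8 tells whether the search moves backward and register 9 holds the
   position it has reached. *)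
Definition forward :=
  If (CLt ?9 ?0) (11 ::= ?9 ;; 12 ::= vec aDeg ?11 ;; forward_outer)
    (If (CLt ?9 (Bin Defs.Add ?0 ?0))
      (11 ::= Bin Defs.Sub ?9 ?0 ;; If (CEq ?11 (Num 0)) compute_need Skip ;; forward_base)
      (write_solution ;; Flush ;; 8 ::= Num 1)).

Definition backward :=
  If (CEq ?9 (Num 0)) (10 ::= Num 0)
    (9 ::= Bin Defs.Sub ?9 (Num 1) ;;
     If (CLt ?9 ?0) (11 ::= ?9 ;; 12 ::= vec aDeg ?11 ;; backward_outer)
       (11 ::= Bin Defs.Sub ?9 ?0 ;; backward_base)).

Definition search_step := If (CEq ?8 (Num 0)) forward backward.

Section Steps.
Variables (n : nat) (G : sgraph n) (W : nat).
Hypothesis wordW : narrays * (n + 1) ^ 2 <= W.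
Hypothesis chG : chordal G.
Hypothesis p7G : path_free 7 G.
Implicit Types (a b u v w : 'I_n) (A D : {set 'I_n}).
Local Notation nb := (nb G).
Local Notation base := (base G).
Local Notation last_nb := (last_nb G).
Local Notation wp := (wp n W).
Local Notation feasible := (feasible G).
Local Notation undominated := (undominated G).
Local Notation chosen := (chosen G).
Local Notation vpos := (vpos G).
Local Notation inside := (inside G).
Local Notation after := (after G).
Local Notation tables := (tables G).
Local Notation edge_to := (edge_to G).
Local Notation track := (track G).

Lemma undominated_nb A u v : u \in base -> v \in base -> nb u v ->
  undominated A u = undominated A v.
Proof.
have imp x y : x \in base -> y \in base -> nb x y -> undominated A x -> undominated A y.
  move=> xB yB xy /undominatedP [w [wB xw nd]]; apply/undominatedP; exists w; split=> //.
  by apply: base_clique xw => //; rewrite nb_sym.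
by move=> uB vB uv; apply/idP/idP; apply: imp => //; rewrite nb_sym.
Qed.

Lemma chosen_nb D u v : u \in base -> v \in base -> nb u v -> chosen D u = chosen D v.
Proof.
have imp x y : x \in base -> y \in base -> nb x y -> chosen D x -> chosen D y.
  move=> xB yB xy /chosenP [w [wD wB xw]]; apply/chosenP; exists w; split=> //.
  by apply: base_clique xw => //; rewrite nb_sym.
by move=> uB vB uv; apply/idP/idP; apply: imp => //; rewrite nb_sym.
Qed.

Lemma chosenU1 D u v : v \in base -> chosen (v |: D) u = nb u v || chosen D u.
Proof.
move=> vB; apply/chosenP/orP => [[w [+ wB uw]] | [uv | /chosenP [w [wD wB uw]]]].
- case/setU1P => [<- | wD]; [by left | right]; by apply/chosenP; exists w.
- by exists v; rewrite setU11.
- by exists w; rewrite in_setU1 wD orbT.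
Qed.

Lemma setU1D_base D v : v \in base -> (v |: D) :\: base = D :\: base.
Proof.
by move=> vB; apply/setP => u; rewrite !inE; case: (eqVneq u v) => [-> | _]; rewrite ?vB.
Qed.

Lemma setU1D_outer D v : v \notin base -> (v |: D) :\: base = v |: D :\: base.
Proof.
by move=> vB; apply/setP => u; rewrite !inE; case: (eqVneq u v) => [-> | _]; rewrite ?vB.
Qed.

Lemma vpos_outer_none v : v \in base -> forall u, vpos u != v.
Proof.
move=> vB u; rewrite /vpos; case: ifP => uB; first by have := ltn_ord v; lia.
by rewrite val_eqE; apply: contraFneq uB => ->.
Qed.

Lemma vpos_base_none v : v \notin base -> forall u, vpos u != n + v.
Proof.
move=> vB u; rewrite /vpos; case: ifP => uB; last by have := ltn_ord u; lia.
by rewrite eqn_add2l val_eqE; apply: contraNneq vB => <-.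
Qed.

Definition need_ok s D := forall u, u \in base ->
  mem s aNeed 0 (last_nb u) = undominated (D :\: base) u && ~~ chosen D u.

(** Up to position [n] the array [aNeed] may be out of date, hence the guard of [st_need]: each
    forward passage through position [n] computes it anew, and the base moves maintain it
    afterwards. *)
Record state_of i D s : Prop := StateOf {
  st_n : vars s 0 = n;
  st_pos : vars s 9 = i;
  st_run : vars s 10 = 1;
  st_tables : tables s;
  st_le : i <= n + n;
  st_feasible : feasible i D;
  st_sol : indicates s aSol D;
  st_track : track (edge_to (D :\: base)) (D :\: base) s;
  st_buf : sbuf s = [::];
  st_need : n < i -> need_ok s D
}.

Definition todo (back : bool) i D := if back then after i D else inside i D ++ after i D.

(** A turn keeps the position: the step back over a vertex is followed at once by the step forward
    that excludes it. *)
Definition next_pos (back : bool) i (back' : bool) i' :=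
  if back then if back' then i'.+1 = i else i' = i else back' = false /\ i' = i.+1.

Definition moved back i D s s1 := exists (back' : bool) i' D',
  [/\ state_of i' D' s1, vars s1 8 = back', next_pos back i back' i',
      todo back' i' D' = todo back i D & souts s1 = souts s].

Lemma state_notin i D v s : state_of i D s -> vpos v = i -> v \notin D.
Proof. by move=> [_ _ _ _ _ [lt _ _ _ _] _ _ _ _] vi; apply/negP => /lt; rewrite vi ltnn. Qed.

Lemma state_lt i D v s : state_of i D s -> v \in D -> vpos v < i.
Proof. by move=> [_ _ _ _ _ [lt _ _ _ _] _ _ _ _] /lt. Qed.

Lemma deg_of s v : tables s -> v \notin base -> mem s aDeg 0 v = size (base_seq G v).
Proof. by move=> [_ _ L _] vB; have [] := L v vB. Qed.

Lemma deg_le s v : tables s -> mem s aDeg 0 v <= #|[set u | nb v u]|.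
Proof.
move=> T; case vB: (v \in base); first by case: T => _ _ _ /(_ v vB) ->.
rewrite (deg_of T) ?vB // -(card_uniqP (filter_uniq _ (enum_uniq _))).
by apply: subset_leq_card; apply/subsetP => u; rewrite mem_base_seq inE => /andP [].
Qed.

Lemma movedP c s i D back :
  vars s 0 = n -> vars s 10 = 1 -> tables s -> sbuf s = [::] ->
  [&& all (fun x => x \notin wr c) [:: 0; 10],
      all (fun k => k \notin wa c) [:: aList; aPriv; aBase; aRep; aDeg] & quiet c] ->
  wp c s (fun s1 => exists (back' : bool) j D', [/\ vars s1 8 = back', vars s1 9 = j,
    indicates s1 aSol D', track (edge_to (D' :\: base)) (D' :\: base) s1
    & [/\ j <= n + n, next_pos back i back' j, n < j -> need_ok s1 D', feasible j D' & todo back' j D' = todo back i D]]) ->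
  wp c s (moved back i D s).
Proof.
move=> sn sr Ts bf /and3P [/allP wc /allP ac qc] h.
apply: wp_weak h _ => s1 [kv km kq] [back' [j [D' [s8 s9 Sol tr [jn nx nd fe E]]]]].
have [kb ko] := kq qc; exists back', j, D'; split=> //; split=> //.
- by rewrite kv // wc.
- by rewrite kv // wc.
- by apply: tables_mem Ts => k hk; apply: km; apply: ac.
- by rewrite kb.
Qed.

Lemma forward_outerP s (v : 'I_n) D : state_of v D s -> vars s 8 = 0 -> vars s 11 = v ->
  vars s 12 = mem s aDeg 0 v -> wp forward_outer s (moved false v D s).
Proof.
move=> S s8 sv sd; have [sn sp sr Ts _ fe Sol tr bf _] := S; have hW := n_lt_W wordW.
have vn := ltn_ord v; have [bI _ _ _] := Ts; have W0 : 0 < W by lia.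
have le1 : v.+1 <= n + n by lia.
have nd s1 D' : n < v.+1 -> need_ok s1 D' by rewrite ltnS leqNgt vn.
apply: movedP => //.
apply: wp_seq; apply: wp_if => [|/=|/=]; first by rewrite /= sv; easy_safe.
- rewrite sv bI nat_of_bool_eq0 => vB.
  have vi : vpos v = v by rewrite /vpos (negbTE vB).
  have vD := state_notin S vi; have [_ ext _ _ _] := fe.
  apply: wp_weak (try_addP wordW (v := v) (D := D) _ _ _ vB vD _ _ _ ext) _ => //=.
    by rewrite sd (deg_of Ts vB).
  move=> s1 [kv _ _] /=; have s1p : vars s1 9 = v by rewrite kv.
  have s18 : vars s1 8 = 0 by rewrite kv.
  case: ifP => ext' [tr1 Sol1]; apply: wp_asg => //=.
  + by easy_safe; move=> _; lia.
  + exists false, v.+1, (v |: D); split; rewrite ?setU1D_outer //= ?s1p ?addn1 //.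
    by split; [by [] | by [] | exact: nd | exact: feasible_add vi vB fe ext' | exact/esym/(todo_include vi vD)].
  + by easy_safe; move=> _; lia.
  + exists false, v.+1, D; split; rewrite //= ?s1p ?addn1 //.
    split; [by [] | by [] | exact: nd | exact: feasible_drop vi vB fe |].
    (* The refused branch holds no solution: a feasible [v |: D] would make the extended outer part
       extensible. *)
    apply/esym/(todo_exclude vi vD); apply: inside_nil => //.
      by move=> u; rewrite in_setU1 => /orP [/eqP -> | /(state_lt S)]; rewrite ?vi ?ltnS // => /ltnW.
    by case/(feasible_addV vi vB vD) => _; rewrite ext'.
- rewrite sv bI nat_of_bool_eq0 negbK => vB; apply: wp_skip; apply: wp_asg => //=.
    by easy_safe; move=> _; lia.
  have no := vpos_outer_none vB.
  exists false, v.+1, D; split; rewrite //= ?sp ?addn1 //.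
  by split; [by [] | by [] | exact: nd | exact: feasible_skip fe | exact: esym (todo_skip _ le1 no)].
Qed.

(** [backward] has already decremented register 9, so the invariant is stated with the old position
    put back. *)
Lemma backward_outerP s (v : 'I_n) D : state_of v.+1 D (setv 9 v.+1 s) -> vars s 9 = v ->
  vars s 8 = 1 -> vars s 11 = v -> vars s 12 = mem s aDeg 0 v ->
  wp backward_outer s (moved true v.+1 D s).
Proof.
move=> S s9 s8 sv sd; have [/= sn sp sr Ts _ fe Sol tr bf _] := S; have hW := n_lt_W wordW.
have vn := ltn_ord v; have [bI _ _ _] := Ts; have W0 : 0 < W by lia.
have nd s1 j D' : j <= n -> n < j -> need_ok s1 D' by rewrite leqNgt => /negP.
apply: movedP => //.
apply: wp_if => [|/=|/=]; first by rewrite /= sv; easy_safe.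
- rewrite sv (bI v) (Sol v) /= subn_bool nat_of_bool_eq1 => /andP [vD vB].
  have vi : vpos v = v by rewrite /vpos (negbTE vB).
  have ED : D = v |: (D :\ v) by rewrite setD1K.
  have v'D : v \notin D :\ v by rewrite !inE eqxx.
  rewrite ED in fe; have [fe' _] := feasible_addV vi vB v'D fe.
  apply: wp_seq; apply: wp_seq; apply: wp_put => /=; [by rewrite sv; easy_safe | by [] |].
  set A := (D :\ v) :\: base.
  have EA : D :\: base = v |: A by rewrite {1}ED setU1D_outer.
  have vA : v \notin A by rewrite !inE eqxx andbF.
  have AB a : a \in A -> a \notin base by rewrite inE => /andP [].
  set s0 := tick _ _.
  have Ts0 : tables s0.
    by apply: tables_mem Ts => k; rewrite !inE => /= hk; case: k hk => [|[|[|[|[|[|[|[|[|[]]]]]]]]]].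
  have tr0 : track (edge_to (v |: A)) A s0.
    rewrite EA in tr; have [T1 T2 T3] := tr; split=> [u|u|a aA].
    - exact: T1.
    - exact: T2.
    - by apply: T3; rewrite in_setU1 aA orbT.
  have s0d : vars s0 12 = size (base_seq G v) by rewrite /= sd (deg_of Ts vB).
  apply: wp_weak (remove_loopP (s := s0) wordW sn sv s0d vB vA AB Ts0 tr0) _.
  move=> s1 [kv1 km1 _] tr1; have s1p : vars s1 9 = v by rewrite kv1.
  apply: wp_seq; apply: wp_asg => //=; apply: wp_asg => //=; first by easy_safe; move=> _; lia.
  have E : todo false v.+1 (D :\ v) = todo true v.+1 D by rewrite /todo (after_at D vi) (after_at (D :\ v) vi) vD (negbTE v'D).
  exists false, v.+1, (D :\ v); split; rewrite //= ?s1p ?addn1 //.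
    by move=> u; rewrite km1 //= sv val_eqE in_setD1 Sol; case: eqVneq.
  by split; [lia | by [] | exact: nd | exact: feasible_drop vi vB fe' | exact: E].
- rewrite sv (bI v) (Sol v) subn_bool nat_of_bool_eq1 => nvD; apply: wp_skip.
  exists true, v, D; split=> //; split; [lia | by [] | exact/nd/ltnW | |].
  + case vB: (v \in base); first by apply: feasible_skipV fe; apply: vpos_outer_none.
    apply: (feasible_passV (v := v)) fe; first by rewrite /vpos vB.
    by move: nvD; rewrite vB andbT.
  + case vB: (v \in base); first by apply/esym/after_skip; apply: vpos_outer_none.
    have vi : vpos v = v by rewrite /vpos vB.
    rewrite vB andbT in nvD.
    exact: esym (etrans (after_at D vi) (ifN _ _ nvD)).
Qed.

Lemma compute_needP s D : state_of n D s ->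
  wp compute_need s (fun s1 => need_ok s1 D).
Proof.
move=> S; have [sn sp sr [bI rep _ _] _ fe Sol [T1 _ _] bf _] := S.
have hW := n_lt_W wordW; have W0 : 0 < W by lia.
have Dout v : v \in D -> v \notin base.
  by move=> /(state_lt S); rewrite /vpos; case: ifP => // _; lia.
apply: wp_seq; apply: (wp_forn wordW (I := fun i s1 => forall v : 'I_n, v < i ->
  mem s1 aNeed 0 v = 0)) => //.
  move=> v s1 _ s1n s1v Is; apply: wp_put => /=; [by rewrite s1v; easy_safe | by [] |].
  by move=> w; rewrite s1v ltnS_ord val_eqE; case: eqVneq => //= _; apply: Is.
move=> s1 [kv km _] need0.
pose bad (x w : 'I_n) := [&& w \in base, last_nb w == x & ndom (edge_to (D :\: base)) w == 0].
apply: (wp_forn wordW (I := fun i s2 => forall x : 'I_n, mem s2 aNeed 0 x =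
  [exists w : 'I_n, (w < i) && bad x w])) => //=.
- by rewrite kv.
- move=> x; rewrite need0 //; apply/esym/eqP; rewrite eqb0.
  by apply/existsPn.
- move=> v s2 [kv2 km2 _] s2n s2v Is.
  have M2 k : k != aNeed -> mem s2 k = mem s k.
    by move=> hk; rewrite km2 ?inE //= km ?inE.
  have EE (x : 'I_n) : [exists w : 'I_n, (w < v.+1) && bad x w] =
      [exists w : 'I_n, (w < v) && bad x w] ||
      [&& v \in base, last_nb v == x & ndom (edge_to (D :\: base)) v == 0].
    apply/existsP/orP => [[w /andP []] | [/existsP [w /andP [wv h]] | h]].
    - rewrite ltnS_ord => /orP [/eqP -> | wu h]; first by right.
      by left; apply/existsP; exists w; rewrite wu.
    - by exists w; rewrite ltnS (ltnW wv).
    - by exists v; rewrite ltnSn.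
  apply: wp_if => [|/=|/=]; first by rewrite /= s2v; easy_safe.
  + rewrite s2v M2 // bI nat_of_bool_eq1 => vB; apply: wp_if => [|/=|/=].
    * by rewrite /= s2v; easy_safe.
    * rewrite s2v M2 // T1 => d0.
      apply: wp_put => /=; [by rewrite s2v M2 // rep //; easy_safe | by [] | move=> x].
      rewrite EE s2v M2 // rep // Is val_eqE [x == _]eq_sym vB d0 andbT.
      by case: eqVneq => //=; rewrite ?orbT ?orbF.
    * rewrite s2v M2 // T1 => d0; apply: wp_skip => x /=.
      by rewrite EE (negbTE d0) !andbF orbF.
  + rewrite s2v M2 // bI nat_of_bool_eq1 => vB; apply: wp_skip => x /=.
    by rewrite EE (negbTE vB) orbF.
move=> s2 _ Is u uB; rewrite /= Is.
have -> : chosen D u = false.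
  by apply/negbTE/chosenP => -[w [/Dout]] /negbTE ->.
rewrite andbT; congr (nat_of_bool _); apply/existsP/undominatedP => [[w] | [w [wB uw nd]]].
  rewrite ltn_ord => /and4P [_ wB lw d0]; exists w; split=> //.
    by rewrite -(last_nb_eq uB wB) eq_sym.
  move=> a aA; apply/negP => aw; move: d0; rewrite /ndom cards_eq0 => /eqP/setP/(_ a).
  by rewrite !inE /edge_to aA aw wB.
exists w; rewrite ltn_ord /bad wB eq_sym (last_nb_eq uB wB) uw /= /ndom cards_eq0.
apply/eqP/setP => a; rewrite !inE /edge_to.
by case aA: (a \in D :\: base); rewrite //= (negbTE (nd a aA)).
Qed.

(** Past the last vertex of its clique nothing could be chosen any more; this is what makes the
    excluding branch of a representative empty. *)
Lemma feasible_last D i v : vpos v = i -> v \in base -> feasible i.+1 D ->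
  undominated (D :\: base) v -> ~~ chosen D v -> last_nb v != v.
Proof.
move=> vi vB [_ _ _ _ ex] v_nd nch; have [/(negP nch) // | ] := ex v vB v_nd.
by apply: contraTneq => ->; rewrite vi ltnn.
Qed.

Lemma need_choose s s1 D v : v \in base -> need_ok s D ->
  (forall x : 'I_n, mem s1 aNeed 0 x = if x == last_nb v then 0 else mem s aNeed 0 x) ->
  need_ok s1 (v |: D).
Proof.
move=> vB nd E u uB; rewrite E last_nb_eq // setU1D_base // chosenU1 //.
by case: ifP => uv; rewrite ?andbF // nd.
Qed.

Lemma need_unchoose s s1 D v : v \in base -> need_ok s (v |: D) ->
  undominated (D :\: base) v -> ~~ chosen D v ->
  (forall x : 'I_n, mem s1 aNeed 0 x = if x == last_nb v then 1 else mem s aNeed 0 x) ->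
  need_ok s1 D.
Proof.
move=> vB nd v_nd nch E u uB; rewrite E last_nb_eq //.
case: ifP => uv; first by rewrite (undominated_nb _ uB vB uv) (chosen_nb _ uB vB uv) v_nd nch.
by rewrite nd // setU1D_base // chosenU1 // uv.
Qed.

Lemma forward_baseP s (v : 'I_n) D : state_of (n + v) D s -> need_ok s D ->
  vars s 8 = 0 -> vars s 11 = v -> wp forward_base s (moved false (n + v) D s).
Proof.
move=> S nd s8 sv; have [sn sp sr Ts _ fe Sol tr bf _] := S; have hW := n_lt_W wordW.
have vn := ltn_ord v; have [bI rep _ _] := Ts; have W0 : 0 < W by lia.
have le1 : (n + v).+1 <= n + n by lia.
have pW : n + v + 1 <= W by lia.
have lt_i : n + v < n + n by lia.
apply: movedP => //.
apply: wp_seq; apply: wp_if => [|/=|/=]; first by rewrite /= sv; easy_safe.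
- rewrite sv bI nat_of_bool_eq1 => vB.
  have vi : vpos v = n + v by rewrite /vpos vB.
  have vD := state_notin S vi.
  apply: wp_if => [|/=|/=]; first by rewrite /= sv rep //; easy_safe.
  + rewrite sv rep // nd // nat_of_bool_eq1 => /andP [v_nd nch].
    apply: wp_seq; apply: wp_put => /=; [by rewrite sv; easy_safe | by [] |].
    apply: wp_put => /=; [by rewrite sv rep //; easy_safe | by [] |].
    rewrite sv rep //; apply: wp_asg => //=; first by rewrite sp; easy_safe.
    exists false, (n + v).+1, (v |: D); split; rewrite ?setU1D_base //= ?sp ?addn1 //.
      by move=> u; rewrite /= val_eqE in_setU1 Sol; case: eqVneq.
    split; [by [] | by [] | | exact: feasible_choose fe v_nd nch | exact/esym/(todo_include vi vD)].
    by move=> _; apply: need_choose nd _ => // x; rewrite /= val_eqE.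
  + rewrite sv rep // nd // nat_of_bool_eq1 => no.
    apply: wp_skip; apply: wp_asg => //=; first by rewrite sp; easy_safe.
    exists false, (n + v).+1, D; split; rewrite //= ?sp ?addn1 //.
    split; [by [] | by [] | by [] | | ].
      by apply: (feasible_pass vi vB fe); apply: contra no => /and3P [-> ->].
    apply/esym/(todo_exclude vi vD); apply: inside_nil => //.
      by move=> u; rewrite in_setU1 => /orP [/eqP -> | /(state_lt S)]; rewrite ?vi ?ltnS // => /ltnW.
    by case/(feasible_chooseV vi vB vD) => _ h1 h2; rewrite h1 h2 in no.
- rewrite sv bI nat_of_bool_eq1 => vB.
  apply: wp_skip; apply: wp_asg => //=; first by rewrite sp; easy_safe.
  have no := vpos_base_none vB.
  exists false, (n + v).+1, D; split; rewrite //= ?sp ?addn1 //.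
  by split; [by [] | by [] | by [] | exact: feasible_skip fe | exact: esym (todo_skip _ lt_i no)].
Qed.

Lemma backward_baseP s (v : 'I_n) D : state_of (n + v).+1 D (setv 9 (n + v).+1 s) ->
  vars s 9 = n + v -> vars s 8 = 1 -> vars s 11 = v ->
  wp backward_base s (moved true (n + v).+1 D s).
Proof.
move=> S s9 s8 sv; have [/= sn sp sr Ts _ fe Sol tr bf nd] := S; have hW := n_lt_W wordW.
have {}nd : need_ok s D by apply: nd; rewrite ltnS leq_addr.
have vn := ltn_ord v; have [bI rep _ _] := Ts; have W0 : 0 < W by lia.
have le0 : n + v <= n + n by lia.
have le1 : (n + v).+1 <= n + n by lia.
have pW : n + v + 1 <= W by lia.
apply: movedP => //.
apply: wp_if => [|/=|/=]; first by rewrite /= sv; easy_safe.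
- rewrite sv (bI v) nat_of_bool_eq1 => vB.
  have vi : vpos v = n + v by rewrite /vpos vB.
  apply: wp_if => [|/=|/=]; first by rewrite /= sv; easy_safe.
  + rewrite sv (Sol v) nat_of_bool_eq1 => vD.
    have ED : D = v |: (D :\ v) by rewrite setD1K.
    have v'D : v \notin D :\ v by rewrite !inE eqxx.
    rewrite ED in fe nd; have [fe' v_nd nch] := feasible_chooseV vi vB v'D fe.
    have EA : D :\: base = (D :\ v) :\: base by rewrite {1}ED setU1D_base.
    have E : todo true (n + v).+1 D = inside (n + v).+1 (D :\ v) ++ after (n + v) (D :\ v).
      by rewrite /todo (after_at D vi) vD.
    have Ea : after (n + v).+1 (D :\ v) = after (n + v) (D :\ v).
      exact: etrans (after_at _ vi) (ifN _ _ v'D).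
    have Sol' u : (if u == v then 0 else mem s aSol 0 u) = (u \in D :\ v).
      by rewrite in_setD1 (Sol u); case: eqVneq.
    apply: wp_seq; apply: wp_put => /=; [by rewrite sv; easy_safe | by [] |].
    apply: wp_seq; apply: wp_put => /=; [by rewrite sv rep //; easy_safe | by [] |].
    rewrite sv rep //; apply: wp_if => [|/=|/=]; first by rewrite /= sv; easy_safe.
    * rewrite sv rep // => lv; apply: wp_skip.
      exists true, (n + v), (D :\ v); split; rewrite -?EA //.
      split; [by [] | by [] | | exact: fe' |].
        by move=> _; apply: need_unchoose nd v_nd nch _ => // x; rewrite /= val_eqE.
      rewrite -[RHS]/(todo true (n + v).+1 D) E inside_nil // => [u /(setD1P) [uv uD] | fe1].
        have := state_lt S uD; rewrite ltnS leq_eqVlt => /orP [/eqP Eu | /ltnW //].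
        by move: uv; rewrite (vpos_inj (etrans Eu (esym vi))) eqxx.
      by have := feasible_last vi vB fe1 v_nd nch; rewrite -val_eqE lv.
    * rewrite sv rep // => lv; apply: wp_seq; apply: wp_asg => //=.
      apply: wp_asg => //=; first by rewrite s9; easy_safe.
      exists false, (n + v).+1, (D :\ v); split; rewrite -?EA //= ?s9 ?addn1 //.
      split; [by [] | by [] | | | exact: etrans (congr1 (cat _) Ea) (esym E)].
        by move=> _; apply: need_unchoose nd v_nd nch _ => // x; rewrite /= val_eqE.
      apply: (feasible_pass vi vB fe'); apply/negP => /and3P [_ _].
      by rewrite -val_eqE (negbTE lv).
  + rewrite sv (Sol v) nat_of_bool_eq1 => vD; apply: wp_skip.
    exists true, (n + v), D; split=> //; split=> //; first exact: feasible_passV vi vD fe.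
    exact: esym (etrans (after_at D vi) (ifN _ _ vD)).
- rewrite sv (bI v) nat_of_bool_eq1 => vB; apply: wp_skip.
  have no := vpos_base_none vB.
  exists true, (n + v), D; split=> //; split=> //; first exact: feasible_skipV fe.
  exact/esym/after_skip.
Qed.

Lemma write_solutionP s D : vars s 0 = n -> indicates s aSol D -> sbuf s = [::] ->
  wp write_solution s (fun s1 => lists (sbuf s1) D /\ souts s1 = souts s).
Proof.
move=> sn Sol bf; have hW := n_lt_W wordW; have W0 : 0 < W by lia.
apply: (wp_forn wordW (I := fun i s1 => souts s1 = souts s /\
  sbuf s1 = [seq val u | u <- take i (enum 'I_n) & u \in D])) => //.
- by rewrite take0.
- move=> v s1 [kv km _] s1n s1v [Io Ib].
  have M : mem s1 aSol = mem s aSol by apply: km.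
  have Et : take v.+1 (enum 'I_n) = rcons (take v (enum 'I_n)) v.
    by rewrite (take_nth v) ?size_enum_ord // nth_ord_enum.
  apply: wp_if => [|/=|/=]; first by rewrite /= s1v; easy_safe.
  + rewrite s1v M Sol nat_of_bool_eq1 => vD; apply: wp_out => //=.
    by rewrite Io Ib s1v Et filter_rcons vD map_rcons.
  + rewrite s1v M Sol nat_of_bool_eq1 => vD; apply: wp_skip => /=.
    by rewrite Io Ib Et filter_rcons (negbTE vD).
move=> s1 _ [Io Ib] /=; split=> //.
rewrite /lists Ib take_oversize ?size_enum_ord //; apply: perm_map.
apply: uniq_perm => [||u]; first by rewrite filter_uniq ?enum_uniq.
  exact: enum_uniq.
by rewrite mem_filter !mem_enum andbT.
Qed.

End Steps.

Lemma tcost_forward_outer N : tcost forward_outer N <= 500 * N.+1.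
Proof. by rewrite /=; lia. Qed.

Lemma tcost_backward_outer N : tcost backward_outer N <= 500 * N.+1.
Proof. by rewrite /=; lia. Qed.

Lemma tcost_forward_base N : tcost forward_base N <= 200.
Proof. by rewrite /=; lia. Qed.

Lemma tcost_backward_base N : tcost backward_base N <= 200.
Proof. by rewrite /=; lia. Qed.

Lemma tcost_compute_need N : tcost compute_need N <= 500 * N.+1.
Proof. by rewrite /=; lia. Qed.

Lemma tcost_write_solution N : tcost write_solution N <= 500 * N.+1.
Proof. by rewrite /=; lia. Qed.

(** * The delay *)

Section SearchStep.
Variables (n : nat) (G : sgraph n) (W : nat).
Hypothesis wordW : narrays * (n + 1) ^ 2 <= W.
Hypothesis chG : chordal G.
Hypothesis p7G : path_free 7 G.
Implicit Types (a b u v w : 'I_n) (A D : {set 'I_n}).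
Local Notation wp := (wp n W).

(** An outer position is charged for a neighbourhood. A base position takes constant time, except
    that position [n] also pays for [compute_need]. *)
Definition visit_size i := if insub i is Some v then #|[set u : 'I_n | nb G v u]|
  else if i == n then n else 0.

Definition visit_cost i := 1000 * (visit_size i).+1.

Definition visits i := \sum_(j < i) visit_cost j.

Lemma visitsS i : visits i.+1 = visits i + visit_cost i.
Proof. by rewrite /visits big_ord_recr. Qed.

Lemma visits_le i j : i <= j -> visits i <= visits j.
Proof.
by move=> /subnK <-; elim: (j - i) => [//|k IH]; rewrite addSn visitsS (leq_trans IH) ?leq_addr.
Qed.

(* The time that may still pass before the next output: a backward move to the
   root followed by a forward move to a leaf, and the writing of the output. *)
Definition potential (back : bool) i :=
  1000 * n.+1 + (if back then visits (n + n) + visits i else visits (n + n) - visits i).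

(* k steps are left for the instructions that surround the step. *)
Definition outcome k back i D s s1 :=
  (exists (back' : bool) i' D', [/\ state_of G i' D' s1, vars s1 8 = back',
     todo G back' i' D' = todo G back i D, souts s1 = souts s
     & clk s1 + potential back' i' + k <= clk s + potential back i]) \/
  (back = false /\ exists t (ws : seq nat), [/\ i = n + n, souts s1 = rcons (souts s) (t, ws),
     lists ws D, state_of G i D s1 /\ vars s1 8 = true
     & [/\ clk s <= t <= clk s1, t + k <= clk s + potential back i & clk s1 + k <= t + 40]]) \/
  [/\ back = true, i = 0, souts s1 = souts s, sbuf s1 = [::]
    & vars s1 10 = 0 /\ clk s1 + k <= clk s + potential back i].

(** Each move lowers the potential by at least the cost of one visit. On a turn at [i] the term
    [visits i] changes sign, and it includes the vertex just passed. *)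
Lemma moved_outcome k back i D s s' s1 : (if back then 0 < i else i < n + n) ->
  moved G back i D s' s1 -> souts s' = souts s ->
  clk s1 + k <= clk s + visit_cost (if back then i.-1 else i) -> outcome k back i D s s1.
Proof.
move=> hi [back' [i' [D' [S1 s18 nx E o1]]]] o2 cl; left; exists back', i', D'; split=> //.
  by rewrite o1.
move: nx hi cl; rewrite /next_pos /potential; case: back {E} => [|[-> ->] lt_i].
  case: i => //= i; case: back' {s18} => [[<-]|->] _; rewrite visitsS; lia.
have := visits_le lt_i; rewrite visitsS; lia.
Qed.

Lemma state_of_eq i D s s1 : state_of G i D s -> vars s1 0 = vars s 0 ->
  vars s1 9 = vars s 9 -> vars s1 10 = vars s 10 -> mem s1 = mem s -> sbuf s1 = sbuf s ->
  state_of G i D s1.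
Proof.
move=> [h1 h2 h3 [h4 h5 h6 h6'] h7 h8 h9 [h10 h11 h12] h13 h14] E0 E9 E10 Em Eb.
split; rewrite ?E0 ?E9 ?E10 ?Eb //.
- by split=> [v|v vB|v vB|v vB]; rewrite /listed Em; [exact: h4|exact: h5|exact: h6|exact: h6'].
- by move=> v; rewrite Em; exact: h9.
- by split=> [u|u|a aA]; rewrite Em; [exact: h10|exact: h11|exact: h12].
- by move=> lt u uB; rewrite Em; exact: h14.
Qed.

Lemma outcome_tick k back i D s s1 :
  outcome k.+1 back i D s s1 -> outcome k back i D s (tick 1 s1).
Proof.
case=> [[b [i' [D' [h1 h2 h3 h4 h5]]]] | [[h [t [ws [h1 h2 h3 [h4 h4'] [h5 h6 h7]]]]] | [h h1 h2 h3 [h4 h5]]]].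
- left; exists b, i', D'; split=> //; first by apply: state_of_eq h1 _ _ _ _ _.
  by rewrite /=; lia.
- right; left; split=> //; exists t, ws; split=> //.
    by split=> //; apply: state_of_eq h4 _ _ _ _ _.
  by rewrite /=; split; lia.
- by right; right; split=> //; rewrite /=; split=> //; lia.
Qed.

Lemma outcome_later k m back i D s s1 :
  outcome (k + m) back i D (tick m s) s1 -> outcome k back i D s s1.
Proof.
case=> [[b [i' [D' [h1 h2 h3 h4 h5]]]] | [[h [t [ws [h1 h2 h3 [h4 h4'] [h5 h6 h7]]]]] | [h h1 h2 h3 [h4 h5]]]];
  rewrite /= in h5 *.
- by left; exists b, i', D'; split=> //; lia.
- by right; left; split=> //; exists t, ws; split=> //; rewrite /= in h6; split; lia.
- by right; right; split=> //; split=> //; lia.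
Qed.

Lemma visit_size_lt v : visit_size v = #|[set u : 'I_n | nb G v u]|.
Proof. by rewrite /visit_size valK. Qed.

Lemma forwardP i D s : state_of G i D s -> vars s 8 = 0 ->
  wp forward s (outcome 14 false i D s).
Proof.
move=> S s8; have [sn sp sr Ts le_i fe Sol tr bf nd] := S; have hW := n_lt_W wordW.
have W0 : 0 < W by lia.
have [bI _ _ _] := Ts.
apply: wp_if => [|/=|/=]; first by easy_safe.
  rewrite sp sn => lt_i; pose v := Ordinal lt_i.
  apply: wp_seq; apply: wp_asg => //=.
  apply: wp_seq; apply: wp_asg => //=; first by rewrite sp; easy_safe.
  rewrite sp; set s' := tick _ _.
  have S' : state_of G v D s' by apply: state_of_eq S _ _ _ _ _.
  have h : wp forward_outer s' (moved G false v D s') by apply: forward_outerP.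
  (* All loops of [forward_outer] run up to register 12, the value of [aDeg] for [v], which is at
     most [visit_size i]. *)
  apply: wp_weak (wp_tcost (y := 12) (isT : bounded 12 forward_outer) h) _ => s1 _ [mv cl].
  have lt_i2 : i < n + n by lia.
  apply: (moved_outcome (back := false) (i := i) lt_i2 mv) => //.
  have d1 : mem s aDeg 0 i <= visit_size i by rewrite (visit_size_lt v); exact: (deg_le v Ts).
  have {cl} := leq_trans cl (leq_add (leqnn _) (tcost_forward_outer _)).
  by rewrite /visit_cost /=; lia.
rewrite sp sn -leqNgt => ge_i; apply: wp_if => [|/=|/=].
- by easy_safe; rewrite ?sn; move=> _; lia.
- rewrite sp sn => lt_i; have lt_v : i - n < n by lia.
  pose v := Ordinal lt_v; have Ei : i = n + v by rewrite /= subnKC.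
  apply: wp_seq; apply: wp_asg => //=; rewrite sp sn.
  set s' := tick _ _.
  have S' : state_of G i D s' by apply: state_of_eq S _ _ _ _ _.
  suff h : wp (If (CEq ?11 (Num 0)) compute_need Skip) s' (fun s1 =>
      [/\ state_of G i D s1, need_ok G s1 D, vars s1 8 = 0 /\ vars s1 11 = v, souts s1 = souts s &
        clk s1 + 300 <= clk s + visit_cost i]).
    apply: wp_seq; apply: wp_weak h _ => s1 _ [S1 nd1 [s18 s11] o1 c1].
    have S1' : state_of G (n + v) D s1 by rewrite -Ei.
    have {}h := forward_baseP wordW chG p7G S1' nd1 s18 s11.
    apply: wp_weak (wp_tcost (y := 0) (isT : bounded 0 forward_base) h) _.
    rewrite -Ei => s2 _ [mv cl]; apply/outcome_tick; apply: (moved_outcome (back := false) (i := i) lt_i mv o1).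
    by have := leq_trans cl (leq_add (leqnn _) (tcost_forward_base _)); lia.
  have vs : 1000 <= visit_cost i by rewrite /visit_cost; lia.
  apply: wp_if => [|/=|/=]; first by easy_safe.
  + move=> /eqP i_n; have {}Ei : i = n by lia.
    have S'' : state_of G n D (tick (2 + 1 + 1) s') by move: S'; rewrite {1}Ei => S2; apply: state_of_eq S2 _ _ _ _ _.
    have h := compute_needP wordW S''.
    apply: wp_weak (wp_tcost (y := 0) (isT : bounded 0 compute_need) h) _.
    move=> s1 [kv km kq] [nd1 cl]; have [//|kb ko] := kq; split=> //.
    * split=> //; rewrite ?kv //.
      - by apply: tables_mem Ts => k hk; rewrite km //; move: hk; rewrite !inE; lia.
      - by move=> u; rewrite km //; apply: Sol.
      - by have [T1 T2 T3] := tr; split=> [u|u|a aA]; rewrite km //; [exact: T1|exact: T2|exact: T3].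
      - by rewrite kb.
    * by rewrite !kv.
    * have {cl} := leq_trans cl (leq_add (leqnn _) (tcost_compute_need _)); rewrite /= sn.
      have -> : visit_cost i = 1000 * n.+1.
        by rewrite /visit_cost /visit_size Ei insubF ?ltnn // eqxx.
      by lia.
  + move=> i_n; apply: wp_skip; split=> //.
    * by move=> u uB; apply: nd => //; lia.
    * by move: vs; rewrite /=; lia.
- rewrite sp sn -leqNgt => ge_i2; have Ei : i = n + n by lia.
  have h : wp write_solution (tick 8 (tick 5 s))
      (fun s1 => lists (sbuf s1) D /\ souts s1 = souts s) by apply: write_solutionP.
  have {}h := wp_clk (wp_tcost (y := 0) (isT : bounded 0 write_solution) h).
  apply: wp_seq; apply: wp_weak h _ => s1 [kv km _] [[[li o1] cl] ge].
  apply: wp_seq; apply: wp_flush; apply: wp_asg => //=.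
  right; left; split=> //; exists (clk s1 + 1), (sbuf s1); split=> //=.
  + by rewrite o1.
  + split=> //; split=> //=; rewrite ?kv //.
    * by apply: tables_mem Ts => k hk; rewrite /= km.
    * by move=> u; rewrite /= km //; apply: Sol.
    * by have [T1 T2 T3] := tr; split=> [u|u|a aA]; rewrite /= km //; [exact: T1|exact: T2|exact: T3].
    * by move=> lt u uB; rewrite /= km //; apply: nd.
  + split.
    * by move: ge; rewrite /=; lia.
    * rewrite /potential /= Ei subnn addn0; move: cl; rewrite -[vars _ 0]/(vars s 0) sn => cl.
      by have {cl} := leq_trans cl (leq_add (leqnn _) (tcost_write_solution n)); rewrite /=; lia.
    * by lia.
Qed.

Lemma backwardP i D s : state_of G i D s -> vars s 8 = 1 ->
  wp backward s (outcome 15 true i D s).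
Proof.
move=> S s8; have [sn sp sr Ts le_i fe Sol tr bf nd] := S; have hW := n_lt_W wordW.
have W0 : 0 < W by lia.
apply: wp_if => [|/=|/=]; first by easy_safe.
  rewrite sp => /eqP i0; apply: wp_asg => //=; right; right; split=> //=.
  by split=> //; rewrite /potential; lia.
rewrite sp => i0; have [j Ej] : exists j, i = j.+1 by exists i.-1; lia.
rewrite Ej in S sp le_i fe nd i0 *.
apply: wp_seq; apply: wp_asg => //=; rewrite sp subn1 /=.
apply: wp_if => [|/=|/=]; first by easy_safe.
  rewrite sn => lt_j; pose v := Ordinal lt_j.
  apply: wp_seq; apply: wp_asg => //=.
  apply: wp_seq; apply: wp_asg => //=.
  set s' := tick _ _.
  have S' : state_of G v.+1 D (setv 9 v.+1 s') by apply: state_of_eq S _ _ _ _ _.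
  have h : wp backward_outer s' (moved G true v.+1 D s') by apply: backward_outerP.
  apply: wp_weak (wp_tcost (y := 12) (isT : bounded 12 backward_outer) h) _ => s1 _ [mv cl].
  apply: outcome_tick; apply: (moved_outcome (back := true) (i := j.+1) _ mv) => //=.
  have d1 : mem s aDeg 0 j <= visit_size j by rewrite (visit_size_lt v); exact: (deg_le v Ts).
  have {cl} := leq_trans cl (leq_add (leqnn _) (tcost_backward_outer _)).
  by rewrite /visit_cost /=; lia.
rewrite sn -leqNgt => ge_j; have lt_v : j - n < n by lia.
pose v := Ordinal lt_v; have E : j = n + v by rewrite /= subnKC.
apply: wp_seq; apply: wp_asg => //=; rewrite sn.
set s' := tick _ _.
have S' : state_of G (n + v).+1 D (setv 9 (n + v).+1 s').
  by rewrite -E; apply: state_of_eq S _ _ _ _ _.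
have h : wp backward_base s' (moved G true (n + v).+1 D s') by apply: backward_baseP.
apply: wp_weak (wp_tcost (y := 0) (isT : bounded 0 backward_base) h) _.
rewrite -E => s1 _ [mv cl]; do 2!apply: outcome_tick; apply: (moved_outcome (back := true) (i := j.+1) _ mv) => //=.
have {cl} := leq_trans cl (leq_add (leqnn _) (tcost_backward_base _)).
by rewrite /visit_cost /=; lia.
Qed.

Lemma search_stepP i D s (back : bool) : state_of G i D s -> vars s 8 = back ->
  wp search_step s (outcome 10 back i D s).
Proof.
move=> S s8; have W0 : 0 < W by have := n_lt_W wordW; lia.
have S' : state_of G i D (tick 4 s) by apply: state_of_eq S _ _ _ _ _.
apply: wp_if => [|/=|/=]; first by easy_safe.
  rewrite s8; case: back s8 => //= s8 _.
  by apply: wp_weak (forwardP S' s8) _ => s1 _ o; apply: (outcome_later (m := 4)).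
rewrite s8; case: back s8 => //= s8 _.
apply: wp_weak (backwardP S' s8) _ => s1 _ o; apply: outcome_tick.
exact: (outcome_later (m := 4)).
Qed.

End SearchStep.

(** * The whole program and its running time *)

Definition preprocessing :=
  close_adjacency ;; search ;; mark_simplicial ;; mark_dead ;; mark_simplicial ;;
  representatives ;; base_lists ;; 10 ::= Num 1.

Definition main_loop := While (CEq ?10 (Num 1)) search_step.

(** Loops are nested at most two deep and each runs [n] times. *)
Lemma tcost_preprocessing n : tcost preprocessing n <= 5000 * (n ^ 2 + 1).
Proof.
have : n <= n * n by case: n => // n; rewrite leq_pmulr.
by rewrite /= -mulnn; lia.
Qed.

Section Program.
Variables (n : nat) (G : sgraph n) (W : nat).
Hypothesis wordW : narrays * (n + 1) ^ 2 <= W.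
Hypothesis chG : chordal G.
Hypothesis p7G : path_free 7 G.
Local Notation wp := (wp n W).

Lemma preprocessingP s : vars s 0 = n -> (forall x, 0 < x -> vars s x = 0) ->
  (forall u v : 'I_n, mem s aAdj u v = adj G u v) ->
  (forall a (v : 'I_n), 2 < a -> a < narrays -> mem s a 0 v = 0) ->
  sbuf s = [::] -> souts s = [::] ->
  wp preprocessing s (fun s1 => [/\ state_of G 0 set0 s1, vars s1 8 = 0, souts s1 = [::]
    & clk s1 <= clk s + 5000 * (n ^ 2 + 1)]).
Proof.
move=> sn sx A0 m0 bf o; have hW := n_lt_W wordW; have W0 : 0 < W by lia.
suff h : wp preprocessing s (fun s1 => vars s1 10 = 1 /\ tables G s1).
  have {}h := wp_tcost (y := 0) (isT : bounded 0 preprocessing) h.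
  apply: wp_weak h _ => s1 [kv km kq] [[s10 T] cl]; have [//|kb ko] := kq.
  split; last by have := tcost_preprocessing n; move: cl; rewrite sn; lia.
  - split=> //; rewrite ?kv ?kb ?sn ?sx ?leq_addr ?km //.
    + exact: feasible0.
    + by move=> v; rewrite km // m0 // in_set0.
    + have Z X : (set0 : {set 'I_n}) :\: X = set0 by rewrite set0D.
      rewrite Z; split=> [u|u|a]; last by rewrite in_set0.
        rewrite km // m0 //; apply/esym/eqP; rewrite cards_eq0; apply/eqP/setP => a.
        by rewrite !inE /edge_to in_set0.
      by rewrite km // m0 // /sdom big1 // => a; rewrite /edge_to in_set0.
  - by rewrite kv // sx.
  - by rewrite ko.
apply: wp_seq; apply: wp_weak (close_adjacencyP wordW sn A0) _ => s1 [kv1 km1 _] A1.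
have s1n : vars s1 0 = n by rewrite kv1.
apply: wp_seq; apply: wp_weak (searchP wordW s1n A1 _ _) _.
- by move=> v; rewrite km1 // m0.
- by move=> v; rewrite km1 // m0.
move=> s2 [kv2 km2 _] [/search_prefix_full [p0 pi so] _].
have s2n : vars s2 0 = n by rewrite kv2.
have A2 : closed_adjacency G s2 by move=> u v; rewrite km2.
have vis : visit_order G s2 (fun v => mem s2 aPos 0 v) by [].
have dead2 : indicates s2 aDead (~: [set: 'I_n]).
  by move=> v; rewrite km2 // km1 // m0 // !inE.
have base2 : indicates s2 aBase (set0 : {set 'I_n}).
  by move=> v; rewrite km2 // km1 // m0 // inE.
apply: wp_seq; apply: wp_weak (mark_simplicialP wordW chG s2n A2 vis dead2 base2) _.
move=> s3 [kv3 km3 _]; rewrite set0U -/(simplicials G) => base3.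
have s3n : vars s3 0 = n by rewrite kv3.
have A3 : closed_adjacency G s3 by move=> u v; rewrite km3.
have dead3 : indicates s3 aDead (~: [set: 'I_n]) by move=> v; rewrite km3.
apply: wp_seq; apply: wp_weak (mark_deadP wordW s3n A3 dead3 base3) _.
move=> s4 [kv4 km4 _]; rewrite setTI -/(far_vertices G) => dead4.
have s4n : vars s4 0 = n by rewrite kv4.
have A4 : closed_adjacency G s4 by move=> u v; rewrite km4.
have base4 : indicates s4 aBase (simplicials G) by move=> v; rewrite km4.
have vis4 : visit_order G s4 (fun v => mem s2 aPos 0 v).
  by split=> // v; rewrite km4 // km3.
apply: wp_seq; apply: wp_weak (mark_simplicialP wordW chG s4n A4 vis4 dead4 base4) _.
move=> s5 [kv5 km5 _] base5'.
have s5n : vars s5 0 = n by rewrite kv5.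
have A5 : closed_adjacency G s5 by move=> u v; rewrite km5.
have base5 : indicates s5 aBase (base G).
  by move=> v; rewrite base5' in_base !inE.
apply: wp_seq; apply: wp_weak (representativesP wordW s5n A5 base5) _.
move=> s6 [kv6 km6 _] rep6.
have s6n : vars s6 0 = n by rewrite kv6.
have A6 : closed_adjacency G s6 by move=> u v; rewrite km6.
have base6 : indicates s6 aBase (base G) by move=> v; rewrite km6.
apply: wp_seq; apply: wp_weak (base_listsP wordW s6n A6 base6 rep6 _) _.
  by move=> v; rewrite km6 // km5 // km4 // km3 // km2 // km1 // m0.
move=> s7 [kv7 km7 _] [L7 D7]; apply: wp_asg => //=; split=> //.
split=> [v|v vB|v vB|v vB]; last exact: D7.
- by rewrite /= km7.
- by rewrite /= km7 // rep6.
- by have [] := L7 v vB.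
Qed.

(** The potential of a backward search that starts at a leaf, plus the 40 instructions allowed after
    an output. *)
Definition delay_bound := 40 + 1000 * n.+1 + 2 * visits G (n + n).

Lemma sum_adj_edges : \sum_(v : 'I_n) #|[set u | adj G v u]| <= 2 * #|edges G|.
Proof.
pose S := [set p : 'I_n * 'I_n | adj G p.1 p.2].
have -> : \sum_(v : 'I_n) #|[set u | adj G v u]| = #|S|.
  rewrite -sum1_card (eq_bigl (fun p => predT p.1 && adj G p.1 p.2)); last first.
    by move=> p; rewrite !inE.
  rewrite -(pair_big_dep predT (fun v u => adj G v u) (fun _ _ => 1)) /=.
  by apply: eq_bigr => v _; rewrite sum1dep_card.
pose T := [set (p.2, p.1) | p in edges G].
have sub : S \subset edges G :|: T.
  apply/subsetP => -[u v]; rewrite !inE /= => uv; case: (ltngtP u v) => /=.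
  - by rewrite uv.
  - move=> vu; apply/imsetP; exists (v, u) => //; by rewrite inE /= vu adj_sym.
  - by move=> /val_inj E; rewrite E adj_irrefl in uv.
apply: leq_trans (subset_leq_card sub) _; apply: leq_trans (leq_card_setU _ _) _.
by rewrite mul2n -addnn leq_add2l leq_imset_card.
Qed.

(** With m edges, the closed neighbourhoods have total size at most 2m + n, position [n] adds n, and
    each of the 2n positions adds one: 1000(2m + 2n) + 2000n. *)
Lemma visits_bound : visits G (n + n) <= 2000 * #|edges G| + 4000 * n.
Proof.
have E : visits G (n + n) = 1000 * (\sum_(j < n + n) (visit_size G j)) + 1000 * (n + n).
  rewrite /visits big_distrr /= -[X in _ = _ + 1000 * X]card_ord -sum1_card big_distrr /=.
  by rewrite -big_split /=; apply: eq_bigr => j _; rewrite /visit_cost mulnS muln1 addnC.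
have B1 : \sum_(j < n) visit_size G (lshift n j) <= 2 * #|edges G| + n.
  apply: leq_trans (_ : \sum_(v < n) (#|[set u | adj G v u]| + 1) <= _); last first.
    by rewrite big_split /= sum1_card card_ord leq_add2r sum_adj_edges.
  apply: leq_sum => v _; rewrite /= visit_size_lt.
  apply: leq_trans (_ : #|v |: [set u | adj G v u]| <= _); last first.
    by rewrite cardsU1 addnC leq_add2l; case: (_ \notin _).
  by apply: subset_leq_card; apply/subsetP => u; rewrite !inE /nb.
have B2 : \sum_(j < n) visit_size G (rshift n j) <= n.
  have E2 (j : 'I_n) : visit_size G (rshift n j) = if val j == 0 then n else 0.
    by rewrite /visit_size /= insubF ?ltnNge ?leq_addr // -[X in _ == X]addn0 eqn_add2l.
  rewrite (eq_bigr _ (fun j _ => E2 j)) -big_mkcond /= sum_nat_const.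
  rewrite -[leqRHS]mul1n leq_mul2r; apply/orP; right; apply/card_le1_eqP => u v.
  by rewrite !unfold_in => /eqP u0 /eqP v0; apply: val_inj; rewrite /= u0 v0.
rewrite E big_split_ord.
apply: leq_trans (leq_add (leq_mul (leqnn 1000) (leq_add B1 B2)) (leqnn _)) _.
by clear; lia.
Qed.

(** Lexicographic induction on the number of outputs to come and on the potential. [last] is the
    time of the previous output, or the end of the preprocessing; the hypothesis on it says that the
    potential still fits in the current delay. *)
Lemma main_loopP (back : bool) i D s last : state_of G i D s -> vars s 8 = back ->
  last <= clk s -> clk s + potential G back i <= last + delay_bound ->
  exists s1 l, [/\ ex n W main_loop s s1, souts s1 = souts s ++ l, sbuf s1 = [::],
    all2 (@lists n) (unzip2 l) (todo G back i D)
    & path (fun t t' => t <= t' <= t + delay_bound) last (rcons (unzip1 l) (clk s1))].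
Proof.
have [m] := ubnP (size (todo G back i D)).
have [k] := ubnP (potential G back i).
elim: m k back i D s last => // m IHm k; elim: k => // k IHk back i D s last lt_k lt_m S s8 ls cs.
have W0 : 0 < W by have := n_lt_W wordW; lia.
have S' : state_of G i D (tick 4 s) by apply: state_of_eq S _ _ _ _ _.
have [s1 h o] := search_stepP wordW chG p7G S' s8.
have le_clk := ex_clk h; rewrite /= in le_clk.
have {}o : outcome G 5 back i D s (tick 1 s1).
  by apply: (outcome_tick wordW); apply: (outcome_later wordW (m := 4)).
have [_ _ sr _ _ _ _ _ _ _] := S.
have safe_c s2 : safec n W (CEq ?10 (Num 1)) s2 by split.
have loop s2 : ex n W main_loop (tick 1 s1) s2 -> ex n W main_loop s s2.
  by move=> h2; apply: ex_whilet (safe_c s) _ h h2; rewrite /= sr.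
case: o => [[b [j [E [h1 h2 h3 h4 h5]]]] | [[h0 [t [ws [h1 h2 h3 [h4 h4'] [h5 h6 h7]]]]] | [h0 h1 h2 h3 [h4 h5]]]].
- have [||||s2 [l [e1 e2 e3 e4 e5]]] := IHk b j E (tick 1 s1) last _ _ h1 h2.
  + by move: h5; rewrite /=; lia.
  + by rewrite h3.
  + by rewrite /=; lia.
  + by move: h5; rewrite /=; lia.
  by exists s2, l; split=> //; [exact: loop | rewrite e2 h4 | rewrite -h3].
- subst back i; have lE : inside G (n + n) D = [:: D].
    by apply: inside_leaf => //; case: S.
  have tE : todo G false (n + n) D = D :: todo G true (n + n) D by rewrite /todo lE.
  have [||||s2 [l [e1 e2 e3 e4 e5]]] :=
      IHm (potential G true (n + n)).+1 true (n + n) D (tick 1 s1) t _ _ h4 h4'.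
  + by [].
  + by move: lt_m; rewrite tE.
  + by move: h5; rewrite /=; lia.
  + by move: h7; rewrite /potential /delay_bound /=; lia.
  exists s2, ((t, ws) :: l); split=> //; first exact: loop.
  + by rewrite e2 h2 cat_rcons.
  + by rewrite tE /= h3.
  + by rewrite /= e5 andbT; apply/andP; split; lia.
- subst back i; exists (tick 5 (tick 1 s1)), [::]; split=> //=.
  + by apply: loop; apply: ex_whilef (safe_c _) _; rewrite /= in h4 *; rewrite h4.
  + by rewrite cats0.
  + by rewrite andbT; move: h5; rewrite /=; lia.
Qed.

End Program.

Definition input_state n (G : sgraph n) : state := {|
  vars := reg (input G);
  mem := fun a i j => ram (input G) (addr n a i j);
  clk := 0; sbuf := [::]; souts := [::]
|}.

(** As addresses are injective, the input fills array 0 exactly, and all other arrays start at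
    zero. *)
Lemma input_ram n (G : sgraph n) a i j : a < narrays -> i < nrows n a -> j < n ->
  ram (input G) (addr n a i j) =
  [exists u : 'I_n, exists v : 'I_n, [&& a == 0, i == u, j == v & adj G u v]].
Proof.
move=> ha hi hj; rewrite /=; congr (nat_of_bool _); apply: eq_existsb => u.
apply: eq_existsb => v.
have -> : u * n + v = addr n 0 u v by rewrite /addr /row_of /matrix_base; lia.
apply/andP/and4P => [[/eqP E uv] | [/eqP -> /eqP -> /eqP -> uv]]; last by [].
by have [-> -> ->] :=
  addr_inj (leqnn _) (leqnn _) (a' := 0) hi (ltn_ord u : u < nrows n 0) hj (ltn_ord v) E.
Qed.

Lemma input_agree n (G : sgraph n) W space : narrays * (n + 1) ^ 2 <= W ->
  (3 * n + narrays) * n <= space -> agree n W space (input_state G) (input G).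
Proof.
move=> hW hS; have nW := n_lt_W hW.
split=> //; split=> [a ha | a | x]; last by rewrite /=; case: eqP => _; lia.
  rewrite /=; apply/eqP; rewrite eqb0; apply/existsPn => u; apply/existsPn => v.
  rewrite negb_and; apply/orP; left.
  have h : (u.+1 * n <= n * n) by rewrite leq_mul2r ltn_ord orbT.
  by have := ltn_ord v; move: h ha hS; rewrite mulSn; lia.
by apply: leq_trans (leq_b1 _) _; lia.
Qed.

Theorem theorem19 :
  exists (P : program) (C k : nat),
  forall (n : nat) (G : sgraph n),
    path_free 7 G -> chordal G ->
    enumerates P (input G) (min_dom_sets G)
      (* preprocessing time *) (C * (n ^ 2 + 1))
      (* delay *)              (C * (n + #|edges G| + 1))
      (* space, in words *)    (C * (n ^ 2 + 1))
      (* largest word *)       (C * (n + 1) ^ k).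
Proof.
(* The delay is the most demanding bound: with m edges, 40 + 1000(n + 1) + 2(2000m + 4000n) is 9000n
   + 4000m + 1040. The exponent 2 comes from addresses and sums. *)
exists (code (Seq preprocessing main_loop) 0), (100 * 100), 2 => n G p7G chG.
have hW : narrays * (n + 1) ^ 2 <= 100 * 100 * (n + 1) ^ 2 by rewrite leq_mul2r orbT.
have hS : (3 * n + narrays) * n <= 100 * 100 * (n ^ 2 + 1).
  have : n <= n * n by case: (n) => // m; rewrite leq_pmulr.
  by rewrite -mulnn; lia.
have A := input_agree G hW hS.
have inp := @input_ram n G.
have [|||s1 h1 [S s18 o1 c1]] :=
    preprocessingP hW chG (s := input_state G) erefl _ _ _ erefl erefl.
- by case.
- move=> u v; rewrite /input_state [mem _ _ _ _]inp //.
  congr nat_of_bool; apply/existsP/idP => [[u' /existsP[v' /and4P[_ /eqP e /eqP e' uv]]] | uv].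
    by rewrite (val_inj e) (val_inj e').
  by exists u; apply/existsP; exists v; rewrite !eqxx.
- move=> a v a2 a16; rewrite /input_state [mem _ _ _ _]inp //; last by rewrite /nrows; case: ifP; have := ltn_ord v; lia.
  by apply/eqP; rewrite eqb0; apply/existsPn => u'; apply/existsPn => v'; rewrite gtn_eqF //; lia.
have pot : clk s1 + potential G false 0 <= clk s1 + delay_bound G.
  by rewrite leq_add2l /potential /delay_bound; lia.
have [s2 [l [h2 o2 b2 l2 t2]]] :=
  main_loopP hW chG p7G (back := false) S s18 (leqnn _) pot.
have h := ex_seq h1 h2.
have [F [c [r halt b o]]] := run_program hW hS h A erefl erefl.
rewrite o1 /= in o2; rewrite /todo cats0 in l2.
split=> //; exists (clk s2), c, (inside G 0 set0), (clk s1).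
split; first 1 last.
- exact: perm_inside.
- by rewrite b b2 o o2.
- by rewrite /= add0n in c1; apply: leq_trans c1 _; rewrite leq_mul2r; apply/orP; right; lia.
- rewrite o o2; apply: sub_path t2 => t t' /andP[-> le_t'] /=.
  apply: leq_trans le_t' _; rewrite leq_add2l /delay_bound.
  by move: (visits_bound G); move: (visits G _) #|_| => x y; lia.
- by [].
Qed.
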